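(* Let $\Omega\subset\mathbb{R}^2$ and let $\mathbb{T}$ be shape-regular in the sense that there is $M_1<\infty$ such that every triangle $T\in\mathcal{T}\in\mathbb{T}$ contains a closed ball of radius $r_T$ and is contained in a closed ball of radius $R_T\le M_1r_T$. There is a constant $C$, independent of the mesh-size (depending only on the shape regularity of $\mathbb{T}$), such that the following holds. Let $\mathcal{T}\in\mathbb{T}$ with set of edges $\mathcal{E}$, let $\widehat{\mathcal{T}}\in\mathbb{T}$ be an admissible refinement with set of edges $\widehat{\mathcal{E}}$, and put $\mathcal{E}':=\mathcal{E}\setminus\widehat{\mathcal{E}}$. Given $u_M\in M(\mathcal{T})$, let $\widehat{u}_M^*:=\widehat{I}_M(J_2u_M)\in M(\widehat{\mathcal{T}})$, where $J_2$ is the local companion operator for piecewise quadratics associated with $\mathcal{E}'$. Then $$\sum_{T\in\mathcal{T}}\Vert D^2_{\mathrm{NC}}(\widehat{u}_M^*-u_M)\Vert_{L^2(T)}^2\le C\sum_{E\in\mathcal{E}\setminus\widehat{\mathcal{E}}}h_E\Vert[D^2_{\mathrm{NC}}u_M]_E\times\nu_E\Vert_{L^2(E)}^2.$$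
   Context: $\Omega\subset\mathbb{R}^2$ is a bounded polygonal Lipschitz domain; $\mathbb{T}$ is the set of regular triangulations (closed triangles, in the sense of Ciarlet) obtained from an initial one by successive admissible refinements. $\mathcal{T}(z)$ is the set of triangles with vertex $z$, $\mathcal{N}(T),\mathcal{E}(T)$ vertices and edges of $T$, $\mathcal{N}(E)$ the end points of $E$, $\mathcal{E}(\partial\Omega),\mathcal{N}(\partial\Omega)$ boundary edges and vertices, $h_E=|E|$, $\mathrm{mid}$ the centroid; $D^2_{\mathrm{NC}},\nabla_{\mathrm{NC}}$ the piecewise Hessian and gradient. Each edge has a unit normal $\nu_E$ of fixed orientation, $\nu_T$ is the outward normal of $T$; $[v]_E=v|_{T_+}-v|_{T_-}$ on interior edges $E=\partial T_+\cap\partial T_-$ and $[v]_E=v$ on boundary edges; $[D^2_{\mathrm{NC}}v]_E\times\nu_E$ denotes the tangential components of the jump (row-wise). $P_k(\mathcal{T})$: piecewise polynomials of degree $\le k$. Hats denote the same objects for $\widehat{\mathcal{T}}$. Morley space: $M(\mathcal{T})$ is the set of $v\in P_2(\mathcal{T})$ continuous at all vertices with $\nabla_{\mathrm{NC}}v$ continuous at $\mathrm{mid}(E)$ for all interior edges, $v=0$ at $\mathcal{N}(\partial\Omega)$ and $\nabla_{\mathrm{NC}}v(\mathrm{mid}(E))=0$ for all $E\in\mathcal{E}(\partial\Omega)$. The fine-level Morley interpolation $\widehat{I}_Mv\in M(\widehat{\mathcal{T}})$ is characterised by $(\widehat{I}_Mv)(z)=v(z)$ for all vertices $z$ of $\widehat{\mathcal{T}}$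 and $\partial(\widehat{I}_Mv)/\partial\nu_E(\mathrm{mid}(E))=\frac1{|E|}\int_E\partial v/\partial\nu_E\,\mathrm{d}s$ for all $E\in\widehat{\mathcal{E}}$. Side-connectivity: for $K\in\mathcal{T}$, $z\in\mathcal{N}(K)$ let $\mathcal{T}(K,z)$ be the set of all $T\in\mathcal{T}$ for which there are $T_1,\dots,T_J\in\mathcal{T}(z)$ with $T_1=K$, $T_J=T$ and $\partial T_j\cap\partial T_{j+1}\in\mathcal{E}'$ for $j=1,\dots,J-1$. Let $\mathcal{E}'(\partial\Omega):=\mathcal{E}'\cap\mathcal{E}(\partial\Omega)$. HCT: for $K\in\mathcal{T}$ let $\mathcal{K}(K)$ be the subdivision of $K$ into the three triangles $\mathrm{conv}\{E,\mathrm{mid}(K)\}$, $E\in\mathcal{E}(K)$, and $HCT'(K):=\{v\in H^2(K):v\in P_3(\mathcal{K}(K))\}$, whose degrees of freedom are $v(z),\nabla v(z)$ for $z\in\mathcal{N}(K)$ and $\partial v/\partial\nu_E(\mathrm{mid}(E))$ for $E\in\mathcal{E}(K)$. Local companion: for $v_2\in P_2(\mathcal{T})$ and $K\in\mathcal{T}$ define $(J_1v_2)|_K\in HCT'(K)$ by $\partial(J_1v_2)|_K/\partial\nu_E(\mathrm{mid}(E))=\partial v_2|_K/\partial\nu_E(\mathrm{mid}(E))$ for $E\in\mathcal{E}(K)$, $(J_1v_2)|_K(z)=v_2|_K(z)$ for $z\in\mathcal{N}(K)$, and $\nabla(J_1v_2)|_K(z)=0$ if $z\in\mathcal{N}(E)$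 for some $E\in\mathcal{E}(K)\cap\mathcal{E}'(\partial\Omega)$, and $\nabla(J_1v_2)|_K(z)=|\mathcal{T}(K,z)|^{-1}\sum_{T\in\mathcal{T}(K,z)}(\nabla v_2|_T)(z)$ otherwise. For $K=\mathrm{conv}\{z_1,z_2,z_3\}=\mathrm{conv}\{E,z_3\}$ with barycentric coordinates $\varphi_1,\varphi_2,\varphi_3$ let $b_{E,K}:=-30(\nu_K\cdot\nu_E)\,\mathrm{dist}(z_3,E)\,\varphi_1^2\varphi_2^2\varphi_3$ on $K$ (zero outside $K$), so that $\frac1{|E|}\int_E\partial b_{E,K}|_K/\partial\nu_E\,\mathrm{d}s=1$, and set $$(J_2v_2)|_K:=(J_1v_2)|_K+\sum_{E\in\mathcal{E}(K)}\Big(\frac1{|E|}\int_E\frac{\partial(v_2-J_1v_2)|_K}{\partial\nu_E}\,\mathrm{d}s\Big)b_{E,K}.$$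
   Formalization: With the printed zero rule for ∇J_1 (edges of K only) J_2u_M can be discontinuous across refined edges; the estimate is proved for its triangle-wise interpolant, and for the rule using edges of all T in T(K,z) both membership in M(T̂) and the estimate; dist(z_3,E) is to the line through E. *)

(* Defs.v *)
From Stdlib Require Import Relation_Operators.
From HB Require Import structures.
From mathcomp Require Import all_boot all_order all_algebra finmap.
From mathcomp Require Import all_classical all_reals all_analysis.
Set Implicit Arguments.
Unset Strict Implicit.
Unset Printing Implicit Defensive.
Import Order.TTheory GRing.Theory Num.Theory.
Import numFieldNormedType.Exports.
Local Open Scope classical_set_scope.
Local Open Scope ring_scope.

Notation plane R := (R * R)%type.

(* A closed triangle or edge is represented by the finite set of its vertices;
   the corresponding closed point set is [hull]. *)
Notation simplex R := {fset (R * R)%type}.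
Notation mesh R := {fset {fset (R * R)%type}}.

(* A piecewise function on a mesh is a family indexed by the triangles. The
   piece [v T] is a polynomial on the whole plane, so that one-sided traces on
   the boundary of T are just values of [v T]; what [v T] is for T outside the
   mesh is irrelevant. *)
Notation broken R := ({fset (R * R)%type} -> R * R -> R).

Section Plane.
Variable R : realType.
Implicit Types (p q x y z : plane R) (S K T E A : simplex R) (Om : set (plane R)).

Definition dot p q : R := p.1 * q.1 + p.2 * q.2.
(* The Euclidean norm; the library norm on R * R is the maximum norm. *)
Definition enorm p : R := Num.sqrt (dot p p).
Definition cross p q : R := p.1 * q.2 - p.2 * q.1.
Definition cball p (r : R) : set (plane R) := [set x | enorm (x - p) <= r].
Definition dist p (D : set (plane R)) : R := inf [set enorm (p - y) | y in D].

Definition hull A : set (plane R) :=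
  [set x | exists w : plane R -> R,
     [/\ forall z, z \in A -> 0 <= w z, \sum_(z <- A) w z = 1
       & x = \sum_(z <- A) w z *: z]].

Definition affine_hull A : set (plane R) :=
  [set x | exists w : plane R -> R,
     \sum_(z <- A) w z = 1 /\ x = \sum_(z <- A) w z *: z].

Definition mid A : plane R := (#|` A|%:R)^-1 *: \sum_(z <- A) z.

Definition edges T : {fset simplex R} := [fset E in fpowerset T | #|` E| == 2%N]%fset.

Definition edge_end E (i : nat) : plane R := nth 0 (enum_fset E) i.
Definition len E : R := enorm (edge_end E 1 - edge_end E 0).

(* (1/|E|) int_E f ds *)
Definition edge_mean E (f : plane R -> R) : R :=
  \int[lebesgue_measure]_(t in `[0%R, 1%R])
     f (edge_end E 0 + t *: (edge_end E 1 - edge_end E 0)).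
Definition edge_int E (f : plane R -> R) : R := len E * edge_mean E f.

Local Notation plane_measure := (@lebesgue_measure R \x @lebesgue_measure R)%E.

Definition dir (i : 'I_2) : plane R := if i == 0 then (1, 0) else (0, 1).
Definition grad (f : plane R -> R) x : plane R := ('D_(dir 0) f x, 'D_(dir 1) f x).
Definition hess (f : plane R -> R) x : 'M[R]_2 :=
  \matrix_(i, j) 'D_(dir j) ('D_(dir i) f) x.

Definition poly_le (k : nat) (f : plane R -> R) :=
  exists c : nat -> nat -> R, forall x,
    f x = \sum_(i < k.+1) \sum_(j < (k - i).+1) c i j * x.1 ^+ i * x.2 ^+ j.

Definition bdry Om : set (plane R) := closure Om `\` Om°.

(* Locally, after a rotation, Om is the strict epigraph of a Lipschitz
   function. *)
Definition lipschitz_boundary Om :=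
  forall x, bdry Om x ->
    exists (e n : plane R) (r L : R) (g : R -> R),
      [/\ [/\ dot e e = 1, dot n n = 1, dot e n = 0 & 0 < r],
          forall s t, `|g s - g t| <= L * `|s - t|
        & forall y, enorm (y - x) < r -> (Om y <-> g (dot e y) < dot n y)].

Definition polygonal Om :=
  exists s : seq (plane R * plane R),
    bdry Om = [set x | exists2 ab, ab \in s & hull [fset ab.1; ab.2]%fset x].

Definition polygonal_lipschitz_domain Om :=
  [/\ Om !=set0, open Om, connected Om & bounded_set Om] /\
  (polygonal Om /\ lipschitz_boundary Om).

Definition triangle T :=
  exists a b c, T = [fset a; b; c]%fset /\ cross (b - a) (c - a) != 0.

(* Distinct triangles are disjoint or share exactly one vertex or one edge. *)
Definition regular_triangulation Om (TT : mesh R) :=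
  [/\ forall T, T \in TT -> triangle T,
      [set x | exists2 T, T \in TT & hull T x] = closure Om
    & forall T T', T \in TT -> T' \in TT -> T != T' ->
        hull T `&` hull T' = hull (T `&` T')%fset].

Definition refines (TT That : mesh R) :=
  forall T', T' \in That -> exists2 T, T \in TT & hull T' `<=` hull T.

(* [adm TT That] : That arises from TT by one admissible refinement step. The
   rule is left arbitrary (e.g. newest-vertex bisection); all that is asked is
   that the steps taken from T0 yield regular triangulations refining the
   previous one. *)
Definition generated (T0 : mesh R) (adm : mesh R -> mesh R -> Prop) :
    set (mesh R) :=
  [set TT | clos_refl_trans _ adm T0 TT].

Definition triangulations Om (T0 : mesh R) (adm : mesh R -> mesh R -> Prop) :=
  regular_triangulation Om T0 /\
  forall TT That, generated T0 adm TT -> adm TT That ->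
    regular_triangulation Om That /\ refines TT That.

Definition shape_regular (M1 : R) (TTs : set (mesh R)) :=
  forall TT T, TTs TT -> T \in TT ->
    exists (c c' : plane R) (r r' : R),
      [/\ 0 < r, r' <= M1 * r, cball c r `<=` hull T & hull T `<=` cball c' r'].

Definition mesh_edges (TT : mesh R) : {fset simplex R} :=
  (\bigcup_(T <- TT) edges T)%fset.
Definition on_boundary Om E := hull E `<=` bdry Om.

(* The edges of TT which are not edges of That. *)
Definition refined_edges (TT That : mesh R) : {fset simplex R} :=
  (mesh_edges TT `\` mesh_edges That)%fset.

Definition unit_normals (nu : simplex R -> plane R) :=
  forall E, #|` E| = 2%N ->
    dot (nu E) (nu E) = 1 /\ dot (nu E) (edge_end E 1 - edge_end E 0) = 0.

Definition opposite T E : plane R := nth 0 (enum_fset (T `\` E)%fset) 0.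
(* The unit outward normal of T along its edge E. *)
Definition outward (nu : simplex R -> plane R) T E : plane R :=
  - Num.sg (dot (opposite T E - mid E) (nu E)) *: nu E.

(* The side of E on which [nu E] is outward is T_+. *)
Definition side (TT : mesh R) nu E (s : R) : simplex R :=
  head fset0 [seq T <- TT | (E \in edges T) && (dot (outward nu T E) (nu E) == s)].

Definition jump Om (TT : mesh R) nu (V : zmodType) E (F : simplex R -> V) : V :=
  if `[< on_boundary Om E >] then F (head fset0 [seq T <- TT | E \in edges T])
  else F (side TT nu E 1) - F (side TT nu E (-1)).

(* The row-wise cross product A x n. *)
Definition tangential (A : 'M[R]_2) (n : plane R) : 'cV[R]_2 :=
  \col_i (A i 0 * n.2 - A i 1 * n.1).

Definition frobenius2 (m n : nat) (A : 'M[R]_(m, n)) : R := \sum_i \sum_j A i j ^+ 2.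

(* A triangle of TT containing x; unique for almost all x. *)
Definition locate (TT : mesh R) x : simplex R :=
  head fset0 [seq T <- TT | `[< hull T x >]].
Definition hess_nc (TT : mesh R) (v : broken R) x : 'M[R]_2 :=
  hess (v (locate TT x)) x.

Definition morley Om (TT : mesh R) (v : broken R) :=
  [/\ forall T, T \in TT -> poly_le 2 (v T),
      forall T T' z, T \in TT -> T' \in TT -> z \in T -> z \in T' ->
        v T z = v T' z,
      forall T T' E, T \in TT -> T' \in TT -> T != T' ->
        E \in edges T -> E \in edges T' ->
        grad (v T) (mid E) = grad (v T') (mid E),
      forall T z, T \in TT -> z \in T -> bdry Om z -> v T z = 0
    & forall T E, T \in TT -> E \in edges T -> on_boundary Om E ->
        grad (v T) (mid E) = 0].

(* T_j and T_(j+1) share an edge of EE; in a regular triangulation the face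
   shared by distinct triangles is spanned by their common vertices. *)
Definition side_patch (EE : {fset simplex R}) (TT : mesh R) K z : mesh R :=
  [fset T in TT | `[< exists s : seq (simplex R),
     [/\ {in K :: s, forall T', T' \in TT /\ z \in T'},
         path (fun T1 T2 => (T1 `&` T2)%fset \in EE) K s
       & last K s = T] >]]%fset.

Definition partial (s : seq 'I_2) (f : plane R -> R) : plane R -> R :=
  foldr (fun i g => 'D_(dir i) g) f s.

Definition test_function (U : set (plane R)) (phi : plane R -> R) :=
  (forall s x, differentiable (partial s phi) x) /\
  exists A : set (plane R),
    [/\ compact A, A `<=` U & forall x, ~ A x -> phi x = 0].

Definition square_integrable (U : set (plane R)) (f : plane R -> R) :=
  measurable_fun U f /\
  (\int[plane_measure]_(x in U) (f x ^+ 2)%:E < +oo)%E.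

(* [g] is the weak derivative for the multi-index [s], given as a list of
   coordinate directions. *)
Definition sobolev (k : nat) (U : set (plane R)) (f : plane R -> R) :=
  square_integrable U f /\
  forall s : seq 'I_2, (size s <= k)%N ->
    exists2 g, square_integrable U g &
      forall phi, test_function U phi ->
        \int[plane_measure]_(x in U) (f x * partial s phi x) =
        (-1) ^+ size s * \int[plane_measure]_(x in U) (g x * phi x).

Definition hct_split K : mesh R := [fset mid K |` E | E in edges K]%fset.

(* The piece of a function c on the split of K near the point x of K. *)
Definition piece_at K (c : broken R) x : plane R -> R :=
  c (locate (hct_split K) x).

(* HCT'(K): the last condition fixes the C^1 representative of the class in
   H^2(K), to which the point values in the degrees of freedom refer. *)
Definition HCT K (c : broken R) :=
  [/\ forall S, S \in hct_split K -> poly_le 3 (c S),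
      sobolev 2 (hull K)° (fun x => piece_at K c x x)
    & forall S S' x, S \in hct_split K -> S' \in hct_split K ->
        hull S x -> hull S' x -> c S x = c S' x /\ grad (c S) x = grad (c S') x].

(* Vertices at which J_1 gets the gradient zero. [zero_own] looks at the edges
   of K only. Then, at the end point z of a refined boundary edge of K, the
   gradients of J_1 v on K and on a neighbour of K across a refined edge need
   not agree, and then J_1 v is not C^1 across that edge. [zero_patch] treats
   all triangles that are side-connected to K at z alike. *)
Definition zero_own Om (TT That : mesh R) K z :=
  exists E, [/\ E \in edges K, E \in refined_edges TT That,
                on_boundary Om E & z \in E].
Definition zero_patch Om (TT That : mesh R) K z :=
  exists2 T, T \in side_patch (refined_edges TT That) TT K z
           & zero_own Om TT That T z.

(* [J1 K] is the companion on K, as a family over the split of K. *)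
Definition companion1 (zero : simplex R -> plane R -> Prop) (TT That : mesh R)
    nu (v : broken R) (J1 : simplex R -> broken R) :=
  forall K, K \in TT ->
    [/\ HCT K (J1 K),
        forall E, E \in edges K ->
          'D_(nu E) (piece_at K (J1 K) (mid E)) (mid E) = 'D_(nu E) (v K) (mid E),
        forall z, z \in K -> piece_at K (J1 K) z z = v K z,
        forall z, z \in K -> zero K z -> grad (piece_at K (J1 K) z) z = 0
      & forall z, z \in K -> ~ zero K z ->
          let P := side_patch (refined_edges TT That) TT K z in
          grad (piece_at K (J1 K) z) z =
            (#|` P|%:R)^-1 *: \sum_(T <- P) grad (v T) z].

(* The barycentric coordinate of the vertex z of K. *)
Definition bary K z x : R :=
  let a := nth 0 (enum_fset (K `\ z)%fset) 0 in
  let b := nth 0 (enum_fset (K `\ z)%fset) 1 in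
  cross (x - a) (b - a) / cross (z - a) (b - a).

(* The distance is to the line through E: this is what makes the mean of the
   normal derivative equal to 1 when the angles at E are obtuse. *)
Definition bubble nu E K x : R :=
  let z3 := opposite K E in
  - 30%:R * dot (outward nu K E) (nu E) * dist z3 (affine_hull E)
  * (\prod_(z <- E) bary K z x ^+ 2) * bary K z3 x.

Definition companion2 nu (v : broken R) (J1 : simplex R -> broken R) :
    simplex R -> broken R :=
  fun K S x => J1 K S x +
    \sum_(E <- edges K)
      edge_mean E (fun y => 'D_(nu E) (fun t => v K t - piece_at K (J1 K) y t) y)
      * bubble nu E K x.

(* u is the Morley interpolation on That of w, which is given on each K of TT
   as a family over the split of K; w is evaluated from within the fine
   triangle. Where w is C^1 this is the usual interpolation. *)
Definition morley_interp (TT That : mesh R) nu (w : simplex R -> broken R)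
    (u : broken R) :=
  forall T', T' \in That -> poly_le 2 (u T') /\
    forall K, K \in TT -> hull T' `<=` hull K ->
      (forall z, z \in T' -> u T' z = piece_at K (w K) z z) /\
      (forall E, E \in edges T' ->
         'D_(nu E) (u T') (mid E) =
         edge_mean E (fun x => 'D_(nu E) (piece_at K (w K) x) x)).

Definition reliability Om (TT That : mesh R) nu (C : R) (v u : broken R) :=
  (\sum_(T <- TT) \int[plane_measure]_(x in hull T)
      (frobenius2 (hess_nc That u x - hess_nc TT v x))%:E
   <= (C * \sum_(E <- refined_edges TT That)
        len E * edge_int E (fun x =>
          frobenius2 (tangential (jump Om TT nu E (fun T => hess (v T) x)) (nu E))))%:E)%E.

End Plane.

(* Main.v *)
From Stdlib Require Operators_Properties.
Require Import Defs.
From mathcomp Require Import all_boot all_order all_algebra finmap.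
From mathcomp Require Import all_classical all_reals all_analysis.
From mathcomp Require Import measurable_realfun.
From mathcomp Require Import ring lra.
Set Implicit Arguments.
Unset Strict Implicit.
Unset Printing Implicit Defensive.
Import Order.TTheory GRing.Theory Num.Theory.
Import numFieldNormedType.Exports.
Local Open Scope fset_scope.
Local Open Scope classical_set_scope.
Local Open Scope ring_scope.

(** Let K be a coarse triangle with inradius r, let v be the quadratic u_M on
    K, and let Gamma be the largest difference, at the vertices of K, between
    the gradients of J_1 u_M and of v. The estimate follows from three bounds
    that are local to K.

    Jumps control Gamma. The Hessian of a piecewise quadratic is constant on
    each triangle, and the gradients of two neighbours agree at the midpoint of
    their common edge E = [a, b]. At an end of E they differ by the jump of the
    Hessian applied to (b - a) / 2, and the square of the length of this vector
    is a quarter of h_E ||[D^2 u_M]_E x nu_E||^2 ([mismatch_inner]; on a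
    boundary edge the gradient itself is of this form, [mismatch_bdry]). The
    triangles of a side patch are joined by paths without repetition, and the
    number of triangles at a vertex is bounded in terms of the shape regularity
    ([valence]). So Gamma^2 is bounded by the contributions of the refined edges
    at the vertices of K ([companion_close]).

    Gamma controls J_2 u_M. The difference J_1 u_M - v is a C^1 cubic on the
    split of K that vanishes at the vertices and has vanishing normal
    derivatives at the midpoints of the edges. In the frames of the spokes from
    the centroid to the vertices the C^1 conditions are linear relations between
    coefficients, and the resulting system for the value and the gradient at the
    centroid is solved explicitly. All coefficients are at most a multiple of
    Gamma r, and therefore the gradient of J_1 u_M - v is Lipschitz on K with a
    constant L proportional to Gamma / r ([hct_grad_lip]). The bubbles that lead
    to J_2 u_M obey the same bound ([companion2_lip]).

    J_2 u_M controls the interpolant. On a fine triangle T inside K the function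
    g = I_M (J_2 u_M) - v is quadratic. It has the vertex values and the mean
    normal derivatives of d = J_2 u_M - v, so its gradient at the midpoint of an
    edge differs from that of d at an end of the edge by at most a multiple of
    L diam(T). Two edges that meet at a vertex then show that the Hessian of g is
    bounded by a multiple of L, whatever the size of T ([interpolant_hess_bound]).

    This is a pointwise bound for the difference of the Hessians by a multiple of
    Gamma / r. Integration over K, whose area is at most a multiple of r^2,
    cancels r, and summation over K counts every refined edge a bounded number of
    times ([local_reliability]).

    For the interpolant to be a Morley function, J_2 u_M has to be C^1 across
    the refined edges, in whose interior there may be new vertices and edges. On
    such an edge its trace is a cubic and its normal derivative a quadratic plus
    a multiple of a fixed bubble, and the data that determine them are shared by
    the two sides when both take the same averages of gradients ([J2_shared]). An
    edge that is not refined is an edge of the fine triangulation, and there the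
    mean of the normal derivative of J_2 u_M equals the midpoint value of that of
    u_M ([companion2_mean]). *)

(** * Gradients and cubic polynomials *)

Lemma plane_eq (R : realType) (x y : plane R) : x.1 = y.1 -> x.2 = y.2 -> x = y.
Proof. by case: x y => [? ?] [? ?] /= -> ->. Qed.

Ltac plane_ring := apply: plane_eq; rewrite /= /GRing.scale /=; ring.
Ltac plane_field := apply: plane_eq; rewrite /= /GRing.scale /=; field.

Section Calculus.
Variable R : realType.
Implicit Types (p q x y z v : plane R) (f : plane R -> R).

Lemma dotB x y p : dot (x - y) p = dot x p - dot y p.
Proof. by rewrite /dot /=; ring. Qed.

Lemma dot_gt0 p : p != 0 -> 0 < dot p p.
Proof.
move=> p0; rewrite lt_neqAle addr_ge0 -?expr2 ?sqr_ge0 // andbT eq_sym /dot -!expr2.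
rewrite paddr_eq0 ?sqr_ge0 // !sqrf_eq0; apply: contra_neqN p0 => /andP[/eqP ? /eqP ?].
exact: plane_eq.
Qed.

(** A vector orthogonal to the unit vector p is a multiple of p turned by a
    right angle. *)
Lemma normal_coord p q : dot p p = 1 -> dot p q = 0 ->
  q.1 = - (q.2 * p.1 - q.1 * p.2) * p.2 /\ q.2 = (q.2 * p.1 - q.1 * p.2) * p.1.
Proof.
move=> h1 h2; split.
  transitivity (dot p p * q.1 - p.1 * dot p q); first by rewrite h1 h2; ring.
  by rewrite /dot; ring.
transitivity (dot p p * q.2 - p.2 * dot p q); first by rewrite h1 h2; ring.
by rewrite /dot; ring.
Qed.

(** Differentiability along all lines with one gradient. It follows the
    sum and product rules of directional derivatives, and restrictions to
    lines are all that is differentiated below. *)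
Definition is_grad f x (g : plane R) := forall v, is_derive x v f (dot g v).

Lemma is_grad_fst x : is_grad fst x (1, 0).
Proof.
move=> v; rewrite /dot /= mul1r mul0r addr0.
have h : (fun h : R => h^-1 *: ((fst \o shift x) (h *: v) - x.1)) @ 0^' --> v.1.
  apply: (@cvg_trans _ (cst v.1 @ 0^')); last exact: cvg_cst.
  apply: near_eq_cvg; near=> h => /=.
  rewrite addrK /=; have h0 : h != 0 by near: h; exact: nbhs_dnbhs_neq.
  by rewrite [RHS]mulrA mulVf // mul1r.
split; first by apply/cvg_ex; exists v.1.
exact: cvg_lim h.
Unshelve. all: by end_near. Qed.

Lemma is_grad_snd x : is_grad snd x (0, 1).
Proof.
move=> v; rewrite /dot /= mul1r mul0r add0r.
have h : (fun h : R => h^-1 *: ((snd \o shift x) (h *: v) - x.2)) @ 0^' --> v.2.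
  apply: (@cvg_trans _ (cst v.2 @ 0^')); last exact: cvg_cst.
  apply: near_eq_cvg; near=> h => /=.
  rewrite addrK /=; have h0 : h != 0 by near: h; exact: nbhs_dnbhs_neq.
  by rewrite [RHS]mulrA mulVf // mul1r.
split; first by apply/cvg_ex; exists v.2.
exact: cvg_lim h.
Unshelve. all: by end_near. Qed.

Lemma is_grad_cst (c : R) x : is_grad (fun=> c) x 0.
Proof. by move=> v; rewrite /dot /= !mul0r addr0; exact: is_derive_cst. Qed.

Lemma is_gradD f (g : plane R -> R) x gf gg : is_grad f x gf -> is_grad g x gg ->
  is_grad (fun x => f x + g x) x (gf + gg).
Proof.
move=> hf hg v; have := is_deriveD (hf v) (hg v).
rewrite (_ : dot gf v + dot gg v = dot (gf + gg) v) //.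
by rewrite /dot /=; ring.
Qed.

Lemma is_gradM f (g : plane R -> R) x gf gg : is_grad f x gf -> is_grad g x gg ->
  is_grad (fun x => f x * g x) x (f x *: gg + g x *: gf).
Proof.
move=> hf hg v; have := is_deriveM (hf v) (hg v).
rewrite (_ : _ + _ = dot (f x *: gg + g x *: gf) v) //.
rewrite /dot /= /GRing.scale /=; ring.
Qed.

Lemma is_grad_eq f x g g' : is_grad f x g -> g = g' -> is_grad f x g'.
Proof. by move=> + <-. Qed.

Lemma is_gradZ (c : R) f x g : is_grad f x g ->
  is_grad (fun x => c * f x) x (c *: g).
Proof.
move=> h; apply: is_grad_eq (is_gradM (is_grad_cst c x) h) _.
by rewrite scaler0 addr0.
Qed.

Lemma is_gradB f (g : plane R -> R) x gf gg : is_grad f x gf -> is_grad g x gg ->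
  is_grad (fun x => f x - g x) x (gf - gg).
Proof.
move=> hf hg; have := is_gradD hf (is_gradZ (-1) hg).
rewrite scaleN1r.
rewrite (_ : (fun _ => _) = (fun x => f x - g x)) //.
by apply: funext => y; rewrite mulN1r.
Qed.

Lemma is_gradX f n x gf : is_grad f x gf ->
  is_grad (fun x => f x ^+ n) x ((n%:R * f x ^+ n.-1) *: gf).
Proof.
move=> h v; have := is_deriveX n (h v).
rewrite (_ : _ *: dot gf v = dot ((n%:R * f x ^+ n.-1) *: gf) v) //.
  by rewrite (_ : f ^+ n = (fun y => f y ^+ n)) //; apply: funext => y; rewrite exprfctE.
by rewrite /dot /= /GRing.scale /=; ring.
Qed.

Lemma is_grad_D f x g v : is_grad f x g -> 'D_v f x = dot g v.
Proof. by move=> h; have := h v => -[]. Qed.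

Lemma is_grad_grad f x g : is_grad f x g -> grad f x = g.
Proof.
move=> h; rewrite /grad !(is_grad_D _ h) /dot /=.
by apply: plane_eq => /=; ring.
Qed.

Lemma is_grad_line f x v (t : R) g : is_grad f (x + t *: v) g ->
  is_derive t (1:R) (fun t : R => f (x + t *: v)) (dot g v).
Proof.
move=> /(_ v) [dv dE].
have E : (fun h : R => h^-1 *: (((fun t : R => f (x + t *: v)) \o shift t) (h *: (1:R)) - f (x + t *: v)))
   = (fun h : R => h^-1 *: ((f \o shift (x + t *: v)) (h *: v) - f (x + t *: v))).
  apply: funext => h /=; congr (_ *: (f _ - _)).
  apply: plane_eq => /=; rewrite /GRing.scale /=; ring.
split; first by rewrite /derivable E.
by rewrite /derive E.
Qed.

(** The coefficients are kept as a table, so that one definition serves a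
    cubic in the standard coordinates and in any affine frame. *)
Definition cubf (k : nat -> nat -> R) (s t : R) : R :=
  k 0%N 0%N + k 1%N 0%N * s + k 0%N 1%N * t
  + k 2%N 0%N * s ^+ 2 + k 1%N 1%N * s * t + k 0%N 2%N * t ^+ 2
  + k 3%N 0%N * s ^+ 3 + k 2%N 1%N * s ^+ 2 * t + k 1%N 2%N * s * t ^+ 2
  + k 0%N 3%N * t ^+ 3.
Definition cubs (k : nat -> nat -> R) (s t : R) : R :=
  k 1%N 0%N + 2 * k 2%N 0%N * s + k 1%N 1%N * t
  + 3 * k 3%N 0%N * s ^+ 2 + 2 * k 2%N 1%N * s * t + k 1%N 2%N * t ^+ 2.
Definition cubt (k : nat -> nat -> R) (s t : R) : R :=
  k 0%N 1%N + k 1%N 1%N * s + 2 * k 0%N 2%N * t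
  + k 2%N 1%N * s ^+ 2 + 2 * k 1%N 2%N * s * t + 3 * k 0%N 3%N * t ^+ 2.

Lemma cubf_grad c x :
  is_grad (fun x => cubf c x.1 x.2) x (cubs c x.1 x.2, cubt c x.1 x.2).
Proof.
have h1 := is_grad_fst x; have h2 := is_grad_snd x.
have hc k := is_grad_cst k x.
apply: is_grad_eq.
  rewrite /cubf.
  repeat first [apply: is_gradD | exact: hc | exact: h1 | exact: h2
    | apply: is_gradX | apply: is_gradM].
by apply: plane_eq; rewrite /cubs /cubt /=; rewrite /GRing.scale /=; ring.
Qed.

End Calculus.

Section CubicCalculus.
Variable R : realType.
Implicit Types (p q x y z v : plane R) (f : plane R -> R).

Definition is_cubic f := exists c, forall x, f x = cubf c x.1 x.2.

Lemma is_cubic_gradE f : is_cubic f -> exists c, (forall x, f x = cubf c x.1 x.2) /\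
  forall x, grad f x = (cubs c x.1 x.2, cubt c x.1 x.2).
Proof.
move=> [c h]; exists c; split=> // x.
have -> : f = fun x => cubf c x.1 x.2 by apply: funext.
exact: is_grad_grad (cubf_grad _ _).
Qed.

Lemma is_cubic_grad f x : is_cubic f -> is_grad f x (grad f x).
Proof.
move=> [c h]; have -> : f = fun x => cubf c x.1 x.2 by apply: funext.
by rewrite (is_grad_grad (cubf_grad c x)); exact: cubf_grad.
Qed.

Lemma is_cubicB f (g : plane R -> R) : is_cubic f -> is_cubic g -> is_cubic (fun x => f x - g x).
Proof.
move=> [c h] [d k]; exists (fun i j => c i j - d i j) => x.
by rewrite h k /cubf; ring.
Qed.

(** In frames adapted to a triangle the derivatives of f along the two axes
    are the partial derivatives of the transformed cubic; all computations
    with cubic pieces are done in such frames. *)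
Lemma cubic_frame f : is_cubic f -> forall o p q, exists k, forall s t : R,
  [/\ f (o + s *: p + t *: q) = cubf k s t,
      dot (grad f (o + s *: p + t *: q)) p = cubs k s t
    & dot (grad f (o + s *: p + t *: q)) q = cubt k s t].
Proof.
move=> /is_cubic_gradE [c [h hg]] [a1 a2] [p1 p2] [q1 q2].
(* the Taylor coefficients of f at the origin (a1, a2) of the frame, along its two axes *)
pose k (i j : nat) : R := match i, j with
 | 0, 0 => cubf c a1 a2
 | 1, 0 => cubs c a1 a2 * p1 + cubt c a1 a2 * p2
 | 0, 1 => cubs c a1 a2 * q1 + cubt c a1 a2 * q2
 | 2, 0 => (c 2%N 0%N + 3 * c 3%N 0%N * a1 + c 2%N 1%N * a2) * p1^+2
     + (c 1%N 1%N + 2 * c 2%N 1%N * a1 + 2 * c 1%N 2%N * a2) * p1 * p2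
     + (c 0%N 2%N + 3 * c 0%N 3%N * a2 + c 1%N 2%N * a1) * p2 ^+ 2
 | 0, 2 => (c 2%N 0%N + 3 * c 3%N 0%N * a1 + c 2%N 1%N * a2) * q1^+2
     + (c 1%N 1%N + 2 * c 2%N 1%N * a1 + 2 * c 1%N 2%N * a2) * q1 * q2
     + (c 0%N 2%N + 3 * c 0%N 3%N * a2 + c 1%N 2%N * a1) * q2 ^+ 2
 | 1, 1 => 2 * (c 2%N 0%N + 3 * c 3%N 0%N * a1 + c 2%N 1%N * a2) * p1 * q1
     + (c 1%N 1%N + 2 * c 2%N 1%N * a1 + 2 * c 1%N 2%N * a2) * (p1 * q2 + p2 * q1)
     + 2 * (c 0%N 2%N + 3 * c 0%N 3%N * a2 + c 1%N 2%N * a1) * p2 * q2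
 | 3, 0 => c 3%N 0%N * p1^+3 + c 2%N 1%N * p1^+2 * p2 + c 1%N 2%N * p1 * p2^+2 + c 0%N 3%N * p2^+3
 | 0, 3 => c 3%N 0%N * q1^+3 + c 2%N 1%N * q1^+2 * q2 + c 1%N 2%N * q1 * q2^+2 + c 0%N 3%N * q2^+3
 | 2, 1 => 3 * c 3%N 0%N * p1^+2 * q1 + c 2%N 1%N * (p1^+2 * q2 + 2 * p1 * p2 * q1)
     + c 1%N 2%N * (p2^+2 * q1 + 2 * p1 * p2 * q2) + 3 * c 0%N 3%N * p2^+2 * q2
 | 1, 2 => 3 * c 3%N 0%N * q1^+2 * p1 + c 2%N 1%N * (q1^+2 * p2 + 2 * q1 * q2 * p1)
     + c 1%N 2%N * (q2^+2 * p1 + 2 * q1 * q2 * p2) + 3 * c 0%N 3%N * q2^+2 * p2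
 | _, _ => 0 end.
exists k => s t; rewrite h hg /dot /= /GRing.scale /= /cubf /cubs /cubt /=.
rewrite /cubf /cubs /cubt; split; ring.
Qed.

Lemma poly3_cubic f : poly_le 3 f -> is_cubic f.
Proof.
move=> [c h]; exists c => x; rewrite h /cubf.
rewrite !big_ord_recl /= !big_ord0 /= /bump /=.
by rewrite !expr0 !expr1 !mulr1; ring.
Qed.

Definition is_quad f := exists c, [/\ c 3%N 0%N = 0, c 2%N 1%N = 0, c 1%N 2%N = 0,
  c 0%N 3%N = 0 & forall x, f x = cubf c x.1 x.2].

Lemma is_quad_cubic f : is_quad f -> is_cubic f.
Proof. by move=> [c [? ? ? ? h]]; exists c. Qed.

Lemma is_quadB f (g : plane R -> R) : is_quad f -> is_quad g -> is_quad (fun x => f x - g x).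
Proof.
move=> [c [c1 c2 c3 c4 h]] [d [d1 d2 d3 d4 k]]; exists (fun i j => c i j - d i j).
rewrite c1 c2 c3 c4 d1 d2 d3 d4 subrr; split=> // x.
by rewrite h k /cubf; ring.
Qed.

(** The midpoint rule is exact, because the derivative of a quadratic along
    a segment is affine. *)
Lemma quad_mid f a b : is_quad f ->
  f b - f a = dot (grad f (2^-1 *: (a + b))) (b - a).
Proof.
move=> [c [c1 c2 c3 c4 h]].
have -> : f = fun x => cubf c x.1 x.2 by apply: funext.
rewrite (is_grad_grad (cubf_grad c _)) /cubf /cubs /cubt /dot /=.
rewrite c1 c2 c3 c4 /GRing.scale /=; by field.
Qed.

Lemma quad_hess f : is_quad f -> exists H : 'M[R]_2,
  (forall x, hess f x = H) /\ forall x y,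
   (grad f x - grad f y).1 = H 0 0 * (x - y).1 + H 0 1 * (x - y).2 /\
   (grad f x - grad f y).2 = H 1 0 * (x - y).1 + H 1 1 * (x - y).2.
Proof.
move=> [c [c1 c2 c3 c4 h]].
have hf : f = fun x => cubf c x.1 x.2 by apply: funext.
have G x : is_grad f x (cubs c x.1 x.2, cubt c x.1 x.2) by rewrite hf; exact: cubf_grad.
have D i : 'D_(dir R i) f = fun x => (if i == 0 then c 1%N 0%N + 2 * c 2%N 0%N * x.1 + c 1%N 1%N * x.2
   else c 0%N 1%N + c 1%N 1%N * x.1 + 2 * c 0%N 2%N * x.2).
  apply: funext => x; rewrite (is_grad_D _ (G x)) /dot /dir /cubs /cubt c1 c2 c3 c4.
  by case: ifP => _ /=; ring.
pose H : 'M[R]_2 := \matrix_(i, j) (if i == 0 then (if j == 0 then 2 * c 2%N 0%N else c 1%N 1%N)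
   else (if j == 0 then c 1%N 1%N else 2 * c 0%N 2%N)).
exists H; split.
  move=> x; apply/matrixP => i j; rewrite !mxE D.
  have A (a b d : R) : is_grad (fun x => a + b * x.1 + d * x.2) x (b, d).
    apply: is_grad_eq.
      apply: is_gradD; [apply: is_gradD; [exact: is_grad_cst|]|];
      apply: is_gradZ; [exact: is_grad_fst|exact: is_grad_snd].
    by apply: plane_eq => /=; rewrite /GRing.scale /=; ring.
  case: ifP => _; rewrite (is_grad_D _ (A _ _ _)) /dot /dir; case: ifP => _ /=; ring.
move=> x y; rewrite !(is_grad_grad (G _)) !mxE /= /cubs /cubt c1 c2 c3 c4; split; ring.
Qed.

Lemma poly2_quad f : poly_le 2 f -> is_quad f.
Proof.
move=> [c h]; exists (fun i j => if (i + j <= 2)%N then c i j else 0); split=> // x.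
rewrite h /cubf /=.
rewrite !big_ord_recl /= !big_ord0 /= /bump /=.
by rewrite !expr0 !expr1 !mulr1; ring.
Qed.

Lemma quad_ends f a b p : is_quad f ->
  dot (grad f a) p + dot (grad f b) p = 2 * dot (grad f (2^-1 *: (a + b))) p.
Proof.
move=> [c [c1 c2 c3 c4 h]]; have -> : f = fun x => cubf c x.1 x.2 by apply: funext.
rewrite !(is_grad_grad (cubf_grad c _)) /cubs /cubt c1 c2 c3 c4 /dot /= /GRing.scale /=.
by field.
Qed.

Lemma ord2 (k : 'I_2) : k = 0 \/ k = 1.
Proof. by case: k => -[|[|//]] ?; [left|right]; apply: val_inj. Qed.

Lemma hessB f (g : plane R -> R) x : is_quad f -> is_quad g ->
  hess f x - hess g x = hess (fun x => f x - g x) x.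
Proof.
move=> hf hg; have hfg := is_quadB hf hg.
have [Hf [hHf gf]] := quad_hess hf; have [Hg [hHg gg]] := quad_hess hg.
have [H [hH gH]] := quad_hess hfg.
rewrite hHf hHg hH.
have D y : grad (fun x => f x - g x) y = grad f y - grad g y.
  by apply: is_grad_grad; apply: is_gradB; apply: is_cubic_grad; exact: is_quad_cubic.
have E (u : plane R) := gf u 0; have E' (u : plane R) := gg u 0.
have E'' (u : plane R) := gH u 0.
have h1 := (E (1,0), E' (1,0), E'' (1,0)).
have h2 := (E (0,1), E' (0,1), E'' (0,1)).
move: h1 h2; rewrite !D /= !subr0 !mulr0 !mulr1 !addr0 !add0r.
move=> [[[a1 a2] [b1 b2]] [d1 d2]] [[[a3 a4] [b3 b4]] [d3 d4]].
apply/matrixP => i j; rewrite !mxE.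
by case: (ord2 i) => ->; case: (ord2 j) => ->; rewrite -?(a1, a2, a3, a4) -?(b1, b2, b3, b4) -?(d1, d2, d3, d4); ring.
Qed.

Lemma int01_poly (p0 p1 p2 p3 p4 : R) (f : R -> R) :
  (forall t, 0 <= t <= 1 -> f t = p0 + p1 * t + p2 * t ^+ 2 + p3 * t ^+ 3 + p4 * t ^+ 4) ->
  \int[lebesgue_measure]_(t in `[0%R, 1%R]) f t = p0 + p1 / 2 + p2 / 3 + p3 / 4 + p4 / 5.
Proof.
move=> hf.
pose po (a b c d e : R) t := a + b * t + c * t ^+ 2 + d * t ^+ 3 + e * t ^+ 4.
pose F (t : R) := t * po p0 (p1 / 2) (p2 / 3) (p3 / 4) (p4 / 5) t.
have dpo a b c d e (t : R) : is_derive t (1:R) (po a b c d e)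
    (b + 2 * c * t + 3 * d * t ^+ 2 + 4 * e * t ^+ 3).
  pose G (x : plane R) := po a b c d e x.1.
  have hG x : is_grad G x ((b + 2 * c * x.1 + 3 * d * x.1 ^+ 2 + 4 * e * x.1 ^+ 3), 0).
    apply: is_grad_eq.
      have hc := is_grad_cst; have h1 := is_grad_fst x.
      by rewrite /G /po; repeat first [exact: hc | exact: h1 | apply: is_gradD
        | apply: is_gradZ | apply: is_gradX].
    by plane_ring.
  have := is_grad_line (hG (0 + t *: (1, 0))).
  rewrite /dot /= !add0r !mulr0 !addr0 mulr1 /GRing.scale /= mulr1 => h.
  rewrite (_ : po a b c d e = fun t => G (0 + t *: (1, 0))) //.
  by apply: funext => u; rewrite /G /= add0r /GRing.scale /= mulr1.
have cpo a b c d e : continuous (po a b c d e).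
  move=> t; apply: differentiable_continuous; apply/derivable1_diffP.
  by have [] := dpo a b c d e t.
have dF (t : R) : is_derive t (1:R) F (po p0 p1 p2 p3 p4 t).
  have := is_deriveM (is_derive_id t 1) (dpo p0 (p1 / 2) (p2 / 3) (p3 / 4) (p4 / 5) t).
  rewrite (_ : id * _ = F) // => h; apply: is_derive_eq h _.
  by rewrite /po /GRing.scale /=; field.
have cF : continuous F.
  by move=> t; apply: differentiable_continuous; apply/derivable1_diffP; have [] := dF t.
transitivity (\int[lebesgue_measure]_(t in `[0%R, 1%R]) po p0 p1 p2 p3 p4 t).
  by apply: eq_Rintegral => t; rewrite inE /= in_itv /= => h; rewrite hf.
rewrite /Rintegral (@continuous_FTC2 _ _ F) //.
- by rewrite /= /F /po; field.
- exact: continuous_subspaceT.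
- split.
  + by move=> x _; have [] := dF x.
  + by apply: cvg_at_right_filter; exact: cF.
  + by apply: cvg_at_left_filter; exact: cF.
- by move=> x _; rewrite derive1E; have [] := dF x.
Qed.

Lemma int01_lip_integrable (f : R -> R) (L : R) :
  (forall s t, 0 <= s <= 1 -> 0 <= t <= 1 -> `|f s - f t| <= L * `|s - t|) ->
  (@lebesgue_measure R).-integrable `[0%R, 1%R] (EFin \o f).
Proof.
move=> lip.
(* clamping the argument to the unit interval extends f continuously *)
pose cl (t : R) := if t < 0 then 0 else if 1 < t then 1 else t.
have clP t : 0 <= cl t <= 1.
  by rewrite /cl; case: (ltP t 0) => ?; case: (ltP 1 t) => ?; apply/andP; split; lra.
have clE t : 0 <= t <= 1 -> cl t = t.
  by move=> /andP[? ?]; rewrite /cl; case: (ltP t 0) => ?; case: (ltP 1 t) => ?; lra.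
have cl1 s t : `|cl s - cl t| <= `|s - t|.
  have h1 := ler_norm (s - t); have h2 := ler_norm (t - s); rewrite distrC in h2.
  have h3 := normr_ge0 (s - t).
  rewrite ler_norml /cl; case: (ltP s 0) => ?; case: (ltP 1 s) => ?;
  case: (ltP t 0) => ?; case: (ltP 1 t) => ?; apply/andP; split; lra.
have L0 : 0 <= L.
  have := lip 0 1; rewrite !lexx !ler01 /= => /(_ isT isT).
  by rewrite sub0r normrN normr1 mulr1; apply: le_trans.
have cg : continuous (f \o cl).
  move=> x; apply/cvgrPdist_le => e e0.
  near=> t.
  rewrite /= (le_trans (lip _ _ (clP _) (clP _))) //.
  have h : `|x - t| <= e / (L + 1).
    by near: t; apply: cvgr_dist_le; [exact: cvg_id|rewrite divr_gt0 // ltr_wpDl].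
  rewrite (le_trans (ler_wpM2l L0 (le_trans (cl1 _ _) h))) //.
  by rewrite mulrA ler_pdivrMr ?ltr_wpDl // mulrDr mulr1 [e * L]mulrC lerDl ltW.
have ig : (@lebesgue_measure R).-integrable `[0%R, 1%R] (EFin \o (f \o cl)).
  apply: continuous_compact_integrable; first exact: segment_compact.
  exact: continuous_subspaceT.
apply: eq_integrable ig => //.
by move=> t; rewrite inE /= in_itv /= => h; rewrite clE.
Unshelve. all: by end_near. Qed.

Lemma int01_near (f : R -> R) (L c B : R) :
  (forall s t, 0 <= s <= 1 -> 0 <= t <= 1 -> `|f s - f t| <= L * `|s - t|) ->
  (forall t, 0 <= t <= 1 -> `|f t - c| <= B) ->
  `|\int[lebesgue_measure]_(t in `[0%R, 1%R]) f t - c| <= B.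
Proof.
move=> lip hB; have ig := int01_lip_integrable lip.
have cst_int (k : R) : \int[lebesgue_measure]_(t in `[0%R, 1%R]) k = k :> R.
  rewrite (@int01_poly k 0 0 0 0) => [|t _]; last by rewrite !mul0r !addr0.
  by rewrite !mul0r !addr0.
have ic (k : R) : (@lebesgue_measure R).-integrable `[0%R,1%R] (EFin \o (fun=> k)).
  by apply: (@int01_lip_integrable _ 0) => s t _ _; rewrite subrr normr0 mul0r.
rewrite ler_norml; apply/andP; split.
  rewrite lerBrDr addrC -[leLHS]cst_int; apply: le_Rintegral => // t; rewrite /= in_itv /= => ht.
  by have := hB t ht; rewrite ler_norml => /andP[]; lra.
rewrite lerBlDr -[leRHS]cst_int; apply: le_Rintegral => // t; rewrite /= in_itv /= => ht.
by have := hB t ht; rewrite ler_norml => /andP[]; lra.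
Qed.

Lemma affine_zero (u w x y : R) : x <= y -> u + x * w <= 0 -> 0 <= u + y * w ->
  exists t, x <= t <= y /\ u + t * w = 0.
Proof.
move=> xy hx hy.
have [w0|w0|w0] := ltgtP w 0.
- by exists x; split; [rewrite lexx xy|nra].
- have wn : w != 0 by rewrite gt_eqF.
  exists (- u / w); split; last by field.
  by rewrite ler_pdivlMr // ler_pdivrMr //; lra.
by exists x; rewrite lexx xy; split=> //; rewrite w0 in hx hy *; lra.
Qed.

Section Envelope.
Variables (phi : R -> R) (L : R).
Let bound s t := `|phi t - phi s| <= L * (t - s).

Lemma bound_trans s t r : bound s t -> bound t r -> bound s r.
Proof.
rewrite /bound => h1 h2; rewrite -(subrKA (phi t)) (le_trans (ler_normD _ _)) //.
apply: le_trans (lerD h2 h1) _; rewrite -mulrDr.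
by rewrite (_ : r - t + (t - s) = r - s) //; ring.
Qed.

Let aff (u : R * R) t := u.1 + t * u.2.
Let low (u v w : R * R) t := aff u t <= aff v t /\ aff u t <= aff w t.
Let lip u v w := forall s t, 0 <= s -> s <= t -> t <= 1 -> low u v w s -> low u v w t -> bound s t.

Lemma affine_le (u w x y z : R) : x <= z -> z <= y -> u + x * w <= 0 -> u + y * w <= 0 ->
  u + z * w <= 0.
Proof. by move=> ? ? ? ?; case: (leP 0 w) => ?; nra. Qed.

(** If u3 is not below the others where u1 = u2, the bounds of the pieces of
    u1 and u2 meet there; otherwise the segment passes through the piece of u3
    in between. *)
Lemma chain12 u1 u2 u3 : lip u1 u2 u3 -> lip u2 u1 u3 -> lip u3 u1 u2 ->
  forall s t, 0 <= s -> s <= t -> t <= 1 -> low u1 u2 u3 s -> low u2 u1 u3 t -> bound s t.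
Proof.
move=> l1 l2 l3 s t s0 st t1 [a1 a2] [b1 b2].
have [m [/andP[sm mt] me]] : exists m, s <= m <= t /\ (u1.1 - u2.1) + m * (u1.2 - u2.2) = 0.
  by apply: affine_zero => //; move: a1 b1; rewrite /aff; lra.
have [h|h] := leP (aff u1 m) (aff u3 m).
  apply: (@bound_trans s m t); [apply: l1|apply: l2] => //; rewrite /low; move: me h;
   rewrite /aff ?(le_trans _ mt) //; rewrite /aff in a1 a2 b1 b2; try lra;
   split; lra.
have [m1 [/andP[sm1 m1m] m1e]] : exists m1, s <= m1 <= m /\ (u1.1 - u3.1) + m1 * (u1.2 - u3.2) = 0.
  by apply: affine_zero => //; move: a2 h; rewrite /aff; lra.
have [m2 [/andP[mm2 m2t] m2e]] : exists m2, m <= m2 <= t /\ (u3.1 - u2.1) + m2 * (u3.2 - u2.2) = 0.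
  by apply: affine_zero => //; move: b2 h me; rewrite /aff; lra.
have k1 : (u1.1 - u2.1) + m1 * (u1.2 - u2.2) <= 0.
  by apply: (affine_le sm1 m1m); move: a1; rewrite /aff; lra.
have k2 : (u2.1 - u1.1) + m2 * (u2.2 - u1.2) <= 0.
  by apply: (affine_le mm2 m2t); move: b1; rewrite /aff; lra.
rewrite /aff in a1 a2 b1 b2 h.
apply: (@bound_trans s m1 t); first by apply: l1; rewrite /low /aff; try split; lra.
apply: (@bound_trans m1 m2 t); first by apply: l3; rewrite /low /aff; try split; lra.
by apply: l2; rewrite /low /aff; try split; lra.
Qed.

(** Each affine function is lowest on an interval, so the unit interval
    splits into at most three consecutive intervals, each with its own bound,
    and these bounds add up. The functions will be the barycentric coordinates
    along a segment, and the intervals its intersections with the three parts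
    of the split triangle. *)
Lemma lip_envelope u1 u2 u3 : lip u1 u2 u3 -> lip u2 u1 u3 -> lip u3 u1 u2 ->
  forall s t, 0 <= s -> s <= t -> t <= 1 -> bound s t.
Proof.
have sw u v w (t : R) : low u v w t -> low u w v t by move=> [].
have lsw u v w : lip u v w -> lip u w v.
  by move=> l s t ? ? ? /sw ? /sw ?; exact: l.
have tri t : [\/ low u1 u2 u3 t, low u2 u1 u3 t | low u3 u1 u2 t].
  rewrite /low; move: (aff u1 t) (aff u2 t) (aff u3 t) => a b c.
  have [h12|h12] := leP a b; have [h13|h13] := leP a c; have [h23|h23] := leP b c;
  first [by constructor 1|by constructor 2; split=> //; lra|by constructor 3; split; lra|exfalso; lra].
move=> l1 l2 l3 s t s0 st t1.
case: (tri s) => hs; case: (tri t) => ht.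
- exact: l1.
- exact: (chain12 l1 l2 l3).
- by apply: (chain12 (lsw _ _ _ l1) l3 l2) => //; exact: sw.
- exact: (chain12 l2 l1 (lsw _ _ _ l3)).
- exact: l2.
- by apply: (chain12 (lsw _ _ _ l2) (lsw _ _ _ l3) l1) => //; exact: sw.
- by apply: (chain12 l3 (lsw _ _ _ l1) (lsw _ _ _ l2)) => //; exact: sw.
- by apply: (chain12 (lsw _ _ _ l3) (lsw _ _ _ l2) (lsw _ _ _ l1)) => //; exact: sw.
- exact: l3.
Qed.
End Envelope.

Lemma mvt_line f (G : plane R -> plane R) a v (s t B : R) : s <= t ->
  (forall r, s <= r <= t -> is_grad f (a + r *: v) (G (a + r *: v))) ->
  (forall r, s <= r <= t -> `|dot (G (a + r *: v)) v| <= B) ->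
  `|f (a + t *: v) - f (a + s *: v)| <= B * (t - s).
Proof.
move=> st hG hB.
have D r : s <= r <= t ->
  is_derive r (1:R) (fun r => f (a + r *: v)) (dot (G (a + r *: v)) v).
  by move=> h; apply: is_grad_line; exact: hG.
have [||c] := @MVT_segment R (fun r => f (a + r *: v)) (fun r => dot (G (a + r *: v)) v) s t st.
- by move=> r; rewrite in_itv /= => /andP[? ?]; apply: D; rewrite !ltW.
- by apply: derivable_within_continuous => r; rewrite in_itv /= => /D [].
rewrite in_itv /= => ch ->.
by rewrite normrM (ger0_norm (_ : 0 <= t - s)) ?subr_ge0 // ler_wpM2r ?subr_ge0 // hB.
Qed.

End CubicCalculus.

(** * Barycentric coordinates *)

Section Triangles.
Variable R : realType.
Implicit Types (a b c p q x y z v : plane R) (f : plane R -> R) (T A E : simplex R).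

(** The l1 norm bounds a scalar product by a componentwise bound without
    square roots. *)
Definition n1 v : R := `|v.1| + `|v.2|.

(** Both orientations are allowed. *)
Definition tri a b c := cross (b - a) (c - a) != 0.

Lemma tri_rot a b c : tri a b c -> tri b c a.
Proof. by rewrite /tri (_ : cross (c - b) _ = cross (b - a) (c - a)) // /cross /=; ring. Qed.

Lemma tri_swap a b c : tri a b c -> tri b a c.
Proof.
by rewrite /tri (_ : cross (a - b) _ = - cross (b - a) (c - a)) ?oppr_eq0 // /cross /=; ring.
Qed.

Lemma tri_neq a b c : tri a b c -> a != b.
Proof.
move=> h; apply: contra_neq h => ->.
by rewrite subrr /cross /= !mul0r subrr.
Qed.

Lemma tri_uniq a b c : tri a b c -> uniq [:: a; b; c].
Proof.
move=> h /=; rewrite !inE (negbTE (tri_neq h)) /= andbT.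
rewrite (negbTE (tri_neq (tri_rot h))) andbT.
by rewrite eq_sym (tri_neq (tri_rot (tri_rot h))).
Qed.

Lemma enum3 a b c : tri a b c -> perm_eq (enum_fset [fset a; b; c]) [:: a; b; c].
Proof.
move=> h; apply: uniq_perm; first exact: fset_uniq.
  exact: tri_uniq.
by move=> x; rewrite !inE orbA.
Qed.

Lemma enum2 a b : a != b -> perm_eq (enum_fset [fset a; b]) [:: a; b].
Proof.
move=> h; apply: uniq_perm; first exact: fset_uniq.
  by rewrite /= inE h.
by move=> x; rewrite !inE.
Qed.

Lemma sum3 (V : nmodType) a b c (F : plane R -> V) : tri a b c ->
  \sum_(z <- [fset a; b; c]) F z = F a + F b + F c.
Proof. by move=> h; rewrite (perm_big _ (enum3 h)) /= !big_cons big_nil addr0 addrA. Qed.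

Lemma sum2 (V : nmodType) a b (F : plane R -> V) : a != b ->
  \sum_(z <- [fset a; b]) F z = F a + F b.
Proof. by move=> h; rewrite (perm_big _ (enum2 h)) /= !big_cons big_nil addr0. Qed.

Lemma prod2 a b (F : plane R -> R) : a != b ->
  \prod_(z <- [fset a; b]) F z = F a * F b.
Proof. by move=> h; rewrite (perm_big _ (enum2 h)) /= !big_cons big_nil mulr1. Qed.

Lemma enum2_cases a b : a != b ->
  enum_fset [fset a; b] = [:: a; b] \/ enum_fset [fset a; b] = [:: b; a].
Proof.
move=> h; have := enum2 h; have := fset_uniq [fset a; b].
move: (enum_fset _) => s us hs.
have hz := perm_size hs; have hm := perm_mem hs; move: us hz hm {hs}.
case: s => [|x [|y [|]]] //= + _ hm; rewrite inE andbT.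
have := hm x; have := hm y; rewrite !inE !eqxx /= orbT => /esym/orP[]/eqP-> /esym/orP[]/eqP->;
  rewrite ?eqxx // => _; by [left|right].
Qed.

(** The barycentric coordinate of the vertex a in the triangle a, b, c, and
    its linear part. With the vertices as arguments the three coordinates are
    one function with rotated arguments. *)
Definition bc a b c x : R := cross (x - b) (c - b) / cross (a - b) (c - b).
Definition bcl a b c v : R := cross v (c - b) / cross (a - b) (c - b).

Lemma tri_cross a b c : tri a b c -> cross (a - b) (c - b) != 0.
Proof.
by rewrite /tri (_ : cross (a - b) _ = - cross (b - a) (c - a)) ?oppr_eq0 // /cross /=; ring.
Qed.

Lemma bc_swap a b c x : bc a b c x = bc a c b x.
Proof.
rewrite /bc; have -> : cross (x - c) (b - c) = - cross (x - b) (c - b) by rewrite /cross /=; ring.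
have -> : cross (a - c) (b - c) = - cross (a - b) (c - b) by rewrite /cross /=; ring.
by rewrite invrN mulrNN.
Qed.

Lemma bc_sum a b c x : tri a b c -> bc a b c x + bc b a c x + bc c a b x = 1.
Proof.
move=> h; have hD := tri_cross h; rewrite /bc.
have -> : cross (b - a) (c - a) = - cross (a - b) (c - b) by rewrite /cross /=; ring.
have -> : cross (c - a) (b - a) = cross (a - b) (c - b) by rewrite /cross /=; ring.
rewrite invrN mulrN -mulNr -!mulrDl; apply: (mulIf hD); rewrite mulfVK // mul1r.
by rewrite /cross /=; ring.
Qed.

Lemma bc_repr a b c x : tri a b c ->
  x = bc a b c x *: a + bc b a c x *: b + bc c a b x *: c.
Proof.
move=> h; have hD := tri_cross h; rewrite /bc.
have -> : cross (b - a) (c - a) = - cross (a - b) (c - b) by rewrite /cross /=; ring.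
have -> : cross (c - a) (b - a) = cross (a - b) (c - b) by rewrite /cross /=; ring.
rewrite invrN mulrN -mulNr.
have aux (u v : R) : u / cross (a - b) (c - b) * v * cross (a - b) (c - b) = u * v.
  by rewrite mulrAC mulfVK.
by apply: plane_eq; rewrite /= /GRing.scale /=; apply: (mulIf hD);
  rewrite !mulrDl !aux /cross /=; ring.
Qed.

Lemma bc_comb a b c (s t u : R) : tri a b c -> s + t + u = 1 ->
  bc a b c (s *: a + t *: b + u *: c) = s.
Proof.
move=> h e; have hD := tri_cross h; rewrite /bc; apply: (mulIf hD); rewrite mulfVK //.
have -> : s = 1 - t - u by rewrite -e; ring.
by rewrite /cross /= /GRing.scale /=; ring.
Qed.

Lemma bcB a b c x y : bc a b c x - bc a b c y = bcl a b c (x - y).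
Proof. by rewrite /bc /bcl -mulrBl; congr (_ / _); rewrite /cross /=; ring. Qed.

Lemma bc_line a b c x v (t : R) : bc a b c (x + t *: v) = bc a b c x + t * bcl a b c v.
Proof. by rewrite /bc /bcl mulrA -mulrDl; congr (_ / _); rewrite /cross /= /GRing.scale /=; ring. Qed.

Lemma bclE a b c v : bcl a b c v = bcl a b c (1,0) * v.1 + bcl a b c (0,1) * v.2.
Proof. by rewrite /bcl !(mulrAC _ (_^-1)) -mulrDl; congr (_ / _); rewrite /cross /=; ring. Qed.

Lemma bcE a b c x : bc a b c x = bc a b c 0 + bcl a b c (1,0) * x.1 + bcl a b c (0,1) * x.2.
Proof. by rewrite -addrA -bclE; have := bcB a b c x 0; rewrite subr0; lra. Qed.

Lemma bc_grad a b c x : is_grad (bc a b c) x (bcl a b c (1,0), bcl a b c (0,1)).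
Proof.
have -> : bc a b c = fun x => bc a b c 0 + bcl a b c (1,0) * x.1 + bcl a b c (0,1) * x.2.
  by apply: funext => y; exact: bcE.
apply: is_grad_eq.
  apply: is_gradD; [apply: is_gradD; [exact: is_grad_cst|]|]; apply: is_gradZ;
  [exact: is_grad_fst|exact: is_grad_snd].
by plane_ring.
Qed.

Lemma bc_continuous a b c : continuous (bc a b c).
Proof.
have -> : bc a b c = fun x => bc a b c 0 + bcl a b c (1,0) * x.1 + bcl a b c (0,1) * x.2.
  by apply: funext => y; exact: bcE.
move=> x; apply: cvgD; [apply: cvgD; [exact: cvg_cst|]|];
  (apply: cvgM; [exact: cvg_cst|]); [exact: cvg_fst|exact: cvg_snd].
Qed.

Lemma bc_self a b c : tri a b c -> bc a b c a = 1.
Proof.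
move=> h; rewrite -[X in bc _ _ _ X](_ : 1 *: a + 0 *: b + 0 *: c = a) ?bc_comb //.
  by rewrite !addr0.
by rewrite scale1r !scale0r !addr0.
Qed.

Lemma bc_other a b c : bc a b c b = 0.
Proof. by rewrite /bc subrr /cross /= !mul0r subrr mul0r. Qed.

Lemma bc_other2 a b c : bc a b c c = 0.
Proof. by rewrite bc_swap bc_other. Qed.

Lemma bary3 a b c : tri a b c -> bary [fset a; b; c] a = bc a b c.
Proof.
move=> h; apply: funext => x; rewrite /bary.
have ab := tri_neq h; have ca := tri_neq (tri_rot (tri_rot h)).
have -> : ([fset a; b; c] `\ a)%fset = [fset b; c].
  apply/fsetP => z; rewrite !inE.
  have [->|] //= := eqVneq z a.
  by rewrite (negbTE ab) eq_sym (negbTE ca).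
by have [->|->] /= := enum2_cases (tri_neq (tri_rot h)); rewrite -?/(bc a b c x) // -/(bc a c b x) bc_swap.
Qed.

Lemma triangle_card T : triangle T -> #|` T| = 3%N.
Proof. by move=> [a [b [c [-> h]]]]; rewrite (perm_size (enum3 h)). Qed.

Lemma fset3_rot a b c : [fset a; b; c] = [fset b; c; a].
Proof. by apply/fsetP => z; rewrite !inE -!orbA orbC -orbA. Qed.
Lemma fset3_swap a b c : [fset a; b; c] = [fset b; a; c].
Proof. by apply/fsetP => z; rewrite !inE [(z == a) || _]orbC. Qed.

Lemma triangle_vertex T z : triangle T -> z \in T ->
  exists b c, T = [fset z; b; c] /\ tri z b c.
Proof.
move=> [a [b [c [-> h]]]]; rewrite !inE -orbA => /or3P[] /eqP ->.
- by exists b, c.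
- by exists c, a; rewrite fset3_rot; split=> //; exact: tri_rot.
- by exists a, b; rewrite -fset3_rot; split=> //; exact/tri_rot/tri_rot.
Qed.

Lemma edgesP T E : reflect (E `<=` T /\ #|` E| = 2)%fset (E \in edges T).
Proof.
rewrite !inE /= fpowersetE; apply: (iffP andP) => -[h1 h2]; split=> //; exact/eqP.
Qed.

Lemma edge2 E : #|` E| = 2%N -> exists a b, E = [fset a; b] /\ a != b.
Proof.
move=> cE; have := fset_uniq E; have hm z : (z \in E) = (z \in enum_fset E) by [].
move: cE hm; case e: (enum_fset E) => [|a [|b [|]]] //= cE hm; rewrite ?e // in cE.
rewrite inE andbT => ab; exists a, b; split=> //.
by apply/fsetP => z; rewrite hm !inE.
Qed.

Lemma triangle_edge T E : triangle T -> E \in edges T ->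
  exists a b c, [/\ T = [fset a; b; c], E = [fset a; b] & tri a b c].
Proof.
move=> hT /edgesP [sE cE].
have : #|` (T `\` E)%fset| = 1%N.
  by rewrite cardfsD (fsetIidPr sE) cE triangle_card.
move/eqP/cardfs1P => [c hc].
have cT : c \in T by have := fset11 c; rewrite -hc inE => /andP[].
have [a [b [eT h]]] := triangle_vertex hT cT.
exists a, b, c; rewrite eT fset3_rot; split=> //; last exact: tri_rot.
have -> : E = (T `\ c)%fset by rewrite -hc; apply/fsetP => z; rewrite !inE; case: (boolP (z \in T)) => // zT; rewrite ?andbF ?andbT ?negbK //; apply: contraNF zT => /(fsubsetP sE).
have ca := tri_neq h; have bc := tri_neq (tri_rot (tri_rot h)).
apply/fsetP => z; rewrite eT !inE; have [->|] //= := eqVneq z c.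
by rewrite (negbTE ca) eq_sym (negbTE bc).
Qed.

Lemma edges3 a b c : tri a b c ->
  perm_eq (enum_fset (edges [fset a; b; c]))
    [:: [fset a; b]; [fset b; c]; [fset c; a]].
Proof.
move=> h.
have ab := tri_neq h; have bc := tri_neq (tri_rot h); have ca := tri_neq (tri_rot (tri_rot h)).
apply: uniq_perm; first exact: fset_uniq.
  rewrite /= !inE; apply/and3P; split=> //; rewrite ?negb_or; try (apply/andP; split);
    apply/eqP => /fsetP.
  - by move/(_ a); rewrite !inE eqxx (negbTE ab) eq_sym (negbTE ca).
  - by move/(_ b); rewrite !inE eqxx orbT (negbTE bc) eq_sym (negbTE ab).
  - by move/(_ b); rewrite !inE eqxx (negbTE bc) eq_sym (negbTE ab).
move=> E; rewrite -[E \in enum_fset _]/(E \in edges [fset a; b; c]).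
apply/idP/idP.
  move=> hE; have := triangle_edge (ex_intro _ a (ex_intro _ b (ex_intro _ c (conj erefl h)))) hE.
  move=> [x [y [z [eT -> t]]]].
  have hx : x \in [fset a; b; c] by rewrite eT !inE eqxx.
  have hy : y \in [fset a; b; c] by rewrite eT !inE eqxx orbT.
  have xy := tri_neq t; move: hx hy.
  rewrite !inE -!orbA => /or3P[]/eqP ? /or3P[]/eqP ?; subst x y;
    rewrite ?eqxx // in xy.
  all: rewrite ?[[fset b; a]%fset]fsetUC ?[[fset a; c]%fset]fsetUC ?[[fset c; b]%fset]fsetUC ?eqxx ?orbT //.
move=> hE; have : [|| E == [fset a; b], E == [fset b; c] | E == [fset c; a]].
  by move: hE; rewrite !in_cons in_nil orbF.
case/or3P => /eqP ->; apply/edgesP; (split; first by apply/fsubsetP => x; rewrite !inE => /orP[] /eqP ->; rewrite eqxx ?orbT).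
all: by rewrite cardfs2 ?ab ?bc ?ca.
Qed.
End Triangles.

(** * Closed triangles *)

Section Hulls.
Variable R : realType.
Implicit Types (a b c p q x y z v : plane R) (f : plane R -> R) (T A E : simplex R).

Lemma triangle3 a b c : tri a b c -> triangle [fset a; b; c].
Proof. by move=> h; exists a, b, c. Qed.

Lemma bary3b a b c : tri a b c -> bary [fset a; b; c] b = bc b a c.
Proof. by move=> h; rewrite fset3_swap bary3 //; exact: tri_swap. Qed.

Lemma bary3c a b c : tri a b c -> bary [fset a; b; c] c = bc c a b.
Proof. by move=> h; rewrite -fset3_rot bary3 //; exact/tri_rot/tri_rot. Qed.

Lemma forall3 a b c (P : plane R -> Prop) :
  (forall z, z \in [fset a; b; c] -> P z) <-> [/\ P a, P b & P c].
Proof.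
split; first by move=> h; split; apply: h; rewrite !inE eqxx ?orbT.
by move=> [? ? ?] z; rewrite !inE -orbA => /or3P[] /eqP ->.
Qed.

Lemma bary_sum T x : triangle T -> \sum_(z <- T) bary T z x = 1.
Proof.
by move=> [a [b [c [-> h]]]]; rewrite sum3 // bary3 // bary3b // bary3c // bc_sum.
Qed.

Lemma bary_repr T x : triangle T -> x = \sum_(z <- T) bary T z x *: z.
Proof.
by move=> [a [b [c [-> h]]]]; rewrite sum3 // bary3 // bary3b // bary3c // -bc_repr.
Qed.

Lemma bary_uniq T x (w : plane R -> R) : triangle T -> \sum_(z <- T) w z = 1 ->
  x = \sum_(z <- T) w z *: z -> forall z, z \in T -> w z = bary T z x.
Proof.
move=> [a [b [c [-> h]]]]; rewrite !sum3 // => hs hx; apply/forall3.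
rewrite bary3 // bary3b // bary3c //; split; rewrite hx.
- by rewrite bc_comb.
- rewrite [w a *: a + _]addrC bc_comb //; first exact: tri_swap.
  by rewrite [w b + _]addrC.
- rewrite [w a *: a + _ + _]addrC addrA bc_comb //.
    by apply/tri_rot/tri_rot.
  by move: hs; rewrite addrC addrA.
Qed.

(** Barycentric coordinates are unique, so the weights of a convex
    combination of some vertices, extended by zero, are the coordinates of the
    point. *)
Lemma tri_face T A x : triangle T -> (A `<=` T)%fset ->
  hull A x <-> (forall z, z \in T -> 0 <= bary T z x) /\
               (forall z, z \in T -> z \notin A -> bary T z x = 0).
Proof.
move=> hT sA.
have mk (V : nmodType) (F : plane R -> V) : (forall z, z \in T -> z \notin A -> F z = 0) ->
    \sum_(z <- T) F z = \sum_(z <- A) F z.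
  by move=> h0; rewrite (big_fset_incl _ sA).
split.
  move=> [w [w0 w1 wx]].
  pose w' z := if z \in A then w z else 0.
  have wA (V : nmodType) (F : R -> plane R -> V) : (forall z, F 0 z = 0) ->
      \sum_(z <- T) F (w' z) z = \sum_(z <- A) F (w z) z.
    move=> F0; rewrite mk; last by move=> z _ /negbTE zA; rewrite /w' zA.
    by apply: eq_big_seq => z zA; rewrite /w'; have -> : z \in A by [].
  have U := bary_uniq (x := x) (w := w') hT.
  have {}U : forall z, z \in T -> w' z = bary T z x.
    apply: U; first by rewrite (wA _ (fun r _ => r)).
    by rewrite wx (wA _ (fun r z => r *: z)) // => z; rewrite scale0r.
  split=> z zT; rewrite -U // /w'; last by move/negbTE ->.
  by case: ifP => // /w0.
move=> [h0 h1]; exists (fun z => bary T z x); split.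
- by move=> z /(fsubsetP sA); exact: h0.
- by rewrite -mk // bary_sum.
- by rewrite -mk -?bary_repr // => z zT zA; rewrite h1 // scale0r.
Qed.

Lemma tri_hull T x : triangle T -> hull T x <-> (forall z, z \in T -> 0 <= bary T z x).
Proof.
move=> hT; rewrite (tri_face x hT (fsubset_refl T)); split; first by case.
by move=> h; split=> // z zT /negP; contradiction.
Qed.

Lemma hull3 a b c x : tri a b c ->
  hull [fset a; b; c] x <-> [/\ 0 <= bc a b c x, 0 <= bc b a c x & 0 <= bc c a b x].
Proof.
move=> h; rewrite tri_hull; last exact: triangle3.
rewrite -{1}bary3 // -{1}bary3b // -{1}bary3c //.
exact: (forall3 a b c (fun z => 0 <= bary _ z x)).
Qed.

Lemma hull_vertex A z : z \in A -> hull A z.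
Proof.
move=> zA; exists (fun y => (y == z)%:R); split.
- by move=> y _; rewrite ler0n.
- rewrite (big_fsetD1 z) //= eqxx big1_seq ?addr0 // => y /andP[_].
  by rewrite !inE => /andP[/negbTE ->].
- rewrite (big_fsetD1 z) //= eqxx scale1r big1_seq ?addr0 // => y /andP[_].
  by rewrite !inE => /andP[/negbTE -> _]; rewrite scale0r.
Qed.

Lemma hull2 a b x : a != b ->
  hull [fset a; b] x <-> exists t : R, 0 <= t <= 1 /\ x = a + t *: (b - a).
Proof.
move=> ab; split.
  move=> [w [w0]]; rewrite !sum2 // => w1 ->; exists (w b); split.
    have := w0 a; have := w0 b; rewrite !inE !eqxx orbT => /(_ isT) ? /(_ isT) ?.
    by apply/andP; split; lra.
  have -> : w a = 1 - w b by rewrite -w1; ring.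
  by plane_ring.
move=> [t [/andP[t0 t1] ->]].
exists (fun z => if z == b then t else 1 - t); split.
- by move=> z _; case: ifP => _; lra.
- by rewrite sum2 // eqxx (negbTE ab); ring.
- rewrite sum2 // eqxx (negbTE ab).
  by plane_ring.
Qed.

Lemma bary_affine T z : triangle T -> z \in T -> exists a b c, bary T z = bc a b c.
Proof.
by move=> hT zT; have [b [c [-> h]]] := triangle_vertex hT zT; exists z, b, c; exact: bary3.
Qed.

Lemma bary_line T z x y (t : R) : triangle T -> z \in T ->
  bary T z (x + t *: (y - x)) = (1 - t) * bary T z x + t * bary T z y.
Proof.
move=> hT zT; have [a [b [c ->]]] := bary_affine hT zT.
by rewrite bc_line -bcB; ring.
Qed.

Lemma hull_convex T x y (t : R) : triangle T -> 0 <= t <= 1 -> hull T x -> hull T y ->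
  hull T (x + t *: (y - x)).
Proof.
move=> hT /andP[t0 t1]; rewrite !tri_hull // => hx hy z zT.
rewrite bary_line //; apply: addr_ge0; apply: mulr_ge0 => //; [lra|exact: hx|exact: hy].
Qed.

Lemma bary_vertex T y z : triangle T -> y \in T -> z \in T -> bary T z y = (y == z)%:R.
Proof.
move=> hT yT zT; have [b [c [e h]]] := triangle_vertex hT zT; rewrite e bary3 //.
move: yT; rewrite e !inE -orbA.
have zb := tri_neq h; have cz := tri_neq (tri_rot (tri_rot h)).
case/or3P => /eqP ->; rewrite ?eqxx ?bc_self ?bc_other ?bc_other2 //.
- by rewrite eq_sym (negbTE zb).
- by rewrite (negbTE cz).
Qed.

Lemma near_pos f x : continuous f -> 0 < f x -> \forall y \near x, 0 < f y.
Proof. by move=> cf h; apply: cvgr_gt (cf x) _ h. Qed.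

Lemma tri_interior T x : triangle T -> (forall z, z \in T -> 0 < bary T z x) ->
  \forall y \near x, forall z, z \in T -> 0 < bary T z y.
Proof.
move=> [a [b [c [-> h]]]] /forall3; rewrite bary3 // bary3b // bary3c // => -[ha hb hc].
near=> y; apply/forall3; rewrite bary3 // bary3b // bary3c //.
by split; near: y; apply: near_pos => //; exact: bc_continuous.
Unshelve. all: by end_near. Qed.

Lemma enorm_comp v : `|v.1| <= enorm v /\ `|v.2| <= enorm v.
Proof.
rewrite /enorm /dot -!expr2; split; rewrite -sqrtr_sqr ler_wsqrtr //.
  by rewrite lerDl sqr_ge0.
by rewrite lerDr sqr_ge0.
Qed.

Lemma enorm_ge0 v : 0 <= enorm v. Proof. exact: sqrtr_ge0. Qed.

Lemma enorm_sqr v : enorm v ^+ 2 = v.1 ^+ 2 + v.2 ^+ 2.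
Proof. by rewrite /enorm sqr_sqrtr /dot -!expr2 // addr_ge0 ?sqr_ge0. Qed.

Lemma enorm_le v (r : R) : 0 <= r -> v.1 ^+ 2 + v.2 ^+ 2 <= r ^+ 2 -> enorm v <= r.
Proof. by move=> r0; rewrite -enorm_sqr; rewrite ler_pXn2r // nnegrE ?enorm_ge0. Qed.

Lemma n1_ge0 v : 0 <= n1 v. Proof. by rewrite addr_ge0. Qed.

Lemma n1_le v : n1 v <= 2 * enorm v.
Proof. by have [] := enorm_comp v; rewrite /n1; lra. Qed.

Lemma dot_n1 v p (B : R) : `|p.1| <= B -> `|p.2| <= B -> `|dot p v| <= B * n1 v.
Proof.
move=> h1 h2; rewrite /dot (le_trans (ler_normD _ _)) // !normrM /n1 mulrDr.
by apply: lerD; apply: ler_wpM2r.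
Qed.

(** The shape of T as it enters the estimates: r stands for the
    inradius, by its effect on the slopes of the barycentric coordinates, and
    D * r bounds the diameter. *)
Definition fat T (r D : R) := [/\ 0 < r,
  forall z v, z \in T -> `|bary T z v - bary T z 0| <= n1 v / (2 * r)
 & forall x y, hull T x -> hull T y -> n1 (x - y) <= D * r].

(** A barycentric coordinate takes values between 0 and 1 on T, so it varies
    by at most 1 along a diameter of the inscribed ball. *)
Lemma ball_slope T c (r : R) : triangle T -> 0 < r -> cball c r `<=` hull T ->
  forall z v, z \in T -> `|bary T z v - bary T z 0| <= n1 v / (2 * r).
Proof.
move=> hT r0 hb z v zT.
have in01 x : hull T x -> 0 <= bary T z x <= 1.
  rewrite tri_hull // => h; rewrite h //= -(bary_sum x hT).
  rewrite (big_fsetD1 z) //= lerDl big_seq_cond; apply: sumr_ge0 => y.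
  by rewrite andbT !inE => /andP[_ yT]; exact: h.
have hp (s1 s2 : R) : s1 ^+ 2 + s2 ^+ 2 = 1 -> 0 <= bary T z (c + r *: (s1, s2)) <= 1.
  move=> h; apply/in01/hb; rewrite /cball /=; apply: enorm_le; first exact: ltW.
  rewrite /= /GRing.scale /=.
  have -> : (c.1 + r * s1 - c.1) ^+ 2 + (c.2 + r * s2 - c.2) ^+ 2 = r ^+ 2 * (s1 ^+ 2 + s2 ^+ 2) by ring.
  by rewrite h mulr1.
have [a [b [d eb]]] := bary_affine hT zT.
rewrite eb bcB subr0 bclE.
have h1 := hp 1 0; have h2 := hp (-1) 0; have h3 := hp 0 1; have h4 := hp 0 (-1).
rewrite eb !bc_line in h1 h2 h3 h4.
have e1 : bcl a b d (-1, 0) = - bcl a b d (1, 0) by rewrite bclE /=; ring.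
have e2 : bcl a b d (0, -1) = - bcl a b d (0, 1) by rewrite bclE /=; ring.
rewrite e1 in h2; rewrite e2 in h4.
have /andP[? ?] : 0 <= bc a b d c + r * bcl a b d (1, 0) <= 1 by apply: h1; ring.
have /andP[? ?] : 0 <= bc a b d c + r * - bcl a b d (1, 0) <= 1 by apply: h2; ring.
have /andP[? ?] : 0 <= bc a b d c + r * bcl a b d (0, 1) <= 1 by apply: h3; ring.
have /andP[? ?] : 0 <= bc a b d c + r * - bcl a b d (0, 1) <= 1 by apply: h4; ring.
have k (s : R) : r * s <= 2^-1 -> - 2^-1 <= r * s -> `|s| <= (2 * r)^-1.
  move=> k1 k2; rewrite ler_norml lerNl -[(2 * r)^-1]mul1r !ler_pdivlMr ?mulr_gt0 //.
  by apply/andP; split; lra.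
have := @dot_n1 v (bcl a b d (1, 0), bcl a b d (0, 1)) (2 * r)^-1.
by rewrite /dot /= [_^-1 * _]mulrC; apply; apply: k; lra.
Qed.

Lemma ball_diam T c' (r' : R) x y : hull T `<=` cball c' r' -> hull T x -> hull T y ->
  n1 (x - y) <= 4 * r'.
Proof.
move=> h /h; rewrite /cball /= => h1 /h; rewrite /cball /= => h2.
have [a1 a2] := enorm_comp (x - c'); have [b1 b2] := enorm_comp (y - c').
have e1 := le_trans (ler_normB ((x - c').1) ((y - c').1)) (lerD (le_trans a1 h1) (le_trans b1 h2)).
have e2 := le_trans (ler_normB ((x - c').2) ((y - c').2)) (lerD (le_trans a2 h1) (le_trans b2 h2)).
have h3 : (x - c').1 - (y - c').1 = (x - y).1 by rewrite /=; ring.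
have h4 : (x - c').2 - (y - c').2 = (x - y).2 by rewrite /=; ring.
rewrite h3 in e1; rewrite h4 in e2.
by rewrite /n1; lra.
Qed.

End Hulls.

(** * The coefficients of a Hsieh-Clough-Tocher function *)

Section HCT.
Variable R : realType.
Implicit Types (a b c p q x y z v : plane R) (f : plane R -> R) (T A E : simplex R).

Let bd (x B : R) := - B <= x <= B.
Lemma bdE (x B : R) : (`|x| <= B) = bd x B. Proof. exact: ler_norml. Qed.

(** Two pieces share the spoke that is the first axis of the frame of k and
    the second axis of the frame of k'. The first four equations say that their
    values agree on it, the other three that their derivatives across it do:
    since the spokes from the centroid add up to zero, the first axis of k' is
    minus the sum of the axes of k. *)
Definition glued (k k' : nat -> nat -> R) :=
  [/\ k 0%N 0%N = k' 0%N 0%N, k 1%N 0%N = k' 0%N 1%N, k 2%N 0%N = k' 0%N 2%N, k 3%N 0%N = k' 0%N 3%N &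
  [/\ k' 1%N 0%N = - k 1%N 0%N - k 0%N 1%N, k' 1%N 1%N = - (2 * k 2%N 0%N) - k 1%N 1%N & k' 1%N 2%N = - (3 * k 3%N 0%N) - k 2%N 1%N]].

(** In the frame of two spokes (1, 0) and (0, 1) are vertices, and
    (1/2, 1/2) is the midpoint of the edge between them. The missing data at
    (0, 1) belong to the next piece. *)
Definition hermite (k : nat -> nat -> R) (B : R) :=
  [/\ cubf k 1 0 = 0, `|cubs k 1 0| <= B, `|cubt k 1 0| <= B, `|cubs k 0 1| <= B & `|cubs k 2^-1 2^-1| <= B].

Definition coef_le (k : nat -> nat -> R) (B : R) :=
  [/\ `|k 2%N 0%N| <= B, `|k 1%N 1%N| <= B, `|k 0%N 2%N| <= B & [/\ `|k 3%N 0%N| <= B, `|k 2%N 1%N| <= B, `|k 1%N 2%N| <= B & `|k 0%N 3%N| <= B]].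

(** The coefficients of one piece are eliminated from its midpoint datum mu,
    which leaves an equation between the value V and the slope Gc along the
    opposite spoke, both at the centroid. *)
Lemma midpoint_equation_bound (V Ga Gb Gc pa pb pc qa cc dca dcb gaa gbb gcc gab gba mu B : R) :
  Ga + Gb + Gc = 0 ->
  pa = - (3 * V) - 2 * Ga - gaa -> pb = - (3 * V) - 2 * Gb - gbb -> pc = - (3 * V) - 2 * Gc - gcc ->
  qa = 2 * V + Ga + gaa -> cc = - pa - pb + pc ->
  dca = gab - Gb - cc -> dcb = gba - Ga - cc ->
  mu = Ga + pa + cc / 2 + 3 / 4 * qa + dca / 2 + dcb / 4 ->
  `|gaa| <= B -> `|gbb| <= B -> `|gcc| <= B -> `|gab| <= B -> `|gba| <= B -> `|mu| <= B ->
  `|3 / 2 * Gc - 9 / 4 * V| <= 3 * B.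
Proof.
move=> G0 -> -> -> -> -> -> -> e; rewrite !bdE /bd => /andP[? ?] /andP[? ?] /andP[? ?] /andP[? ?] /andP[? ?] /andP[? ?].
have hG : Gc = - Ga - Gb by rewrite -[Gc](addKr (Ga + Gb)) G0; ring.
have -> : 3 / 2 * Gc - 9 / 4 * V = mu + gaa / 2 + gbb / 4 - gcc / 4 - gab / 2 - gba / 4.
  by rewrite e hG; field.
by apply/andP; split; lra.
Qed.

(** The slopes along the three spokes add up to zero, so that the sum of the
    three equations contains V only. *)
Lemma centroid_data_bound (V Ga Gb Gc B : R) : Ga + Gb + Gc = 0 ->
  `|3 / 2 * Ga - 9 / 4 * V| <= 3 * B -> `|3 / 2 * Gb - 9 / 4 * V| <= 3 * B ->
  `|3 / 2 * Gc - 9 / 4 * V| <= 3 * B ->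
  [/\ `|V| <= 2 * B, `|Ga| <= 5 * B, `|Gb| <= 5 * B & `|Gc| <= 5 * B].
Proof.
rewrite !bdE /bd => h /andP[? ?] /andP[? ?] /andP[? ?].
have B0 : 0 <= B by lra.
by split; apply/andP; split; lra.
Qed.

Lemma hermite_coefs k B : hermite k B ->
  (k 2%N 0%N = - (3 * k 0%N 0%N) - 2 * k 1%N 0%N - cubs k 1 0) /\ (k 3%N 0%N = 2 * k 0%N 0%N + k 1%N 0%N + cubs k 1 0)
  /\ (k 2%N 1%N = cubt k 1 0 - k 0%N 1%N - k 1%N 1%N) /\ (k 1%N 2%N = cubs k 0 1 - k 1%N 0%N - k 1%N 1%N).
Proof.
move=> [h _ _ _ _]; rewrite /cubf in h; rewrite /cubs /cubt.
by rewrite !(expr1n, expr0n, mulr1, mulr0, addr0) /= in h *; split; [lra|split; [lra|split; lra]].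
Qed.

Lemma coef_p_bound (x V G g B : R) : x = - (3 * V) - 2 * G - g ->
  `|V| <= 2 * B -> `|G| <= 5 * B -> `|g| <= B -> `|x| <= 35 * B.
Proof. by rewrite !bdE /bd => -> /andP[? ?] /andP[? ?] /andP[? ?]; apply/andP; split; lra. Qed.

Lemma coef_q_bound (x V G g B : R) : x = 2 * V + G + g ->
  `|V| <= 2 * B -> `|G| <= 5 * B -> `|g| <= B -> `|x| <= 35 * B.
Proof. by rewrite !bdE /bd => -> /andP[? ?] /andP[? ?] /andP[? ?]; apply/andP; split; lra. Qed.

Lemma coef_c_bound (x V G g h l p q r Ga Gb B : R) : x = - p - q + r ->
  p = - (3 * V) - 2 * Ga - g -> q = - (3 * V) - 2 * Gb - h -> r = - (3 * V) - 2 * G - l ->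
  Ga + Gb + G = 0 ->
  `|V| <= 2 * B -> `|G| <= 5 * B -> `|g| <= B -> `|h| <= B -> `|l| <= B -> `|x| <= 29 * B.
Proof.
move=> -> -> -> -> h0; have -> : Ga = - Gb - G by rewrite -[Ga](addrK (Gb + G)) [Ga + _]addrA h0; ring.
rewrite !bdE /bd => /andP[? ?] /andP[? ?] /andP[? ?] /andP[? ?] /andP[? ?]; apply/andP; split; lra.
Qed.

Lemma coef_d_bound (x G g c0 B : R) : x = g - G - c0 ->
  `|G| <= 5 * B -> `|g| <= B -> `|c0| <= 29 * B -> `|x| <= 35 * B.
Proof. by rewrite !bdE /bd => -> /andP[? ?] /andP[? ?] /andP[? ?]; apply/andP; split; lra. Qed.

(** Going round the three spokes determines the mixed coefficients, because
    the number of spokes is odd. *)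
Lemma cyc_solve (x y z p q r : R) : y = - (2 * p) - x -> x = - (2 * q) - z -> z = - (2 * r) - y ->
  x = - p - q + r.
Proof. by move=> h1 h2 h3; lra. Qed.

(** Unisolvence of the Hsieh-Clough-Tocher element with a bound. The gluing
    conditions and the data at the vertices express all coefficients by the
    value and the slopes at the centroid, and the three midpoint data determine
    these. *)
Lemma hct_coef_bound ka kb kc B : glued kc kb -> glued ka kc -> glued kb ka ->
  hermite ka B -> hermite kb B -> hermite kc B ->
  [/\ coef_le ka (35 * B), coef_le kb (35 * B) & coef_le kc (35 * B)].
Proof.
move=> [a1 a2 a3 a4 [a5 a6 a7]] [b1 b2 b3 b4 [b5 b6 b7]] [c1 c2 c3 c4 [c5 c6 c7]] ha hb hc.
have [pa [qa [da1 da2]]] := hermite_coefs ha.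
have [pb [qb [db1 db2]]] := hermite_coefs hb.
have [pc [qc [dc1 dc2]]] := hermite_coefs hc.
have mE (k : nat -> nat -> R) : cubs k 2^-1 2^-1 = k 1%N 0%N + k 2%N 0%N + k 1%N 1%N / 2
    + 3 / 4 * k 3%N 0%N + k 2%N 1%N / 2 + k 1%N 2%N / 4.
  by rewrite /cubs; field.
case: ha => _ ha1 ha2 ha3 ha4; case: hb => _ hb1 hb2 hb3 hb4; case: hc => _ hc1 hc2 hc3 hc4.
rewrite c1 in pb qb; rewrite -b1 in pc qc; rewrite -c2 in da1 b5; rewrite -a2 in db1 c5; rewrite -b2 in dc1 a5.
have ecc := cyc_solve a6 b6 c6; have eca := cyc_solve b6 c6 a6; have ecb := cyc_solve c6 a6 b6.
have G0 : kc 1%N 0%N + ka 1%N 0%N + kb 1%N 0%N = 0 by rewrite a5; ring.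
have G1 : ka 1%N 0%N + kb 1%N 0%N + kc 1%N 0%N = 0 by rewrite a5; ring.
have G2 : kb 1%N 0%N + kc 1%N 0%N + ka 1%N 0%N = 0 by rewrite a5; ring.
have Mc := midpoint_equation_bound G0 pc pa pb qc ecc dc1 dc2 (mE kc) hc1 ha1 hb1 hc2 hc3 hc4.
have Ma := midpoint_equation_bound G1 pa pb pc qa eca da1 da2 (mE ka) ha1 hb1 hc1 ha2 ha3 ha4.
have Mb := midpoint_equation_bound G2 pb pc pa qb ecb db1 db2 (mE kb) hb1 hc1 ha1 hb2 hb3 hb4.
have [V Ga Gb Gc] := centroid_data_bound G0 Ma Mb Mc.
have Cc := coef_c_bound ecc pc pa pb G0 V Gc hc1 ha1 hb1.
have Ca := coef_c_bound eca pa pb pc G1 V Ga ha1 hb1 hc1.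
have Cb := coef_c_bound ecb pb pc pa G2 V Gb hb1 hc1 ha1.
have B0 : 0 <= B by apply: le_trans hc1.
have C35 (x : R) : `|x| <= 29 * B -> `|x| <= 35 * B.
  by move=> h; apply: le_trans h _; rewrite ler_wpM2r // ler_nat.
split; (split; last split).
- exact: coef_p_bound pa V Gb ha1.
- exact: C35.
- by rewrite -c3; exact: coef_p_bound pb V Gc hb1.
- exact: coef_q_bound qa V Gb ha1.
- exact: coef_d_bound da1 Gc ha2 Ca.
- exact: coef_d_bound da2 Gb ha3 Ca.
- by rewrite -c4; exact: coef_q_bound qb V Gc hb1.
- exact: coef_p_bound pb V Gc hb1.
- exact: C35.
- by rewrite -a3; exact: coef_p_bound pc V Ga hc1.
- exact: coef_q_bound qb V Gc hb1.
- exact: coef_d_bound db1 Ga hb2 Cb.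
- exact: coef_d_bound db2 Gc hb3 Cb.
- by rewrite -a4; exact: coef_q_bound qc V Ga hc1.
- exact: coef_p_bound pc V Ga hc1.
- exact: C35.
- by rewrite -b3; exact: coef_p_bound pa V Gb ha1.
- exact: coef_q_bound qc V Ga hc1.
- exact: coef_d_bound dc1 Gb hc2 Cc.
- exact: coef_d_bound dc2 Ga hc3 Cc.
- by rewrite -b4; exact: coef_q_bound qa V Gb ha1.
Qed.

Lemma cubic_grad_lip k (B s t s' t' : R) : coef_le k B -> 0 <= s <= 1 -> 0 <= t <= 1 ->
  0 <= s' <= 1 -> 0 <= t' <= 1 ->
  `|cubs k s t - cubs k s' t'| <= 10 * B * (`|s - s'| + `|t - t'|) /\
  `|cubt k s t - cubt k s' t'| <= 10 * B * (`|s - s'| + `|t - t'|).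
Proof.
move=> [h20 h11 h02 [h30 h21 h12 h03]] /andP[s0 s1] /andP[t0 t1] /andP[s0' s1'] /andP[t0' t1'].
set ds := `|s - s'|; set dt := `|t - t'|.
have ds0 : 0 <= ds := normr_ge0 _.
have dt0 : 0 <= dt := normr_ge0 _.
have B0 : 0 <= B by apply: le_trans h20.
have ab (x y : R) (m : R) : 0 <= m -> `|x| <= B -> `|y| <= m -> `|x * y| <= B * m.
  by move=> m0 hx hy; rewrite normrM; apply: ler_pM.
have sq (x y : R) : 0 <= x <= 1 -> 0 <= y <= 1 -> `|x ^+ 2 - y ^+ 2| <= 2 * `|x - y|.
  move=> /andP[? ?] /andP[? ?]; rewrite subr_sqr normrM mulrC ler_wpM2r // ler_norml.
  by apply/andP; split; lra.
have xy : `|s * t - s' * t'| <= ds + dt.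
  have -> : s * t - s' * t' = (s - s') * t + s' * (t - t') by ring.
  apply: le_trans (ler_normD _ _) _; rewrite !normrM -/ds -/dt; apply: lerD.
    by rewrite ger0_norm // ler_piMr.
  by rewrite ger0_norm // ler_piMl.
have s2 : `|s ^+ 2 - s' ^+ 2| <= 2 * ds by apply: sq; apply/andP.
have t2 : `|t ^+ 2 - t' ^+ 2| <= 2 * dt by apply: sq; apply/andP.
have n0 (n : nat) (u : R) : 0 <= u -> 0 <= n%:R * u by move=> ?; rewrite mulr_ge0.
have ee := addr_ge0 ds0 dt0.
have h1 : B * dt >= 0 by rewrite mulr_ge0.
have h2 : B * ds >= 0 by rewrite mulr_ge0.
split.
- have -> : cubs k s t - cubs k s' t' = 2 * (k 2%N 0%N * (s - s')) + k 1%N 1%N * (t - t')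
     + 3 * (k 3%N 0%N * (s ^+ 2 - s' ^+ 2)) + 2 * (k 2%N 1%N * (s * t - s' * t')) + k 1%N 2%N * (t ^+ 2 - t' ^+ 2).
    by rewrite /cubs; ring.
  have := ab _ _ _ ds0 h20 (lexx _); have := ab _ _ _ dt0 h11 (lexx _).
  have := ab _ _ _ (n0 2%N _ ds0) h30 s2; have := ab _ _ _ ee h21 xy.
  have := ab _ _ _ (n0 2%N _ dt0) h12 t2.
  rewrite !ler_norml => /andP[? ?] /andP[? ?] /andP[? ?] /andP[? ?] /andP[? ?].
  by apply/andP; split; lra.
- have -> : cubt k s t - cubt k s' t' = 2 * (k 0%N 2%N * (t - t')) + k 1%N 1%N * (s - s')
     + 3 * (k 0%N 3%N * (t ^+ 2 - t' ^+ 2)) + 2 * (k 1%N 2%N * (s * t - s' * t')) + k 2%N 1%N * (s ^+ 2 - s' ^+ 2).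
    by rewrite /cubt; ring.
  have := ab _ _ _ dt0 h02 (lexx _); have := ab _ _ _ ds0 h11 (lexx _).
  have := ab _ _ _ (n0 2%N _ dt0) h03 t2; have := ab _ _ _ ee h12 xy.
  have := ab _ _ _ (n0 2%N _ ds0) h21 s2.
  rewrite !ler_norml => /andP[? ?] /andP[? ?] /andP[? ?] /andP[? ?] /andP[? ?].
  by apply/andP; split; lra.
Qed.

End HCT.

(** * Piecewise functions on the split of a triangle *)

Section Split.
Variable R : realType.
Implicit Types (a b c m p q x y z v : plane R) (f w : plane R -> R) (G : plane R -> plane R).

(** Inside the triangle this is the part of the split next to [b, c]. *)
Definition near_side a b c x := bc a b c x <= bc b c a x /\ bc a b c x <= bc c a b x.

Lemma hull3c a b c x : tri a b c ->
  hull [fset a; b; c] x <-> [/\ 0 <= bc a b c x, 0 <= bc b c a x & 0 <= bc c a b x].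
Proof. by move=> h; rewrite hull3 // (bc_swap b). Qed.

Lemma bc_sumc a b c x : tri a b c -> bc a b c x + bc b c a x + bc c a b x = 1.
Proof. by move=> h; rewrite (bc_swap b) bc_sum. Qed.

(** w and G are the values and gradients of a C^1 function with the pieces
    fa, fb, fc. On the boundary between two parts both pieces have to fit. *)
Definition split_C1 a b c (fa fb fc w : plane R -> R) G := forall x, hull [fset a; b; c] x ->
  [/\ near_side a b c x -> w x = fa x /\ is_grad fa x (G x),
      near_side b c a x -> w x = fb x /\ is_grad fb x (G x)
    & near_side c a b x -> w x = fc x /\ is_grad fc x (G x)].

Lemma split_C1_rot a b c fa fb fc w G : split_C1 a b c fa fb fc w G -> split_C1 b c a fb fc fa w G.
Proof. by move=> h x; rewrite -fset3_rot => /h []. Qed.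

Lemma near_side_line a b c x v (s r t : R) : s <= r -> r <= t ->
  near_side a b c (x + s *: v) -> near_side a b c (x + t *: v) -> near_side a b c (x + r *: v).
Proof.
move=> sr rt; rewrite /near_side !bc_line => -[h1 h2] [h3 h4].
have k (u w : R) : s * u <= w -> t * u <= w -> r * u <= w.
  by case: (leP 0 u) => ? ? ?; nra.
split.
  have := k (bcl a b c v - bcl b c a v) (bc b c a x - bc a b c x); lra.
have := k (bcl a b c v - bcl c a b v) (bc c a b x - bc a b c x); lra.
Qed.

(** A segment meets each part of the split in an interval, so Lipschitz
    bounds on the parts give one on the segment with the same constant. *)
Lemma segment_lip a b c x y (phi : R -> R) (L : R) :
  (forall P, P \in [:: (a, b, c); (b, c, a); (c, a, b)] -> forall s t, 0 <= s -> s <= t -> t <= 1 ->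
    near_side P.1.1 P.1.2 P.2 (x + s *: (y - x)) -> near_side P.1.1 P.1.2 P.2 (x + t *: (y - x)) ->
    `|phi t - phi s| <= L * (t - s)) ->
  `|phi 1 - phi 0| <= L.
Proof.
move=> h; set v := y - x.
have E := @lip_envelope R phi L (bc a b c x, bcl a b c v) (bc b c a x, bcl b c a v) (bc c a b x, bcl c a b v).
rewrite /= in E; rewrite -[leRHS](mulr1 L) -[X in _ <= L * X]subr0; apply: E => //.
- move=> s t s0 st t1 h1 h2; apply: (h (a, b, c)); rewrite ?inE ?eqxx //=.
    by rewrite /near_side !bc_line.
  by rewrite /near_side !bc_line.
- move=> s t s0 st t1 [h1 h1'] [h2 h2']; apply: (h (b, c, a)); rewrite ?inE ?eqxx ?orbT //=.
    by rewrite /near_side !bc_line.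
  by rewrite /near_side !bc_line.
- move=> s t s0 st t1 h1 h2; apply: (h (c, a, b)); rewrite ?inE ?eqxx ?orbT //=.
    by rewrite /near_side !bc_line.
  by rewrite /near_side !bc_line.
Qed.

Lemma n1Z (t : R) v : n1 (t *: v) = `|t| * n1 v.
Proof. by rewrite /n1 /= /GRing.scale /= !normrM mulrDr. Qed.

Lemma line_diff x v (s t : R) : x + t *: v - (x + s *: v) = (t - s) *: v.
Proof. by plane_ring. Qed.

Lemma in_segment a b c x y (t : R) : tri a b c -> 0 <= t -> t <= 1 ->
  hull [fset a; b; c] x -> hull [fset a; b; c] y ->
  hull [fset a; b; c] (x + t *: (y - x)).
Proof. by move=> h t0 t1; apply: hull_convex; [exact: triangle3|apply/andP]. Qed.

Lemma lip_glue a b c (F : plane R -> R) (L : R) : tri a b c ->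
  (forall P, P \in [:: (a, b, c); (b, c, a); (c, a, b)] -> forall x y,
    hull [fset a; b; c] x -> hull [fset a; b; c] y ->
    near_side P.1.1 P.1.2 P.2 x -> near_side P.1.1 P.1.2 P.2 y -> `|F y - F x| <= L * n1 (y - x)) ->
  forall x y, hull [fset a; b; c] x -> hull [fset a; b; c] y ->
    `|F y - F x| <= L * n1 (y - x).
Proof.
move=> ht h x y hx hy.
have := @segment_lip a b c x y (fun t => F (x + t *: (y - x))) (L * n1 (y - x)).
rewrite /= scale1r scale0r addr0 [x + (y - x)]addrC subrK; apply.
move=> P hP s t s0 st t1 hs htt.
have := h P hP _ _ (in_segment ht s0 (le_trans st t1) hx hy) (in_segment ht (le_trans s0 st) t1 hx hy) hs htt.
by rewrite line_diff n1Z (ger0_norm (_ : 0 <= t - s)) ?subr_ge0 // => H; rewrite -mulrA [n1 _ * _]mulrC.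
Qed.

Definition lip_on a b c G (L : R) := forall x y, hull [fset a; b; c] x -> hull [fset a; b; c] y ->
  `|(G y).1 - (G x).1| <= L * n1 (y - x) /\ `|(G y).2 - (G x).2| <= L * n1 (y - x).

Lemma is_grad_lin p x : is_grad (fun y => dot p y) x p.
Proof.
apply: is_grad_eq.
  by apply: is_gradD; apply: is_gradZ; [exact: is_grad_fst|exact: is_grad_snd].
by plane_ring.
Qed.

(** Second derivatives jump across the spokes; the mean value inequality is
    therefore applied on each part of the segment. *)
Lemma split_C1_taylor a b c fa fb fc w G (L : R) : tri a b c -> 0 <= L ->
  split_C1 a b c fa fb fc w G -> lip_on a b c G L ->
  forall x y, hull [fset a; b; c] x -> hull [fset a; b; c] y ->
   `|w y - w x - dot (G x) (y - x)| <= L * n1 (y - x) ^+ 2.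
Proof.
move=> ht L0 hw hG x y hx hy; set v := y - x.
have := @segment_lip a b c x y (fun t => w (x + t *: v) - dot (G x) (x + t *: v)) (L * n1 v ^+ 2).
rewrite -/v /= scale1r scale0r addr0 [x + v]addrC /v subrK -/v.
have -> : w y - dot (G x) y - (w x - dot (G x) x) = w y - w x - dot (G x) v.
  by rewrite /dot /v /=; ring.
apply.
have key f s t : 0 <= s -> s <= t -> t <= 1 ->
    (forall r, s <= r <= t -> w (x + r *: v) = f (x + r *: v) /\ is_grad f (x + r *: v) (G (x + r *: v))) ->
    `|w (x + t *: v) - dot (G x) (x + t *: v) - (w (x + s *: v) - dot (G x) (x + s *: v))|
      <= L * n1 v ^+ 2 * (t - s).
  move=> s0 st t1 hf.
  have [|-> _] := hf s; first by rewrite lexx.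
  have [|-> _] := hf t; first by rewrite lexx st.
  apply: (@mvt_line R (fun z => f z - dot (G x) z) (fun z => G z - G x)) => // r hr.
    by apply: is_gradB; [have [] := hf r hr|exact: is_grad_lin].
  have [r0 r1] : 0 <= r /\ r <= 1.
    by move: hr => /andP[? ?]; split; [apply: le_trans s0 _|apply: le_trans t1].
  have [g1 g2] := hG _ _ hx (in_segment ht r0 r1 hx hy); rewrite -/v in g1 g2.
  have e : n1 (x + r *: v - x) <= n1 v.
    have -> : x + r *: v - x = r *: v by rewrite addrAC subrr add0r.
    by rewrite n1Z ger0_norm // ler_piMl // n1_ge0.
  rewrite expr2 mulrA; apply: dot_n1 => /=.
    by apply: le_trans g1 _; apply: ler_wpM2l.
  by apply: le_trans g2 _; apply: ler_wpM2l.
have mid (s t r : R) : 0 <= s -> t <= 1 -> s <= r <= t -> hull [fset a; b; c] (x + r *: v).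
  by move=> s0 t1 /andP[? ?]; apply: in_segment => //; [apply: le_trans s0 _|apply: le_trans t1].
move=> P hP s t s0 st t1 hs htt.
move: hP; rewrite !inE => /or3P[] /eqP eP; rewrite eP /= in hs htt.
- apply: (key fa) => // r hr; have [h1 _ _] := hw _ (mid s t r s0 t1 hr); apply: h1.
  by move: hr => /andP[? ?]; apply: (@near_side_line a b c x v s r t).
- apply: (key fb) => // r hr; have [_ h1 _] := hw _ (mid s t r s0 t1 hr); apply: h1.
  by move: hr => /andP[? ?]; apply: (@near_side_line b c a x v s r t).
- apply: (key fc) => // r hr; have [_ _ h1] := hw _ (mid s t r s0 t1 hr); apply: h1.
  by move: hr => /andP[? ?]; apply: (@near_side_line c a b x v s r t).
Qed.

(** The components of X in the orthogonal frame of nu and e, multiplied by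
    the length of e to avoid a division. *)
Lemma normal_frame (nu e X : plane R) : dot nu nu = 1 -> dot nu e = 0 ->
  enorm e * `|X.1| <= enorm e * `|dot X nu| + `|dot X e| /\
  enorm e * `|X.2| <= enorm e * `|dot X nu| + `|dot X e|.
Proof.
move=> h1 h2.
pose s := e.2 * nu.1 - e.1 * nu.2.
have [e1 e2] : e.1 = - s * nu.2 /\ e.2 = s * nu.1 := normal_coord h1 h2.
have es : enorm e = `|s|.
  rewrite /enorm; have -> : dot e e = s ^+ 2.
    by rewrite -[RHS]mulr1 -h1 {1}/dot e1 e2 /dot; ring.
  by rewrite sqrtr_sqr.
have n1 : `|nu.1| <= 1 /\ `|nu.2| <= 1.
  have := enorm_comp nu; rewrite /enorm h1 sqrtr1 //.
pose tau : R := - X.1 * nu.2 + X.2 * nu.1.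
have x1 : X.1 = dot X nu * nu.1 - tau * nu.2.
  transitivity (dot nu nu * X.1); first by rewrite h1 mul1r.
  by rewrite /tau /dot; ring.
have x2 : X.2 = dot X nu * nu.2 + tau * nu.1.
  transitivity (dot nu nu * X.2); first by rewrite h1 mul1r.
  by rewrite /tau /dot; ring.
have xe : dot X e = s * tau by rewrite /dot e1 e2 /tau; ring.
have k (u t : R) : `|t| <= 1 -> `|u * t| <= `|u| by move=> ?; rewrite normrM ler_piMr.
rewrite es xe normrM -!mulrDr; split; apply: ler_wpM2l => //.
  rewrite {1}x1; apply: le_trans (ler_normB _ _) _; apply: lerD; apply: k; tauto.
rewrite {1}x2; apply: le_trans (ler_normD _ _) _; apply: lerD; apply: k; tauto.
Qed.

End Split.

(** * Lipschitz bound for Hsieh-Clough-Tocher gradients *)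

Section CubicPieces.
Variable R : realType.
Implicit Types (a b c m p q x y z v : plane R) (f w : plane R -> R) (G : plane R -> plane R).

Definition centroid a b c : plane R := 3^-1 *: (a + b + c).

Definition framed f m p q k := forall s t : R,
  [/\ f (m + s *: p + t *: q) = cubf k s t,
      dot (grad f (m + s *: p + t *: q)) p = cubs k s t
    & dot (grad f (m + s *: p + t *: q)) q = cubt k s t].

(** It suffices to compare at the parameters 0, 1/2 and 1 of the spoke, where
    the data determine the values, which are cubic, and the derivatives across
    the spoke, which are quadratic. *)
Lemma glued_of f g m p q q' k k' : q' = - p - q -> framed f m p q k -> framed g m q' p k' ->
  (forall t : R, 0 <= t <= 1 -> f (m + t *: p) = g (m + t *: p) /\
     grad f (m + t *: p) = grad g (m + t *: p)) -> glued k k'.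
Proof.
move=> -> hf hg h.
have e t : 0 <= t <= 1 -> [/\ cubf k t 0 = cubf k' 0 t, cubs k t 0 = cubt k' 0 t
    & cubs k' 0 t = - cubs k t 0 - cubt k t 0].
  move=> /h [h1 h2]; have [f1 f2 f3] := hf t 0; have [g1 g2 g3] := hg 0 t.
  rewrite !scale0r !addr0 in f1 f2 f3 g1 g2 g3.
  rewrite -f1 -f2 -f3 -g1 -g2 -g3 h1 h2; split=> //.
  by rewrite /dot /=; ring.
have [|z1 z2 z3] := e 0; first by rewrite lexx ler01.
have [|o1 o2 o3] := e 1; first by rewrite lexx ler01.
have [|t1 t2 t3] := e 2^-1; first by apply/andP; split; lra.
move: z1 z2 z3 o1 o2 o3 t1 t2 t3; rewrite /cubf /cubs /cubt /glued.
rewrite !(expr0n, expr1n, mulr0, mul0r, mulr1, mul1r, addr0, add0r) /= => z1 z2 z3 o1 o2 o3 t1 t2 t3.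
by split; [lra|lra|lra|lra|split; lra].
Qed.

(** Hermite interpolation: for a cubic on the unit interval that vanishes at
    both ends the derivative at 1/2 is minus a quarter of the sum of the end
    derivatives. *)
Lemma trace_mid f a b : is_cubic f -> f a = 0 -> f b = 0 ->
  dot (grad f (2^-1 *: (a + b))) (b - a) = - (4^-1 * (dot (grad f a) (b - a) + dot (grad f b) (b - a))).
Proof.
move=> hf fa fb; have [k hk] := cubic_frame hf a (b - a) 0.
have [p1 p2 _] := hk 0 0; have [q1 q2 _] := hk 1 0; have [_ r2 _] := hk 2^-1 0.
have e0 : a + 0 *: (b - a) + 0 *: 0 = a by rewrite !scale0r !addr0.
have e1 : a + 1 *: (b - a) + 0 *: 0 = b by rewrite scale0r scale1r addr0 addrC subrK.
have e2 : a + 2^-1 *: (b - a) + 0 *: 0 = 2^-1 *: (a + b).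
  by plane_field.
rewrite e0 fa in p1; rewrite e1 fb in q1; rewrite e0 in p2; rewrite e1 in q2; rewrite e2 in r2.
rewrite p2 q2 r2; move: p1 q1; rewrite /cubf /cubs.
rewrite !(expr0n, expr1n, mulr0, mul0r, mulr1, mul1r, addr0, add0r) /= => p1 q1.
by rewrite -p1 in q1; lra.
Qed.

Lemma centroid_bc a b c : tri a b c -> bc a b c (centroid a b c) = 3^-1.
Proof.
move=> h; rewrite /centroid !scalerDr bc_comb //; lra.
Qed.

Lemma centroid_rot a b c : centroid b c a = centroid a b c.
Proof. by rewrite /centroid; congr (_ *: _); rewrite addrC addrA. Qed.

(** The third spoke is minus the sum of the other two, so subtracting the
    third barycentric coordinate from the first two gives the coordinates in
    the frame of two spokes. *)
Lemma piece_coord a b c x : tri a b c ->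
  x = centroid a b c + (bc a b c x - bc c a b x) *: (a - centroid a b c)
      + (bc b c a x - bc c a b x) *: (b - centroid a b c).
Proof.
move=> h; have hs := bc_sumc x h.
rewrite [LHS](bc_repr x h) (bc_swap b).
move: hs; set la := bc a b c x; set lb := bc b c a x; set lc := bc c a b x => hs.
have -> : lc = 1 - la - lb by rewrite -hs; ring.
by rewrite /centroid; plane_field.
Qed.

Lemma bcl_small a b c (r D : R) v : tri a b c -> fat [fset a; b; c] r D ->
  `|bcl a b c v| <= n1 v / (2 * r).
Proof.
move=> h [_ hs _]; have := hs a v; rewrite !inE eqxx /= => /(_ isT).
by rewrite bary3 // bcB subr0.
Qed.

Lemma fat_rot a b c (r D : R) : fat [fset a; b; c] r D -> fat [fset b; c; a] r D.
Proof. by rewrite (fset3_rot a). Qed.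

Lemma diam_small a b c (r D : R) x y : fat [fset a; b; c] r D ->
  hull [fset a; b; c] x -> hull [fset a; b; c] y -> n1 (x - y) <= D * r.
Proof. by move=> [_ _]; apply. Qed.

(** The slopes 1 / r of the frame coordinates enter twice: through the
    arguments of the cubic, and when the gradient is recovered from its
    components along the spokes. *)
Lemma piece_lip a b c (r D B : R) f k : tri a b c -> fat [fset a; b; c] r D ->
  framed f (centroid a b c) (a - centroid a b c) (b - centroid a b c) k -> coef_le k B ->
  forall x y, hull [fset a; b; c] x -> hull [fset a; b; c] y ->
    near_side c a b x -> near_side c a b y ->
   `|(grad f y).1 - (grad f x).1| <= 40 * B / r ^+ 2 * n1 (y - x) /\
   `|(grad f y).2 - (grad f x).2| <= 40 * B / r ^+ 2 * n1 (y - x).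
Proof.
move=> h hfat hk hB x y hx hy rx ry.
have [r0 _ _] := hfat; have rn : r != 0 by rewrite gt_eqF.
have B0 : 0 <= B by case: hB => + _ _ _; apply: le_trans.
set m := centroid a b c; set la := bc a b c; set lb := bc b c a; set lc := bc c a b.
have small z : [/\ `|bcl a b c z| <= n1 z / (2 * r), `|bcl b c a z| <= n1 z / (2 * r) & `|bcl c a b z| <= n1 z / (2 * r)].
  split; [exact: bcl_small hfat|apply: bcl_small (fat_rot hfat)|apply: bcl_small (fat_rot (fat_rot hfat))] => //.
    exact: tri_rot.
  exact/tri_rot/tri_rot.
have half (u : R) : u / (2 * r) + u / (2 * r) = u / r by field.
have ds : `|(la y - lc y) - (la x - lc x)| <= n1 (y - x) / r.
  have -> : (la y - lc y) - (la x - lc x) = (la y - la x) - (lc y - lc x) by ring.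
  rewrite !bcB; apply: le_trans (ler_normB _ _) _.
  by have [h1 h2 h3] := small (y - x); rewrite -half; apply: lerD.
have dt : `|(lb y - lc y) - (lb x - lc x)| <= n1 (y - x) / r.
  have -> : (lb y - lc y) - (lb x - lc x) = (lb y - lb x) - (lc y - lc x) by ring.
  rewrite !bcB; apply: le_trans (ler_normB _ _) _.
  by have [h1 h2 h3] := small (y - x); rewrite -half; apply: lerD.
have in01 z : hull [fset a; b; c] z -> near_side c a b z -> 0 <= la z - lc z <= 1 /\ 0 <= lb z - lc z <= 1.
  rewrite hull3c // => -[h1 h2 h3] [h4 h5]; have := bc_sumc z h; rewrite -/la -/lb -/lc in h1 h2 h3 h4 h5 *.
  by move=> hs; split; apply/andP; split; lra.
have [sx tx] := in01 _ hx rx; have [sy ty] := in01 _ hy ry.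
have [k1 k2] := cubic_grad_lip hB sy ty sx tx.
have [_ px qx] := hk (la x - lc x) (lb x - lc x); rewrite -piece_coord // in px qx.
have [_ py qy] := hk (la y - lc y) (lb y - lc y); rewrite -piece_coord // in py qy.
rewrite -px -py in k1; rewrite -qx -qy in k2.
set X := grad f y - grad f x.
have X1 : `|dot X (a - m)| <= 20 * B / r * n1 (y - x).
  rewrite /X dotB.
  apply: le_trans k1 _; have := ler_wpM2l (mulr_ge0 (ler0n R 10) B0) (lerD ds dt).
  by rewrite (_ : 10%:R * B * (n1 (y - x) / r + n1 (y - x) / r) = 20 * B / r * n1 (y - x)) //; ring.
have X2 : `|dot X (b - m)| <= 20 * B / r * n1 (y - x).
  rewrite /X dotB.
  apply: le_trans k2 _; have := ler_wpM2l (mulr_ge0 (ler0n R 10) B0) (lerD ds dt).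
  by rewrite (_ : 10%:R * B * (n1 (y - x) / r + n1 (y - x) / r) = 20 * B / r * n1 (y - x)) //; ring.
have key z : n1 z = 1 -> `|dot X z| <= 40 * B / r ^+ 2 * n1 (y - x).
  move=> z1.
  have -> : dot X z = (bcl a b c z - bcl c a b z) * dot X (a - m) + (bcl b c a z - bcl c a b z) * dot X (b - m).
    have := piece_coord (m + z) h; have := bcB a b c (m + z) m; have := bcB b c a (m + z) m; have := bcB c a b (m + z) m.
    rewrite [m + z]addrC addrK => /eqP; rewrite subr_eq => /eqP -> /eqP; rewrite subr_eq => /eqP -> /eqP; rewrite subr_eq => /eqP ->.
    have -> : bc a b c m = 3^-1 by rewrite centroid_bc.
    have -> : bc b c a m = 3^-1 by rewrite /m -centroid_rot centroid_bc //; exact: tri_rot.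
    have -> : bc c a b m = 3^-1 by rewrite /m -centroid_rot -centroid_rot centroid_bc //; exact/tri_rot/tri_rot.
    rewrite -/m => e; have {}e : z = (bcl a b c z - bcl c a b z) *: (a - m) + (bcl b c a z - bcl c a b z) *: (b - m).
      by rewrite -[LHS](addrK m) e; plane_ring.
    by rewrite {1}e /dot /= /GRing.scale /=; ring.
  have [h1 h2 h3] := small z; rewrite z1 in h1 h2 h3.
  have c1 : `|bcl a b c z - bcl c a b z| <= r^-1.
    by apply: le_trans (ler_normB _ _) _; rewrite -[leRHS]mul1r -half; apply: lerD.
  have c2 : `|bcl b c a z - bcl c a b z| <= r^-1.
    by apply: le_trans (ler_normB _ _) _; rewrite -[leRHS]mul1r -half; apply: lerD.
  apply: le_trans (ler_normD _ _) _; rewrite !normrM.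
  rewrite (_ : 40 * B / r ^+ 2 * n1 (y - x) = r^-1 * (20 * B / r * n1 (y - x)) + r^-1 * (20 * B / r * n1 (y - x))); last by field.
  by apply: lerD; apply: ler_pM.
split.
  have := key (1, 0); rewrite /dot /= !mulr1 !mulr0 addr0; apply.
  by rewrite /n1 /= normr1 normr0 addr0.
have := key (0, 1); rewrite /dot /= !mulr1 !mulr0 add0r; apply.
by rewrite /n1 /= normr1 normr0 add0r.
Qed.

(** The normal component vanishes at the midpoint, and the tangential one is
    given by the gradients at the ends. *)
Lemma mid_grad f a b (nu : plane R) (Gam : R) : a != b -> is_cubic f -> f a = 0 -> f b = 0 ->
  dot nu nu = 1 -> dot nu (b - a) = 0 -> dot (grad f (2^-1 *: (a + b))) nu = 0 ->
  `|(grad f a).1| <= Gam -> `|(grad f a).2| <= Gam ->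
  `|(grad f b).1| <= Gam -> `|(grad f b).2| <= Gam ->
  `|(grad f (2^-1 *: (a + b))).1| <= Gam /\ `|(grad f (2^-1 *: (a + b))).2| <= Gam.
Proof.
move=> ab hf fa fb n1' n2' n3 a1 a2 b1 b2.
have [X1 X2] := normal_frame (grad f (2^-1 *: (a + b))) n1' n2'.
have e0 : 0 < enorm (b - a).
  by rewrite sqrtr_gt0 dot_gt0 // subr_eq0 eq_sym.
have T : `|dot (grad f (2^-1 *: (a + b))) (b - a)| <= enorm (b - a) * Gam.
  rewrite (trace_mid hf fa fb) normrN normrM gtr0_norm ?invr_gt0 //.
  have ha := dot_n1 (b - a) a1 a2; have hb := dot_n1 (b - a) b1 b2.
  have G0 : 0 <= Gam by apply: le_trans a1.
  have := ler_normD (dot (grad f a) (b - a)) (dot (grad f b) (b - a)).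
  have := ler_wpM2l G0 (n1_le (b - a)).
  move: ha hb; set u := `|dot _ _|; set u' := `|dot _ _|; set u'' := `|_ + _|.
  by rewrite [enorm _ * _]mulrC; lra.
rewrite n3 normr0 mulr0 add0r in X1 X2.
by split; [move: (le_trans X1 T)|move: (le_trans X2 T)]; rewrite ler_pM2l.
Qed.

End CubicPieces.

Section HCTLipschitz.
Variable R : realType.
Implicit Types (a b c m p q x y z v : plane R) (f w : plane R -> R) (G : plane R -> plane R).

Definition grad_le f x (Gam : R) := `|(grad f x).1| <= Gam /\ `|(grad f x).2| <= Gam.
Definition flat_mid f a b := exists nu, [/\ dot nu nu = 1, dot nu (b - a) = 0
  & dot (grad f (2^-1 *: (a + b))) nu = 0].

Lemma centroid_in a b c : tri a b c -> hull [fset a; b; c] (centroid a b c).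
Proof.
move=> h; rewrite hull3c // centroid_bc // -centroid_rot centroid_bc; last exact: tri_rot.
rewrite -centroid_rot centroid_bc; last exact/tri_rot/tri_rot.
by split; rewrite invr_ge0.
Qed.

(** The data are scalar products of gradients with spokes, which are no
    longer than the diameter D * r. *)
Lemma hermite_of a b c (r D Gam : R) f k : tri a b c -> fat [fset a; b; c] r D ->
  is_cubic f -> framed f (centroid a b c) (a - centroid a b c) (b - centroid a b c) k ->
  f a = 0 -> f b = 0 -> grad_le f a Gam -> grad_le f b Gam -> flat_mid f a b ->
  hermite k (Gam * (D * r)).
Proof.
move=> h hfat hf hk fa fb [a1 a2] [b1 b2] [nu [n1 n2 n3]].
have [m1 m2] := mid_grad (tri_neq h) hf fa fb n1 n2 n3 a1 a2 b1 b2.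
have hm := centroid_in h; set m := centroid a b c in hk hm *.
have Gam0 : 0 <= Gam by apply: le_trans a1.
have ha : hull [fset a; b; c] a by apply: hull_vertex; rewrite !inE eqxx.
have hb : hull [fset a; b; c] b by apply: hull_vertex; rewrite !inE eqxx orbT.
have da := ler_wpM2l Gam0 (diam_small hfat ha hm).
have db := ler_wpM2l Gam0 (diam_small hfat hb hm).
have [p1 p2 p3] := hk 1 0; have [q1 q2 q3] := hk 0 1; have [_ r2 _] := hk 2^-1 2^-1.
have e1 : m + 1 *: (a - m) + 0 *: (b - m) = a by rewrite scale0r scale1r addr0 addrC subrK.
have e2 : m + 0 *: (a - m) + 1 *: (b - m) = b by rewrite scale0r scale1r addr0 addrC subrK.
have e3 : m + 2^-1 *: (a - m) + 2^-1 *: (b - m) = 2^-1 *: (a + b).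
  by plane_field.
rewrite e1 in p1 p2 p3; rewrite e2 in q2; rewrite e3 in r2.
split.
- by rewrite -p1.
- by rewrite -p2; apply: le_trans da; exact: dot_n1.
- by rewrite -p3; apply: le_trans db; exact: dot_n1.
- by rewrite -q2; apply: le_trans da; exact: dot_n1.
- by rewrite -r2; apply: le_trans da; exact: dot_n1.
Qed.

Lemma spoke a b c (t : R) : tri a b c -> 0 <= t <= 1 ->
  let x := centroid a b c + t *: (a - centroid a b c) in
  [/\ hull [fset a; b; c] x, near_side b c a x & near_side c a b x].
Proof.
move=> h /andP[t0 t1] x; have hm := centroid_in h.
have ha : hull [fset a; b; c] a by apply: hull_vertex; rewrite !inE eqxx.
have m1 := centroid_bc h; have m2 := centroid_bc (tri_rot h); have m3 := centroid_bc (tri_rot (tri_rot h)).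
rewrite (centroid_rot a b c) in m2; rewrite (centroid_rot b c a) (centroid_rot a b c) in m3.
have x1 : bc a b c x = 3^-1 + t * (1 - 3^-1) by rewrite bc_line -bcB bc_self // m1.
have x2 : bc b c a x = 3^-1 - t * 3^-1 by rewrite bc_line -bcB bc_other2 m2; ring.
have x3 : bc c a b x = 3^-1 - t * 3^-1 by rewrite bc_line -bcB bc_other m3; ring.
split; first exact: in_segment.
  by rewrite /near_side x1 x2 x3; split; lra.
by rewrite /near_side x1 x2 x3; split; lra.
Qed.

Lemma split_C1_glued a b c fa fb fc w G kb kc : tri a b c -> split_C1 a b c fa fb fc w G ->
  framed fc (centroid a b c) (a - centroid a b c) (b - centroid a b c) kc ->
  framed fb (centroid c a b) (c - centroid c a b) (a - centroid c a b) kb -> glued kc kb.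
Proof.
move=> h hw hc; rewrite (centroid_rot b c a) (centroid_rot a b c) => hb.
apply: (glued_of _ hc hb).
  by rewrite /centroid; plane_field.
move=> t ht; have [x1 x2 x3] := spoke h ht.
have [_ /(_ x2) [h1 h2] /(_ x3) [h3 h4]] := hw _ x1.
by rewrite -h1 -h3 (is_grad_grad h2) (is_grad_grad h4).
Qed.

Lemma near_side_vertex a b c : tri a b c -> near_side b c a a /\ near_side c a b a.
Proof.
move=> h; rewrite /near_side bc_other2 bc_other bc_self //; split; split; rewrite ?ler01 //; lra.
Qed.

(** With zero vertex values and zero normal derivatives at the midpoints a
    Hsieh-Clough-Tocher function is determined by its gradients at the vertices,
    and so is the bound for its second derivatives. They jump across the spokes,
    hence the bound is a Lipschitz constant of the gradient. *)
Lemma hct_grad_lip a b c (r D Gam : R) fa fb fc w G : tri a b c -> fat [fset a; b; c] r D ->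
  is_cubic fa -> is_cubic fb -> is_cubic fc -> split_C1 a b c fa fb fc w G ->
  [/\ w a = 0, w b = 0 & w c = 0] ->
  (forall z, z \in [fset a; b; c] -> `|(G z).1| <= Gam /\ `|(G z).2| <= Gam) ->
  flat_mid fc a b -> flat_mid fa b c -> flat_mid fb c a ->
  lip_on a b c G (1400 * (Gam * (D * r)) / r ^+ 2).
Proof.
move=> h hfat ca cb cc hw [wa wb wc] hG fab fbc fca.
have hab := tri_rot h; have hca := tri_rot hab.
have [kc hc] := cubic_frame cc (centroid a b c) (a - centroid a b c) (b - centroid a b c).
have [ka ha] := cubic_frame ca (centroid b c a) (b - centroid b c a) (c - centroid b c a).
have [kb hb] := cubic_frame cb (centroid c a b) (c - centroid c a b) (a - centroid c a b).
have g1 : glued kc kb := split_C1_glued h hw hc hb.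
have g2 : glued ka kc := split_C1_glued hab (split_C1_rot hw) ha hc.
have g3 : glued kb ka := split_C1_glued hca (split_C1_rot (split_C1_rot hw)) hb ha.
have va : hull [fset a; b; c] a by apply: hull_vertex; rewrite !inE eqxx.
have vb : hull [fset a; b; c] b by apply: hull_vertex; rewrite !inE eqxx orbT.
have vc : hull [fset a; b; c] c by apply: hull_vertex; rewrite !inE eqxx orbT.
have [ra1 ra2] := near_side_vertex h; have [rb1 rb2] := near_side_vertex hab; have [rc1 rc2] := near_side_vertex hca.
have [_ /(_ ra1) [ba Gba] /(_ ra2) [cca Gca]] := hw _ va.
have [/(_ rb2) [ab Gab] _ /(_ rb1) [ccb Gcb]] := hw _ vb.
have [/(_ rc1) [ac Gac] /(_ rc2) [bcc Gbc] _] := hw _ vc.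
have gl f z : z \in [fset a; b; c] -> is_grad f z (G z) -> grad_le f z Gam.
  by move=> zK hz; rewrite /grad_le (is_grad_grad hz); exact: hG.
have ia : a \in [fset a; b; c] by rewrite !inE eqxx.
have ib : b \in [fset a; b; c] by rewrite !inE eqxx orbT.
have ic : c \in [fset a; b; c] by rewrite !inE eqxx orbT.
have Hc : hermite kc (Gam * (D * r)).
  apply: (hermite_of h hfat cc hc) => //; rewrite -?cca -?ccb //; by [apply: gl].
have Ha : hermite ka (Gam * (D * r)).
  apply: (hermite_of hab (fat_rot hfat) ca ha) => //; rewrite -?ab -?ac //; by [apply: gl].
have Hb : hermite kb (Gam * (D * r)).
  apply: (hermite_of hca (fat_rot (fat_rot hfat)) cb hb) => //; rewrite -?ba -?bcc //; by [apply: gl].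
have [Ka Kb Kc] := hct_coef_bound g1 g2 g3 Ha Hb Hc.
have E : 40 * (35 * (Gam * (D * r))) / r ^+ 2 = 1400 * (Gam * (D * r)) / r ^+ 2 :> R by congr (_ / _); ring.
have key P x y : P \in [:: (a, b, c); (b, c, a); (c, a, b)] ->
    hull [fset a; b; c] x -> hull [fset a; b; c] y ->
    near_side P.1.1 P.1.2 P.2 x -> near_side P.1.1 P.1.2 P.2 y ->
   `|(G y).1 - (G x).1| <= 1400 * (Gam * (D * r)) / r ^+ 2 * n1 (y - x) /\
   `|(G y).2 - (G x).2| <= 1400 * (Gam * (D * r)) / r ^+ 2 * n1 (y - x).
  move=> hP hx hy; rewrite -E; have [X1 X2 X3] := hw _ hx; have [Y1 Y2 Y3] := hw _ hy.
  move: hP; rewrite !inE => /or3P[] /eqP -> /= rx ry.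
  - have [_ gx] := X1 rx; have [_ gy] := Y1 ry.
    rewrite -(is_grad_grad gx) -(is_grad_grad gy).
    by apply: (piece_lip hab (fat_rot hfat) ha Ka) => //; rewrite -fset3_rot.
  - have [_ gx] := X2 rx; have [_ gy] := Y2 ry.
    rewrite -(is_grad_grad gx) -(is_grad_grad gy).
    by apply: (piece_lip hca (fat_rot (fat_rot hfat)) hb Kb) => //; rewrite fset3_rot.
  - have [_ gx] := X3 rx; have [_ gy] := Y3 ry.
    rewrite -(is_grad_grad gx) -(is_grad_grad gy).
    exact: (piece_lip h hfat hc Kc).
move=> x y hx hy; split.
  apply: (lip_glue (F := fun z => (G z).1) h) => // P hP x' y' hx' hy' rx ry.
  by have [] := key P x' y' hP hx' hy' rx ry.
apply: (lip_glue (F := fun z => (G z).2) h) => // P hP x' y' hx' hy' rx ry.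
by have [] := key P x' y' hP hx' hy' rx ry.
Qed.

End HCTLipschitz.

(** * Regular triangulations and the boundary *)

Section Mesh.
Variable R : realType.
Implicit Types (a b c p q x y z v : plane R) (f : plane R -> R) (T A E K : simplex R)
  (Om : set (plane R)) (TT : mesh R).

Lemma nbhs_dir x v (P : set (plane R)) : nbhs x P ->
  exists2 e : R, 0 < e < 1 & P (x + e *: v).
Proof.
move/nbhs_ballP => [e /= e0 he].
pose d := Num.min (2^-1) (e / (2 * (n1 v + 1))).
have n0 : 0 < 2 * (n1 v + 1) by have := n1_ge0 v; lra.
have d0 : 0 < d by rewrite lt_min invr_gt0 ltr0n divr_gt0.
exists d; first by rewrite d0 /= gt_min; apply/orP; left; lra.
have h (t : R) : `|t| <= n1 v -> `|d * t| < e.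
  move=> ht; rewrite normrM gtr0_norm //.
  have : d * `|t| <= e / (2 * (n1 v + 1)) * n1 v.
    by apply: ler_pM => //; [exact: ltW|rewrite ge_min lexx orbT].
  move/le_lt_trans; apply.
  rewrite mulrAC ltr_pdivrMr //; have := n1_ge0 v; nra.
apply: he; split; rewrite /ball /= opprD addrA subrr add0r normrN; apply: h.
  by rewrite /n1 lerDl.
by rewrite /n1 lerDr.
Qed.

Lemma near_seq (I : eqType) (s : seq I) x (Q : I -> plane R -> Prop) :
  (forall i, i \in s -> \forall y \near x, Q i y) -> \forall y \near x, forall i, i \in s -> Q i y.
Proof.
elim: s => [|i s IH] h; first by near=> y => i; rewrite in_nil.
have h1 := h i (mem_head i s); have h2 : \forall y \near x, forall i, i \in s -> Q i y.
  by apply: IH => j js; apply: h; rewrite inE js orbT.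
near=> y => j; rewrite inE => /predU1P[->|]; first by near: y.
by move: j; near: y.
Unshelve. all: by end_near. Qed.

Lemma hull_closed T x : triangle T -> ~ hull T x -> \forall y \near x, ~ hull T y.
Proof.
move=> hT hx.
have [z [zT zn]] : exists z, z \in T /\ bary T z x < 0.
  apply: contrapT => hn; apply: hx; rewrite tri_hull // => z zT.
  by rewrite leNgt; apply/negP => zx; apply: hn; exists z.
have [a [b [c eb]]] := bary_affine hT zT.
near=> y; rewrite tri_hull // => /(_ z zT); apply/negP; rewrite -ltNge.
rewrite -oppr_gt0; near: y; apply: near_pos; last by rewrite oppr_gt0.
by move=> u; apply: cvgN; rewrite eb; exact: bc_continuous.
Unshelve. all: by end_near. Qed.

Lemma dot_continuous p x : continuous (fun y => dot p (y - x)).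
Proof.
have -> : (fun y => dot p (y - x)) = fun y => p.1 * y.1 + p.2 * y.2 - dot p x.
  by apply: funext => y; rewrite /dot /=; ring.
move=> y; apply: cvgB; last exact: cvg_cst.
by apply: cvgD; (apply: cvgM; first exact: cvg_cst); [exact: cvg_fst|exact: cvg_snd].
Qed.

(** A Lipschitz domain lies on one side of its boundary, since a ball just
    below a boundary point misses Om. For open sets in general this fails: the
    points of a slit are interior to the closure. *)
Lemma bdry_not_inner Om x : open Om -> lipschitz_boundary Om -> bdry Om x ->
  ~ nbhs x (closure Om).
Proof.
move=> oO hL hx hn; have [e [n [r [L [g [[ee nn en r0] hg hO]]]]]] := hL x hx.
have Onx : ~ Om x.
  by case: hx => _ hi hO'; apply: hi; apply: open_nbhs_nbhs; split.
have gx : dot n x <= g (dot e x).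
  rewrite leNgt; apply/negP => h; apply: Onx; apply/hO => //.
  by rewrite subrr /enorm /dot /= !mul0r addr0 sqrtr0.
have [d /andP[d0 d1] hd] := nbhs_dir (- (r / 2) *: n) hn.
(* y lies at distance s below the boundary point x *)
set y := x + d *: (- (r / 2) *: n) in hd.
have yx : y - x = (- (d * (r / 2))) *: n.
  by apply: plane_eq; rewrite /y /= /GRing.scale /=; ring.
pose s := d * (r / 2); have s0 : 0 < s by rewrite mulr_gt0 // divr_gt0.
have sr : s < r by rewrite /s; nra.
have ny : dot n y = dot n x - s.
  have -> : dot n y = dot n x + dot n (y - x) by rewrite /dot /=; ring.
  rewrite yx -/s; have -> : dot n (- s *: n) = - s * dot n n by rewrite /dot /= /GRing.scale /=; ring.
  by rewrite nn mulr1.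
have ey : dot e y = dot e x.
  have -> : dot e y = dot e x + dot e (y - x) by rewrite /dot /=; ring.
  rewrite yx -/s; have -> : dot e (- s *: n) = - s * dot e n by rewrite /dot /= /GRing.scale /=; ring.
  by rewrite en mulr0 addr0.
(* half of s is kept for the vertical, half for the variation of g; the slope l is positive *)
pose l := `|L| + 1; have l0 : 0 < l by rewrite ltr_wpDl.
have N : \forall z \near y, ~ Om z.
  near=> z => Oz.
  have z1 : 0 < s / 2 + dot (- n) (z - y).
    near: z; apply: near_pos => [z|]; first by apply: cvgD; [exact: cvg_cst|exact: dot_continuous].
    by rewrite subrr /dot /= !mulr0 !addr0 divr_gt0.
  have z2 : 0 < s / 2 + dot (l *: e) (z - y).
    near: z; apply: near_pos => [z|]; first by apply: cvgD; [exact: cvg_cst|exact: dot_continuous].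
    by rewrite subrr /dot /= !mulr0 !addr0 divr_gt0.
  have z3 : 0 < s / 2 + dot (- l *: e) (z - y).
    near: z; apply: near_pos => [z|]; first by apply: cvgD; [exact: cvg_cst|exact: dot_continuous].
    by rewrite subrr /dot /= !mulr0 !addr0 divr_gt0.
  have z4 : 0 < r ^+ 2 - (dot (1, 0) (z - x) * dot (1, 0) (z - x) + dot (0, 1) (z - x) * dot (0, 1) (z - x)).
    near: z; apply: near_pos => [z|].
      apply: cvgB; first exact: cvg_cst.
      by apply: cvgD; apply: cvgM; exact: dot_continuous.
    have -> : dot (1, 0) (y - x) * dot (1, 0) (y - x) + dot (0, 1) (y - x) * dot (0, 1) (y - x) = s ^+ 2 * dot n n.
      by rewrite yx /s /dot /= /GRing.scale /=; ring.
    by rewrite nn mulr1 subr_gt0 ltr_pXn2r // nnegrE ltW.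
  have zr : enorm (z - x) < r.
    rewrite -(ltr_pXn2r (_ : (0 < 2)%N)) ?nnegrE ?enorm_ge0 ?(ltW r0) // enorm_sqr.
    by move: z4; rewrite /dot /= !mul1r !mul0r addr0 add0r -!expr2 subr_gt0.
  move: (Oz); rewrite (hO z zr) => zg.
  have := hg (dot e z) (dot e y); rewrite ler_norml => /andP[gz _].
  have dz : `|dot e z - dot e y| * l < s / 2.
    have -> : dot e z - dot e y = dot e (z - y) by rewrite /dot /=; ring.
    move: z2 z3; rewrite /dot /= /GRing.scale /= => z2 z3.
    rewrite -[l]gtr0_norm // -normrM ltr_norml; clear -z2 z3; apply/andP; split; lra.
  have lz : L * `|dot e z - dot e y| <= `|dot e z - dot e y| * l.
    rewrite mulrC; apply: ler_wpM2l => //; rewrite /l.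
    by have := ler_norm L; clear; lra.
  have nz : dot n z < dot n y + s / 2.
    by move: z1; rewrite /dot /=; clear; lra.
  by rewrite ey in gz lz dz; clear -gz lz dz gx zg ny nz; lra.
have [z [Oz nOz]] := hd _ N; contradiction.
Unshelve. all: by end_near. Qed.

Section Regular.
Variables (Om : set (plane R)) (TT : mesh R).
Hypothesis reg : regular_triangulation Om TT.

Lemma reg_tri T : T \in TT -> triangle T. Proof. by case: reg => h _ _; exact: h. Qed.

Lemma reg_cover x : closure Om x <-> exists2 T, T \in TT & hull T x.
Proof. by case: reg => _ <- _. Qed.

Lemma reg_face T T' x : T \in TT -> T' \in TT -> hull T x -> hull T' x ->
  hull (T `&` T')%fset x.
Proof.
move=> hT hT' x1 x2; have [e|ne] := eqVneq T T'; first by rewrite -e fsetIid.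
by case: reg => _ _ <- //.
Qed.

(** A common point lies in the common face, where the coordinates of the
    other vertices vanish. *)
Lemma reg_face0 T T' x z : T \in TT -> T' \in TT -> hull T x -> hull T' x ->
  z \in T -> z \notin T' -> bary T z x = 0.
Proof.
move=> hT hT' x1 x2 zT zT'; have := reg_face hT hT' x1 x2.
rewrite (tri_face x (reg_tri hT) (fsubsetIl _ _)) => -[_]; apply => //.
by rewrite inE zT.
Qed.

Lemma card_sub_eq T T' : T \in TT -> T' \in TT -> (T `<=` T')%fset -> T = T'.
Proof.
move=> hT hT' s; have cT := triangle_card (reg_tri hT); have cT' := triangle_card (reg_tri hT').
by apply/eqP; rewrite eqEfcard s cT cT'.
Qed.

Lemma reg_interior T T' x : T \in TT -> T' \in TT ->
  (forall z, z \in T -> 0 < bary T z x) -> hull T' x -> T = T'.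
Proof.
move=> hT hT' hx x2.
have x1 : hull T x by by rewrite tri_hull; [move=> z zT; apply/ltW/hx|exact: reg_tri].
apply: card_sub_eq => //; apply/fsubsetP => z zT; apply: contraT => zT'.
by have := hx z zT; rewrite (reg_face0 hT hT' x1 x2 zT zT') ltxx.
Qed.

End Regular.
End Mesh.

(** * Edges, sides and jumps *)

Ltac slra := repeat match goal with
  | H : _ = _ :> {fset _} |- _ => clear H
  | H : _ <> _ :> {fset _} |- _ => clear H end; lra.

Section Edges.
Variable R : realType.
Implicit Types (a b c p q x y z v : plane R) (f : plane R -> R) (T A E K : simplex R)
  (Om : set (plane R)) (TT : mesh R).

Lemma fset2_cases a b a' b' : a != b -> [fset a; b] = [fset a'; b'] ->
  (a = a' /\ b = b') \/ (a = b' /\ b = a').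
Proof.
move=> ab e.
have : a \in [fset a'; b'] by rewrite -e !inE eqxx.
have : b \in [fset a'; b'] by rewrite -e !inE eqxx orbT.
rewrite !inE => /orP[] /eqP hb /orP[] /eqP ha; subst a b; rewrite ?eqxx // in ab.
  by right.
by left.
Qed.

Lemma two_on_edge T T' E : triangle T -> triangle T' -> E \in edges T -> E \in edges T' ->
  exists a b c c', [/\ T = [fset a; b; c], T' = [fset a; b; c'], E = [fset a; b],
   tri a b c & tri a b c'].
Proof.
move=> hT hT' /(triangle_edge hT) [a [b [c [-> -> h]]]] /(triangle_edge hT') [a' [b' [c' [-> e h']]]].
exists a, b, c, c'.
by have [[? ?]|[? ?]] := fset2_cases (tri_neq h) e; subst a' b'; split=> //;
  [rewrite fset3_swap|exact: tri_swap].
Qed.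

Lemma bc_edge a b c (t : R) : tri a b c ->
  [/\ bc a b c (a + t *: (b - a)) = 1 - t, bc b a c (a + t *: (b - a)) = t
    & bc c a b (a + t *: (b - a)) = 0].
Proof.
move=> h; rewrite !bc_line -!bcB bc_self // (bc_self (tri_swap h)) !bc_other bc_other2.
by split; ring.
Qed.

Section Regular.
Variables (Om : set (plane R)) (TT : mesh R).
Hypothesis reg : regular_triangulation Om TT.

(** Otherwise the midpoint of the common edge, moved a little towards c,
    would be an interior point of T in T'. *)
Lemma opposite_sides T T' a b c c' : T \in TT -> T' \in TT -> T <> T' ->
  T = [fset a; b; c] -> T' = [fset a; b; c'] -> tri a b c -> tri a b c' ->
  cross (c - a) (b - a) * cross (c' - a) (b - a) < 0.
Proof.
move=> hT hT' ne eT eT' h h'.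
have k0 := tri_cross (tri_rot (tri_rot h)); have k0' := tri_cross (tri_rot (tri_rot h')).
rewrite ltNge; apply/negP => pos.
have {}pos : 0 < cross (c - a) (b - a) / cross (c' - a) (b - a).
  rewrite lt_neqAle eq_sym mulf_neq0 ?invr_neq0 //=.
  rewrite -(pmulr_lge0 _ (_ : 0 < cross (c' - a) (b - a) ^+ 2)); last by rewrite exprn_even_gt0.
  by rewrite expr2 mulrA mulfVK.
set m := a + 2^-1 *: (b - a).
have [ma mb mc] := bc_edge 2^-1 h; have [ma' mb' mc'] := bc_edge 2^-1 h'; rewrite -/m in ma mb mc ma' mb' mc'.
have N : \forall y \near m, 0 < bc a b c' y /\ 0 < bc b a c' y.
  near=> y; split; near: y; apply: near_pos; rewrite ?ma' ?mb'; try slra; exact: bc_continuous.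
have [e /andP[e0 e1] [pa pb]] := nbhs_dir (c - m) N.
set x := m + e *: (c - m) in pa pb.
have xa : bc a b c x = (1 - e) / 2 by rewrite bc_line -bcB ma bc_other2; field.
have xb : bc b a c x = (1 - e) / 2 by rewrite bc_line -bcB mb bc_other2; field.
have xc : bc c a b x = e by rewrite bc_line -bcB mc (bc_self (tri_rot (tri_rot h))); ring.
have xc' : bc c' a b x = e * (cross (c - a) (b - a) / cross (c' - a) (b - a)).
  rewrite -xc /bc.
  set u := cross _ _; set v := cross _ _ in k0 *; set w := cross _ _ in k0' *.
  by rewrite mulrA mulfVK.
have eq : T = T'.
  apply: (reg_interior reg hT hT' (x := x)).
    rewrite eT; apply/forall3; rewrite bary3 // bary3b // bary3c // xa xb xc; split; slra.
  by rewrite eT' hull3 // xc'; split; [exact: ltW|exact: ltW|apply: mulr_ge0; exact: ltW].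
exact: ne.
Unshelve. all: by end_near. Qed.

(** Near an inner point of the common edge the side on which a point lies
    decides which of the two triangles covers it. *)
Lemma shared_inner T T' a b c c' (t : R) : T \in TT -> T' \in TT -> T <> T' ->
  T = [fset a; b; c] -> T' = [fset a; b; c'] -> tri a b c -> tri a b c' ->
  0 < t < 1 -> nbhs (a + t *: (b - a)) (closure Om).
Proof.
move=> hT hT' ne eT eT' h h' /andP[t0 t1].
have := opposite_sides hT hT' ne eT eT' h h'.
have [ma mb mc] := bc_edge t h; have [ma' mb' mc'] := bc_edge t h'.
have k0 := tri_cross (tri_rot (tri_rot h)); have k0' := tri_cross (tri_rot (tri_rot h')).
set k := cross _ _ in k0 *; set k' := cross _ _ in k0' * => kk.
near=> y; apply/(reg_cover reg).
have [s|s] := leP 0 (bc c a b y).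
  exists T => //; rewrite eT hull3 //; split=> //; apply: ltW; near: y; apply: near_pos;
    rewrite ?ma ?mb; try slra; exact: bc_continuous.
exists T' => //; rewrite eT' hull3 //; split; last first.
- move: s; rewrite /bc -/k -/k'; set u := cross _ _ => s.
  have : 0 < (u / k) * (k * k') by rewrite nmulr_rgt0.
  rewrite mulrA divfK // => ukk.
  by rewrite -(pmulr_lge0 _ (_ : 0 < k' ^+ 2)) ?exprn_even_gt0 // expr2 mulrA divfK // ltW.
- by apply: ltW; near: y; apply: near_pos; rewrite ?ma' ?mb'; try slra; exact: bc_continuous.
- by apply: ltW; near: y; apply: near_pos; rewrite ?ma' ?mb'; try slra; exact: bc_continuous.
Unshelve. all: by end_near. Qed.

Hypothesis oO : open Om.
Hypothesis hL : lipschitz_boundary Om.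

(** A second triangle at the edge would make its points interior to the
    closure of the domain. *)
Lemma bdry_edge_one_triangle T T' a b (t : R) : T \in TT -> T' \in TT -> a != b ->
  [fset a; b] \in edges T -> [fset a; b] \in edges T' ->
  0 < t < 1 -> bdry Om (a + t *: (b - a)) -> T' = T.
Proof.
move=> hT hT' ab eT eT' tt hb; apply: contrapT => /nesym ne.
have [a1 [b1 [c [c' [e1 e2 e3 h h']]]]] := two_on_edge (reg_tri reg hT) (reg_tri reg hT') eT eT'.
apply: (bdry_not_inner oO hL hb).
have [[? ?]|[? ?]] := fset2_cases ab e3; subst a1 b1; first exact: (shared_inner hT hT' ne e1 e2).
have -> : a + t *: (b - a) = b + (1 - t) *: (a - b).
  by plane_ring.
apply: (shared_inner hT hT' ne e1 e2) => //.
by move/andP: tt => [? ?]; apply/andP; split; slra.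
Qed.

(** No other triangle comes near an inner point of the edge, so that points
    just beyond the edge are not covered. Thus all inner points of the edge are
    boundary points as soon as one is, and the ends follow by closedness. *)
Lemma bdry_edge T a b (t : R) : T \in TT -> a != b -> [fset a; b] \in edges T ->
  0 < t < 1 -> bdry Om (a + t *: (b - a)) -> on_boundary Om [fset a; b].
Proof.
move=> hT ab eT tt hb.
have [a1 [b1 [c [e1 e3 h1]]]] := triangle_edge (reg_tri reg hT) eT.
have [h e2] : tri a b c /\ T = [fset a; b; c].
  have [[? ?]|[? ?]] := fset2_cases ab e3; subst a1 b1; first by [].
  by split; [exact: tri_swap|rewrite fset3_swap].
have inT (s : R) : 0 <= s <= 1 -> hull T (a + s *: (b - a)).
  move=> /andP[s0 s1]; have [sa sb sc] := bc_edge s h.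
  by rewrite e2 hull3 // sa sb sc; split; slra.
have rel (s : R) : 0 < s < 1 -> bdry Om (a + s *: (b - a)).
  move=> /andP[s0 s1]; set y := a + s *: (b - a).
  have yT : hull T y by apply: inT; rewrite !ltW.
  have [sa sb sc] := bc_edge s h; rewrite -/y in sa sb sc.
  split; first by apply/(reg_cover reg); exists T.
  move=> hi.
  have only T' : T' \in enum_fset TT -> \forall z \near y, hull T' z -> T' = T.
    move=> hT'; have [->|ne] := pselect (T' = T); first by near=> z.
    have [yT'|yT'] := pselect (hull T' y); last first.
      have := hull_closed (reg_tri reg hT') yT'.
      by apply: filterS => z.
    have vz z : z \in T -> bary T z y != 0 -> z \in T'.
      by move=> zT; apply: contraNT => zT'; rewrite (reg_face0 reg hT hT' yT yT' zT zT').
    have aT' : a \in T'.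
      by apply: vz; rewrite e2 ?inE ?eqxx // bary3 // sa; slra.
    have bT' : b \in T'.
      by apply: vz; rewrite e2 ?inE ?eqxx ?orbT // bary3b // sb; slra.
    near=> z => _.
    apply: (bdry_edge_one_triangle hT hT' ab eT _ tt hb); apply/edgesP; split; last by rewrite cardfs2 ab.
    by apply/fsubsetP => w; rewrite !inE => /orP[] /eqP ->.
  have := near_seq only => {}only.
  have [e /andP[e0 e1'] [ze zO]] := nbhs_dir (y - c) (filterI only hi).
  set z := y + e *: (y - c) in ze zO.
  have /(reg_cover reg) [T' hT' zT'] : closure Om z by apply: subset_closure.
  have {}ze := ze T' hT' zT'; subst T'.
  move: zT'; rewrite e2 hull3 // => -[_ _].
  by rewrite /z bc_line -bcB sc (bc_self (tri_rot (tri_rot h))); slra.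
have endp u v : (forall s : R, 0 < s < 1 -> bdry Om (u + s *: (v - u))) -> closure Om u -> bdry Om u.
  move=> hr cu; split=> // hi.
  have [e he he2] := nbhs_dir (v - u) (nbhs_interior hi).
  by have [_] := hr e he; apply.
have cl u : hull T u -> closure Om u by move=> ?; apply/(reg_cover reg); exists T.
move=> y; rewrite hull2 // => -[s [/andP[s0 s1] ->]].
have [s0'|s0'] := eqVneq s 0.
  rewrite s0' scale0r addr0; apply: (endp _ b rel); apply: cl.
  by have := inT 0; rewrite scale0r addr0; apply; rewrite lexx ler01.
have [s1'|s1'] := eqVneq s 1.
  rewrite s1' scale1r addrC subrK; apply: (endp _ a).
    move=> r /andP[r0 r1]; have -> : b + r *: (a - b) = a + (1 - r) *: (b - a).
      by plane_ring.
    by apply: rel; apply/andP; split; slra.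
  apply: cl; have := inT 1; rewrite scale1r addrC subrK; apply; by rewrite lexx ler01.
by apply: rel; rewrite !lt_neqAle s0 s1 s1' eq_sym s0'.
Unshelve. all: by end_near. Qed.

Lemma bdry_uniq T T' E : T \in TT -> T' \in TT -> E \in edges T -> E \in edges T' ->
  on_boundary Om E -> T' = T.
Proof.
move=> hT hT' eT eT' hb.
have [a [b [c [_ eE h]]]] := triangle_edge (reg_tri reg hT) eT; subst E.
have ab := tri_neq h; have tt : 0 < (2^-1 : R) < 1 by apply/andP; split; slra.
apply: (bdry_edge_one_triangle hT hT' ab eT eT' tt); apply: hb; rewrite hull2 //.
by exists 2^-1; split=> //; apply/andP; split; slra.
Qed.

Lemma head_unique (s : seq (simplex R)) (P : pred (simplex R)) T :
  T \in s -> P T -> (forall T', T' \in s -> P T' -> T' = T) -> head fset0 [seq x <- s | P x] = T.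
Proof.
move=> hT pT hu.
have : head fset0 [seq x <- s | P x] \in [seq x <- s | P x].
  have : T \in [seq x <- s | P x] by rewrite mem_filter pT.
  by case: [seq x <- s | P x] => //= u l _; rewrite mem_head.
by rewrite mem_filter => /andP[h1 h2]; exact: hu.
Qed.

Lemma jump_bdry (V : zmodType) nu E T (F : simplex R -> V) : T \in TT -> E \in edges T ->
  on_boundary Om E -> jump Om TT nu E F = F T.
Proof.
move=> hT eT hb; rewrite /jump; case: asboolP => // _; congr F.
by apply: head_unique => // T' hT' eT'; exact: bdry_uniq eT eT' hb.
Qed.

Lemma opposite3 a b c : tri a b c -> opposite [fset a; b; c] [fset a; b] = c.
Proof.
move=> h; rewrite /opposite.
have -> : ([fset a; b; c] `\` [fset a; b])%fset = [fset c].
  apply/fsetP => z; rewrite !inE.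
  have [->|] := eqVneq z a; first by rewrite (negbTE (_ : a != c)) // eq_sym (tri_neq (tri_rot (tri_rot h))).
  have [->|] := eqVneq z b; first by rewrite (negbTE (_ : b != c)) // (tri_neq (tri_rot h)).
  by rewrite /=.
have -> // : enum_fset [fset c] = [:: c].
apply: perm_small_eq => //; apply: uniq_perm; rewrite ?fset_uniq // => z.
by rewrite -[LHS]/(z \in [fset c]) !inE.
Qed.

Lemma mid2 a b : a != b -> mid [fset a; b] = 2^-1 *: (a + b).
Proof. by move=> ab; rewrite /mid cardfs2 ab sum2. Qed.

Lemma normal_cross (nu e x : plane R) : dot nu nu = 1 -> dot nu e = 0 ->
  cross x e * (e.2 * nu.1 - e.1 * nu.2) = dot x nu * dot e e.
Proof.
move=> h1 h2; have [e1 e2] := normal_coord h1 h2.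
set s := _ - _ in e1 e2 *.
have -> : dot e e = s ^+ 2.
  by rewrite -[RHS]mulr1 -h1 {1}/dot e1 e2 /dot; ring.
by rewrite /cross e1 e2 /dot; ring.
Qed.

Lemma cross_len (nu e : plane R) : dot nu nu = 1 -> dot nu e = 0 ->
  (e.2 * nu.1 - e.1 * nu.2) ^+ 2 = dot e e.
Proof.
move=> h1 h2; transitivity (dot e e * dot nu nu - dot nu e ^+ 2); last by rewrite h1 h2; ring.
by rewrite /dot; ring.
Qed.

Lemma mid_dot a b c (nu : plane R) : dot nu (b - a) = 0 -> dot (c - 2^-1 *: (a + b)) nu = dot (c - a) nu.
Proof.
move=> h; transitivity (dot (c - a) nu - 2^-1 * dot nu (b - a)); last by rewrite h; ring.
by rewrite /dot /= /GRing.scale /=; field.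
Qed.

Lemma outward_dot (nu : simplex R -> plane R) a b c : tri a b c -> let E := [fset a; b] in
  dot (nu E) (nu E) = 1 -> dot (nu E) (b - a) = 0 ->
  dot (outward nu [fset a; b; c] E) (nu E) = - Num.sg (dot (c - a) (nu E)).
Proof.
move=> h E n1 n2; rewrite /outward opposite3 // mid2 ?(tri_neq h) // (mid_dot _ n2).
transitivity (- Num.sg (dot (c - a) (nu E)) * dot (nu E) (nu E)); last by rewrite n1 mulr1.
by rewrite /dot /= /GRing.scale /=; ring.
Qed.

Lemma dot_opposite_neq0 (nu a b c : plane R) : tri a b c -> dot nu nu = 1 -> dot nu (b - a) = 0 ->
  dot (c - a) nu != 0.
Proof.
move=> h n1 n2; apply/eqP => h0.
have k0 := tri_cross (tri_rot (tri_rot h)).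
have := normal_cross (c - a) n1 n2; rewrite h0 mul0r => /eqP; rewrite mulf_eq0 (negbTE k0) /= => /eqP s0.
have e0 : dot (b - a) (b - a) = 0 by rewrite -(cross_len n1 n2) s0 expr0n.
have := @dot_gt0 R (b - a); rewrite e0 ltxx subr_eq0 eq_sym (tri_neq h).
by move/(_ isT).
Qed.

Lemma opposite_signs T T' a b c c' (nu : plane R) : T \in TT -> T' \in TT -> T <> T' ->
  T = [fset a; b; c] -> T' = [fset a; b; c'] -> tri a b c -> tri a b c' ->
  dot nu nu = 1 -> dot nu (b - a) = 0 ->
  Num.sg (dot (c' - a) nu) = - Num.sg (dot (c - a) nu).
Proof.
move=> hT hT' ne eT eT' h h' n1 n2.
have op := opposite_sides hT hT' ne eT eT' h h'.
have k1 := normal_cross (c - a) n1 n2; have k2 := normal_cross (c' - a) n1 n2.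
have k3 := cross_len n1 n2.
have d0 := dot_opposite_neq0 h n1 n2; have d0' := dot_opposite_neq0 h' n1 n2.
have pos : 0 < dot (b - a) (b - a) by rewrite dot_gt0 // subr_eq0 eq_sym (tri_neq h).
have prod : dot (c - a) nu * dot (c' - a) nu < 0.
  rewrite -(pmulr_llt0 _ pos) -(pmulr_llt0 _ pos).
  rewrite (_ : _ * _ * _ * _ = (dot (c - a) nu * dot (b - a) (b - a)) * (dot (c' - a) nu * dot (b - a) (b - a))); last by ring.
  rewrite -k1 -k2 mulrACA -expr2 k3.
  by rewrite pmulr_llt0.
have /orP[p|p] := lt_total d0.
  have p' : 0 < dot (c' - a) nu by move: prod; rewrite nmulr_rlt0.
  by rewrite (gtr0_sg p') (ltr0_sg p) opprK.
have p' : dot (c' - a) nu < 0 by move: prod; rewrite pmulr_rlt0.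
by rewrite (gtr0_sg p) (ltr0_sg p').
Qed.

Lemma side_unique (nu : simplex R -> plane R) T T' E : T \in TT -> T' \in TT ->
  E \in edges T -> E \in edges T' ->
  dot (nu E) (nu E) = 1 -> dot (nu E) (edge_end E 1 - edge_end E 0) = 0 ->
  T <> T' -> dot (outward nu T' E) (nu E) = - dot (outward nu T E) (nu E) /\
     (dot (outward nu T E) (nu E) = 1 \/ dot (outward nu T E) (nu E) = -1).
Proof.
move=> hT hT' eT eT' n1 n2 ne.
have [a [b [c [c' [e1 e2 e3 h h']]]]] := two_on_edge (reg_tri reg hT) (reg_tri reg hT') eT eT'.
have n2' : dot (nu E) (b - a) = 0.
  move: n2; rewrite {2 3}e3 /edge_end; have [->|->] := enum2_cases (tri_neq h) => //= n2.
  by transitivity (- dot (nu E) (a - b)); [rewrite /dot /=; ring|rewrite n2 oppr0].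
have s := opposite_signs hT hT' ne e1 e2 h h' n1 n2'.
have d0 := dot_opposite_neq0 h n1 n2'.
rewrite e1 e2; move: n1 n2' s d0; rewrite e3 => n1 n2' s d0.
rewrite !outward_dot // s; split=> //.
have [p|p|p] := ltgtP (dot (c - a) (nu [fset a; b])) 0; last by rewrite p eqxx in d0.
  by left; rewrite (ltr0_sg p) opprK.
by right; rewrite (gtr0_sg p).
Qed.

(** The sign depends on the side to which nu points. *)
Lemma jump_inner (V : zmodType) (nu : simplex R -> plane R) E T T' (F : simplex R -> V) :
  unit_normals nu -> T \in TT -> T' \in TT ->
  E \in edges T -> E \in edges T' -> T <> T' ->
  jump Om TT nu E F = F T - F T' \/ jump Om TT nu E F = F T' - F T.
Proof.
move=> hnu hT hT' eT eT' ne.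
have nb : ~ on_boundary Om E by move=> hb; apply: ne; exact: bdry_uniq eT' eT hb.
have [n1 n2] : dot (nu E) (nu E) = 1 /\ dot (nu E) (edge_end E 1 - edge_end E 0) = 0.
  by apply: hnu; have [] := edgesP _ _ eT.
have n11 : (1 : R) <> -1 by move=> h; have := @ltr01 R; have := @ltrN10 R; rewrite -h => /lt_trans h1 /h1; rewrite ltxx.
have U T1 T2 : T1 \in TT -> T2 \in TT -> E \in edges T1 -> E \in edges T2 ->
    dot (outward nu T1 E) (nu E) = dot (outward nu T2 E) (nu E) -> T1 = T2.
  move=> h1 h2 e1 e2 e; apply: contrapT => n12.
  have [k1 k2] := side_unique h1 h2 e1 e2 n1 n2 n12.
  by move: k1 k2; rewrite e => k1 [] k2; rewrite k2 ?opprK in k1; case: n11.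
have S s T1 : T1 \in TT -> E \in edges T1 -> dot (outward nu T1 E) (nu E) = s -> side TT nu E s = T1.
  move=> h1 e1 es; apply: head_unique => //; first by rewrite e1 es eqxx.
  by move=> T2 h2 /andP[e2 /eqP es2]; apply: U => //; rewrite es es2.
have [k1 k2] := side_unique hT hT' eT eT' n1 n2 ne.
rewrite /jump; case: asboolP => // _.
case: k2 => k2; rewrite k2 in k1.
  by left; rewrite (S _ _ hT eT k2) (S _ _ hT' eT' k1).
by right; rewrite opprK in k1; rewrite (S _ _ hT eT k2) (S _ _ hT' eT' k1).
Qed.

End Regular.
End Edges.

(** * The number of triangles at a vertex *)

Section Valence.
Variable R : realType.
Implicit Types (a b c p q x y z v : plane R) (f : plane R -> R) (T A E K : simplex R)
  (Om : set (plane R)) (TT : mesh R).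

Definition balls (M : R) T c c' (r r' : R) :=
  [/\ 0 < r, r' <= M * r, cball c r `<=` hull T & hull T `<=` cball c' r'].

Lemma balls_fat (M : R) T c c' (r r' : R) : triangle T -> balls M T c c' r r' -> fat T r (4 * M).
Proof.
move=> hT [r0 hr h1 h2]; split=> //; first exact: ball_slope h1.
move=> x y hx hy; apply: le_trans (ball_diam h2 hx hy) _.
by rewrite -mulrA ler_wpM2l.
Qed.

Lemma ball_inner T c (r : R) p : triangle T -> 0 < r -> cball c r `<=` hull T ->
  `|p.1 - c.1| <= r / 2 -> `|p.2 - c.2| <= r / 2 -> forall z, z \in T -> 0 < bary T z p.
Proof.
move=> hT r0 hb h1 h2 z zT.
have N : nbhs p (hull T).
  near=> y; apply: hb; rewrite /cball /=; apply: enorm_le; first exact: ltW.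
  have : 0 < r ^+ 2 - (dot (1, 0) (y - c) * dot (1, 0) (y - c) + dot (0, 1) (y - c) * dot (0, 1) (y - c)).
    near: y; apply: near_pos => [y|].
      apply: cvgB; first exact: cvg_cst.
      by apply: cvgD; apply: cvgM; exact: dot_continuous.
    rewrite /dot /= !mul1r !mul0r addr0 add0r -!expr2.
    have sq (u : R) : `|u| <= r / 2 -> u ^+ 2 <= r ^+ 2 / 4.
      move=> hu; rewrite -real_normK ?num_real // (_ : r ^+ 2 / 4 = (r / 2) ^+ 2); last by field.
      by rewrite ler_pXn2r // nnegrE // divr_ge0 // ltW.
    have := sq _ h1; have := sq _ h2; have : 0 < r ^+ 2 by rewrite exprn_gt0.
    by move=> ? ? ?; lra.
  by rewrite /dot /= !mul1r !mul0r addr0 add0r -!expr2 => ?; lra.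
have [e /andP[e0 e1] he] := nbhs_dir (p - z) N.
have [a [b [d eb]]] := bary_affine hT zT.
have bz : bary T z z = 1 by rewrite bary_vertex // eqxx.
move: he; rewrite tri_hull // => /(_ z zT); move: bz; rewrite eb bc_line -bcB => -> ?.
by nra.
Unshelve. all: by end_near. Qed.

Lemma seq_argmin (I : eqType) (s : seq I) (F : I -> R) : s != [::] ->
  exists2 i, i \in s & forall j, j \in s -> F i <= F j.
Proof.
elim: s => // i s IH _; have [->|sn] := eqVneq s [::].
  by exists i; rewrite ?inE ?eqxx // => j; rewrite !inE => /eqP ->.
have [k ks hk] := IH sn; have [h|h] := leP (F i) (F k).
  exists i; rewrite ?inE ?eqxx // => j; rewrite inE => /predU1P[->//|/hk]; exact: le_trans.
exists k; first by rewrite inE ks orbT.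
by move=> j; rewrite inE => /predU1P[->|/hk //]; exact: ltW.
Qed.

(** Homotheties with centre z shrink the triangles at z to the smallest of
    their inradii r0 and keep them inside the original triangles. The shrunk
    balls stay within a multiple of r0 of z, and each triangle has in its
    interior a point of a fixed grid of width r0 / 2. As the triangles do not
    overlap, these grid points are different. *)
Lemma valence (M : R) : exists N : nat, forall Om TT, regular_triangulation Om TT ->
  (forall T, T \in TT -> exists c c' r r', balls M T c c' r r') ->
  forall z, (size [seq T : simplex R <- enum_fset TT | z \in T] <= N)%N.
Proof.
(* the shifted coordinates cx and cy below lie between 0 and 8 * M *)
pose n := (Num.truncn (8 * M)).+1.
exists #|{: 'I_n * 'I_n}| => Om TT reg hB z.
set s : seq (simplex R) := [seq T : simplex R <- enum_fset TT | z \in T].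
have [->//|sn] := eqVneq s [::].
have ex (T : simplex R) : exists p : (plane R * plane R) * (R * R),
    T \in TT -> balls M T p.1.1 p.1.2 p.2.1 p.2.2.
  have [hT|hT] := pselect (T \in TT).
    by have [c [c' [r [r' h]]]] := hB T hT; exists ((c, c'), (r, r')).
  by exists ((0, 0), (0, 0)) => /hT.
have [F hF] := choice ex.
have [T0 hT0 hmin] := seq_argmin (fun T => (F T).2.1) sn.
have sE T : T \in s -> T \in TT /\ z \in T by rewrite mem_filter => /andP[].
set r0 := (F T0).2.1 in hmin.
have r0_gt : 0 < r0 by have [/hF[]] := sE T0 hT0.
(* the centre of the shrunk ball and its coordinates in units of r0 / 2, shifted to be nonnegative *)
pose ctr T := z + (r0 / (F T).2.1) *: ((F T).1.1 - z).
pose cx T := ((ctr T).1 - z.1) / (r0 / 2) + 4 * M.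
pose cy T := ((ctr T).2 - z.2) / (r0 / 2) + 4 * M.
have cxy T : T \in s -> 0 <= cx T <= 8 * M /\ 0 <= cy T <= 8 * M.
  move=> Ts; have [hT zT] := sE T Ts; have [rT hr h1 h2] := hF T hT.
  have zc : enorm (z - (F T).1.2) <= (F T).2.2 by apply: h2; exact: hull_vertex.
  have cc : enorm ((F T).1.1 - (F T).1.2) <= (F T).2.2.
    by apply/h2/h1; rewrite /cball /= subrr /enorm /dot /= !mul0r addr0 sqrtr0 ltW.
  have [z1 z2] := enorm_comp (z - (F T).1.2); have [c1 c2] := enorm_comp ((F T).1.1 - (F T).1.2).
  have e (u w : R) : `|u| <= (F T).2.2 -> `|w| <= (F T).2.2 -> 0 <= r0 / (F T).2.1 * (u - w) / (r0 / 2) + 4 * M <= 8 * M.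
    move=> hu hw.
    have -> : r0 / (F T).2.1 * (u - w) / (r0 / 2) = 2 * ((u - w) / (F T).2.1).
      by field; rewrite !gt_eqF.
    have : `|(u - w) / (F T).2.1| <= 2 * M.
      rewrite normrM (gtr0_norm (_ : 0 < ((F T).2.1)^-1)) ?invr_gt0 // ler_pdivrMr //.
      by apply: le_trans (ler_normB _ _) _; rewrite -mulrA; lra.
    by rewrite ler_norml => /andP[? ?]; apply/andP; split; lra.
  rewrite /cx /cy /ctr /= /GRing.scale /=.
  have -> : z.1 + r0 / (F T).2.1 * ((F T).1.1.1 - z.1) - z.1 = r0 / (F T).2.1 * (((F T).1.1 - (F T).1.2).1 - (z - (F T).1.2).1) by rewrite /=; ring.
  have -> : z.2 + r0 / (F T).2.1 * ((F T).1.1.2 - z.2) - z.2 = r0 / (F T).2.1 * (((F T).1.1 - (F T).1.2).2 - (z - (F T).1.2).2) by rewrite /=; ring.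
  by split; apply: e; [exact: le_trans c1 cc|exact: le_trans z1 zc|exact: le_trans c2 cc|exact: le_trans z2 zc].
pose idx T : 'I_n * 'I_n := (inord (Num.truncn (cx T)), inord (Num.truncn (cy T))).
have idxE T : T \in s -> (nat_of_ord (idx T).1 = Num.truncn (cx T)) /\ (nat_of_ord (idx T).2 = Num.truncn (cy T)).
  by move=> /cxy [/andP[_ h1] /andP[_ h2]]; rewrite /idx /= !inordK // ltnS le_truncn.
(* rounding down these coordinates gives a point of the shrunk ball *)
pose grid (i : 'I_n * 'I_n) : plane R := z + (r0 / 2) *: ((i.1%:R - 4 * M, i.2%:R - 4 * M) : plane R).
have inner T : T \in s -> forall y, y \in T -> 0 < bary T y (grid (idx T)).
  move=> Ts y yT; have [hT zT] := sE T Ts; have [rT hr h1 h2] := hF T hT.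
  have tT := reg_tri reg hT; have [/andP[x0 _] /andP[y0 _]] := cxy T Ts.
  have [i1 i2] := idxE T Ts.
  have /andP[k1 k2] := truncn_itv x0; have /andP[k3 k4] := truncn_itv y0.
  rewrite -i1 -natr1 in k1 k2; rewrite -i2 -natr1 in k3 k4.
  set l := r0 / (F T).2.1.
  have l0 : 0 < l by rewrite divr_gt0.
  have l1 : l <= 1 by rewrite ler_pdivrMr // mul1r hmin.
  pose p' := z + l^-1 *: (grid (idx T) - z).
  have -> : grid (idx T) = z + l *: (p' - z).
    rewrite /p' [z + _ - z]addrAC subrr add0r scalerA mulfV ?gt_eqF // scale1r.
    by rewrite addrC subrK.
  rewrite bary_line // bary_vertex //.
  have aux (u w : R) : 0 < u -> `|w| <= 1 -> `|u * w| <= u.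
    by move=> u0 w1; rewrite normrM gtr0_norm // ler_piMr // ltW.
  have pp : 0 < bary T y p'.
    apply: (ball_inner tT rT h1) => //; rewrite /p' /grid /= /GRing.scale /=.
    - have -> : z.1 + l^-1 * (z.1 + r0 / 2 * ((idx T).1%:R - 4 * M) - z.1) - (F T).1.1.1
         = (F T).2.1 / 2 * ((idx T).1%:R - cx T).
        by rewrite /cx /ctr /l /= /GRing.scale /=; field; rewrite !gt_eqF.
      apply: aux; first by rewrite divr_gt0.
      by rewrite ler_norml; apply/andP; split; lra.
    - have -> : z.2 + l^-1 * (z.2 + r0 / 2 * ((idx T).2%:R - 4 * M) - z.2) - (F T).1.1.2
         = (F T).2.1 / 2 * ((idx T).2%:R - cy T).
        by rewrite /cy /ctr /l /= /GRing.scale /=; field; rewrite !gt_eqF.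
      apply: aux; first by rewrite divr_gt0.
      by rewrite ler_norml; apply/andP; split; lra.
  by apply: ltr_wpDl; [apply: mulr_ge0; [rewrite subr_ge0|exact: ler0n]|exact: mulr_gt0].
have inj : {in s &, injective idx}.
  move=> T T' Ts Ts' e; have [hT _] := sE T Ts; have [hT' _] := sE T' Ts'.
  apply: (reg_interior reg hT hT' (inner T Ts)).
  rewrite e tri_hull; last exact: (reg_tri reg hT').
  by move=> y yT; apply/ltW; exact: (inner T' Ts').
rewrite -(size_map idx) -(card_uniqP _) ?max_card // map_inj_in_uniq //.
by rewrite filter_uniq // fset_uniq.
Unshelve. all: by end_near. Qed.

End Valence.

(** * Edge bubbles *)

Section Bubble.
Variable R : realType.
Implicit Types (a b c m p q x y z v : plane R) (f w : plane R -> R) (G : plane R -> plane R)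
  (nu : simplex R -> plane R) (n : plane R) (T E K : simplex R).

Lemma cauchy_unit n x : dot n n = 1 -> `|dot x n| <= enorm x.
Proof.
move=> h; rewrite -(ler_pXn2r (_ : (0 < 2)%N)) ?nnegrE ?enorm_ge0 //.
rewrite real_normK ?num_real // enorm_sqr -[leRHS]mulr1 -h -subr_ge0.
rewrite (_ : _ - _ = (x.1 * n.2 - x.2 * n.1) ^+ 2) ?sqr_ge0 //.
by rewrite /dot; ring.
Qed.

Lemma proj_normal n (e u : plane R) : dot n n = 1 -> dot n e = 0 -> dot e e != 0 ->
  u - (dot u e / dot e e) *: e = dot u n *: n.
Proof.
move=> h1 h2 e0; have k := cross_len h1 h2; have [z1 z2] := normal_coord h1 h2.
rewrite -k; rewrite -k sqrf_eq0 in e0; move: z1 z2 e0.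
set g := _ - _ => z1 z2 e0; rewrite /dot in h1.
apply: plane_eq; rewrite /= /GRing.scale /= /dot; rewrite z1 z2.
  transitivity (u.1 * (n.1 * n.1 + n.2 * n.2) - (u.1 * n.2 ^+ 2 - u.2 * n.1 * n.2)); last by ring.
  by rewrite h1; field.
transitivity (u.2 * (n.1 * n.1 + n.2 * n.2) - (u.2 * n.1 ^+ 2 - u.1 * n.1 * n.2)); last by ring.
by rewrite h1; field.
Qed.

Lemma dist_line a b c n : a != b -> dot n n = 1 -> dot n (b - a) = 0 ->
  dist c (affine_hull [fset a; b]) = `|dot (c - a) n|.
Proof.
move=> ab h1 h2; rewrite /dist; apply/eqP; rewrite eq_le; apply/andP; split.
  apply: ge_inf.
    by exists 0 => _ [y _ <-]; exact: enorm_ge0.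
  pose e := b - a.
  have e0 : dot e e != 0 by rewrite gt_eqF // dot_gt0 // subr_eq0 eq_sym.
  pose s := dot (c - a) e / dot e e.
  exists (a + s *: e).
    exists (fun z => if z == b then s else 1 - s); rewrite !sum2 // eqxx (negbTE ab); split.
      by rewrite subrK.
    by plane_ring.
  have -> : c - (a + s *: e) = dot (c - a) n *: n.
    by rewrite opprD addrA; exact: proj_normal.
  rewrite /enorm; have -> : dot (dot (c - a) n *: n) (dot (c - a) n *: n) = dot (c - a) n ^+ 2 * dot n n.
    by rewrite {1}/dot /= /GRing.scale /= [dot n n]/dot; ring.
  by rewrite h1 mulr1 sqrtr_sqr.
apply: lb_le_inf.
  exists (enorm (c - a)), a => //.
  exists (fun z => if z == b then 0 else 1); rewrite !sum2 // eqxx (negbTE ab) addr0; split=> //.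
  by rewrite scale1r scale0r addr0.
move=> _ [y [w [w1 ->]] <-]; rewrite !sum2 // in w1 *.
apply: le_trans (cauchy_unit _ h1).
have -> : w a = 1 - w b by rewrite -w1; ring.
suff -> : dot (c - a) n = dot (c - ((1 - w b) *: a + w b *: b)) n by [].
transitivity (dot (c - a) n - w b * dot n (b - a)); first by rewrite h2; ring.
by rewrite /dot /= /GRing.scale /=; ring.
Qed.

(** With d the signed height of c over [a, b], in which the orientations of
    the two normals and the distance combine, this is the bubble of [a, b]. *)
Definition edge_bubble a b c (d : R) x := 30 * d * (bc a b c x ^+ 2 * bc b c a x ^+ 2 * bc c a b x).
Definition bc_slope a b c : plane R := (bcl a b c (1, 0), bcl a b c (0, 1)).
Definition edge_bubble_grad a b c (d : R) x : plane R :=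
  (30 * d) *: ((2 * bc a b c x * bc b c a x ^+ 2 * bc c a b x) *: bc_slope a b c
   + (2 * bc a b c x ^+ 2 * bc b c a x * bc c a b x) *: bc_slope b c a
   + (bc a b c x ^+ 2 * bc b c a x ^+ 2) *: bc_slope c a b).

Lemma edge_bubble_is_grad a b c d x : is_grad (edge_bubble a b c d) x (edge_bubble_grad a b c d x).
Proof.
apply: is_grad_eq.
  apply: is_gradZ; apply: is_gradM; last exact: bc_grad.
  by apply: is_gradM; apply: is_gradX; exact: bc_grad.
by apply: plane_eq; rewrite /edge_bubble_grad /bc_slope /= /GRing.scale /=; ring.
Qed.

Lemma bubbleE nu a b c : tri a b c -> let E := [fset a; b] in
  dot (nu E) (nu E) = 1 -> dot (nu E) (b - a) = 0 ->
  bubble nu E [fset a; b; c] = edge_bubble a b c (dot (c - a) (nu E)).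
Proof.
move=> h E n1 n2; apply: funext => x; rewrite /bubble opposite3 //.
rewrite (dist_line c (tri_neq h) n1 n2) prod2 ?(tri_neq h) // bary3 // bary3b // bary3c //.
rewrite outward_dot // /edge_bubble (bc_swap b); set d := dot _ _.
have -> : - 30%:R * - Num.sg d * `|d| = 30 * d.
  by rewrite mulrNN -mulrA -numEsg.
by ring.
Qed.

(** Across the height of the triangle the coordinate of c grows from 0
    to 1. *)
Lemma bcl_normal a b c n : tri a b c -> dot n n = 1 -> dot n (b - a) = 0 ->
  bcl c a b n * dot (c - a) n = 1.
Proof.
move=> h n1 n2; rewrite /bcl.
have k0 := tri_cross (tri_rot (tri_rot h)).
have d0 := dot_opposite_neq0 h n1 n2.
have k1 := normal_cross (c - a) n1 n2; have k2 := normal_cross n n1 n2.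
rewrite n1 mul1r in k2.
have e0 : dot (b - a) (b - a) != 0 by rewrite gt_eqF // dot_gt0 // subr_eq0 eq_sym (tri_neq h).
have s0 : (b - a).2 * n.1 - (b - a).1 * n.2 != 0 by rewrite -sqrf_eq0 (cross_len n1 n2).
apply: (mulIf s0); apply: (mulIf k0); rewrite mul1r.
by rewrite [RHS]mulrC k1 -k2; field.
Qed.

Lemma edge_bubble_grad_edge a b c d x : bc c a b x = 0 ->
  edge_bubble_grad a b c d x = (30 * d * (bc a b c x ^+ 2 * bc b c a x ^+ 2)) *: bc_slope c a b /\
  edge_bubble_grad b c a d x = 0 /\ edge_bubble_grad c a b d x = 0.
Proof.
move=> h; rewrite /edge_bubble_grad h; split; last split; plane_ring.
Qed.

Lemma edge_bubble_edge a b c d x : bc c a b x = 0 ->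
  [/\ edge_bubble a b c d x = 0, edge_bubble b c a d x = 0 & edge_bubble c a b d x = 0].
Proof. by move=> h; rewrite /edge_bubble h; split; ring. Qed.

Lemma dot_bc_slope a b c v : dot (bc_slope a b c) v = bcl a b c v.
Proof. by rewrite bclE. Qed.

Lemma prod4_lip (x1 x2 x3 x4 y1 y2 y3 y4 e : R) :
  0 <= x1 <= 1 -> 0 <= x2 <= 1 -> 0 <= x3 <= 1 -> 0 <= x4 <= 1 ->
  0 <= y1 <= 1 -> 0 <= y2 <= 1 -> 0 <= y3 <= 1 -> 0 <= y4 <= 1 ->
  `|x1 - y1| <= e -> `|x2 - y2| <= e -> `|x3 - y3| <= e -> `|x4 - y4| <= e ->
  `|x1 * x2 * x3 * x4 - y1 * y2 * y3 * y4| <= 4 * e.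
Proof.
have two (x x' y y' e1 e2 : R) : 0 <= x' <= 1 -> 0 <= y <= 1 -> `|x - y| <= e1 -> `|x' - y'| <= e2 ->
    `|x * x' - y * y'| <= e1 + e2.
  move=> /andP[a0 a1] /andP[b0 b1] h1 h2.
  have -> : x * x' - y * y' = (x - y) * x' + y * (x' - y') by ring.
  apply: le_trans (ler_normD _ _) _; rewrite !normrM (ger0_norm a0) (ger0_norm b0).
  by apply: lerD; [apply: le_trans (ler_piMr _ a1) h1|apply: le_trans (ler_piMl _ b1) h2].
have p01 (x y : R) : 0 <= x <= 1 -> 0 <= y <= 1 -> 0 <= x * y <= 1.
  by move=> /andP[a0 a1] /andP[b0 b1]; rewrite mulr_ge0 // mulr_ile1.
move=> x1h x2h x3h x4h y1h y2h y3h y4h h1 h2 h3 h4.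
have -> : 4 * e = e + e + e + e by ring.
have y12 := p01 _ _ y1h y2h; have y123 := p01 _ _ y12 y3h.
by apply: (two) => //; apply: (two) => //; apply: (two).
Qed.

Lemma bc01 a b c x : tri a b c -> hull [fset a; b; c] x ->
  [/\ 0 <= bc a b c x <= 1, 0 <= bc b c a x <= 1 & 0 <= bc c a b x <= 1].
Proof.
move=> h; rewrite hull3c // => -[h1 h2 h3]; have hs := bc_sumc x h.
by split; apply/andP; split; lra.
Qed.

(** Two derivatives of the coordinates give a factor r^-2, and the height d
    takes back one power of r. *)
Lemma edge_bubble_grad_lip a b c (r D d : R) : tri a b c -> fat [fset a; b; c] r D -> `|d| <= D * r ->
  lip_on a b c (edge_bubble_grad a b c d) (150 * D / r).
Proof.
move=> h hfat hd x y hx hy; have [r0 _ _] := hfat.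
have [ax bx cx] := bc01 h hx; have [ay by' cy] := bc01 h hy.
have s1 v := bcl_small v h hfat.
have s2 v := bcl_small v (tri_rot h) (fat_rot hfat).
have s3 v := bcl_small v (tri_rot (tri_rot h)) (fat_rot (fat_rot hfat)).
set e := n1 (y - x) / (2 * r).
have e1 : `|bc a b c y - bc a b c x| <= e by rewrite bcB; exact: s1.
have e2 : `|bc b c a y - bc b c a x| <= e by rewrite bcB; exact: s2.
have e3 : `|bc c a b y - bc c a b x| <= e by rewrite bcB; exact: s3.
have e0 : 0 <= e by apply: le_trans e1.
have key (u1 u2 u3 : R) : `|u1| <= (2 * r)^-1 -> `|u2| <= (2 * r)^-1 -> `|u3| <= (2 * r)^-1 ->
  `|30 * d * (2 * bc a b c y * bc b c a y ^+ 2 * bc c a b y * u1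
     + 2 * bc a b c y ^+ 2 * bc b c a y * bc c a b y * u2 + bc a b c y ^+ 2 * bc b c a y ^+ 2 * u3)
   - 30 * d * (2 * bc a b c x * bc b c a x ^+ 2 * bc c a b x * u1
     + 2 * bc a b c x ^+ 2 * bc b c a x * bc c a b x * u2 + bc a b c x ^+ 2 * bc b c a x ^+ 2 * u3)|
   <= 150 * D / r * n1 (y - x).
  move=> h1 h2 h3.
  have P1 := prod4_lip ay by' by' cy ax bx bx cx e1 e2 e2 e3.
  have P2 := prod4_lip ay ay by' cy ax ax bx cx e1 e1 e2 e3.
  have P3 := prod4_lip ay ay by' by' ax ax bx bx e1 e1 e2 e2.
  move: P1 P2 P3; set q1 := _ - _; set q2 := _ - _; set q3 := _ - _ => P1 P2 P3.
  have -> : 150 * D / r * n1 (y - x) = (30 * (D * r)) * (5 * (2 * e * r^-1)).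
    by rewrite /e; field; rewrite gt_eqF.
  rewrite -mulrBr normrM; apply: ler_pM => //.
    by rewrite normrM ger0_norm // ler_wpM2l.
  rewrite [X in Num.norm X](_ : _ = 2 * (q1 * u1) + 2 * (q2 * u2) + q3 * u3); last first.
    by rewrite /q1 /q2 /q3; ring.
  have M (q u : R) : `|q| <= 4 * e -> `|u| <= (2 * r)^-1 -> `|q * u| <= 2 * e * r^-1.
    move=> hq hu; rewrite normrM (_ : 2 * e * r^-1 = 4 * e * (2 * r)^-1); first exact: ler_pM.
    by field; rewrite gt_eqF.
  have := M _ _ P1 h1; have := M _ _ P2 h2; have := M _ _ P3 h3.
  have : 0 <= 2 * e * r^-1 by apply: mulr_ge0; [exact: mulr_ge0|rewrite invr_ge0 ltW].
  by rewrite !ler_norml; set k := 2 * e * r^-1 => ? /andP[? ?] /andP[? ?] /andP[? ?]; apply/andP; split; lra.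
have u10 : n1 ((1, 0) : plane R) = 1 by rewrite /n1 /= normr1 normr0 addr0.
have u01 : n1 ((0, 1) : plane R) = 1 by rewrite /n1 /= normr1 normr0 add0r.
split.
  have t1 := s1 (1, 0); have t2 := s2 (1, 0); have t3 := s3 (1, 0).
  by rewrite u10 mul1r in t1 t2 t3; exact: key.
have t1 := s1 (0, 1); have t2 := s2 (0, 1); have t3 := s3 (0, 1).
by rewrite u01 mul1r in t1 t2 t3; exact: key.
Qed.

Definition bubble_comb a b c (k1 k2 k3 d1 d2 d3 : R) x :=
  k1 * edge_bubble a b c d1 x + k2 * edge_bubble b c a d2 x + k3 * edge_bubble c a b d3 x.
Definition bubble_comb_grad a b c (k1 k2 k3 d1 d2 d3 : R) x : plane R :=
  k1 *: edge_bubble_grad a b c d1 x + k2 *: edge_bubble_grad b c a d2 x + k3 *: edge_bubble_grad c a b d3 x.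

Lemma bubble_comb_is_grad a b c k1 k2 k3 d1 d2 d3 x :
  is_grad (bubble_comb a b c k1 k2 k3 d1 d2 d3) x (bubble_comb_grad a b c k1 k2 k3 d1 d2 d3 x).
Proof. by apply: is_gradD; [apply: is_gradD|]; apply: is_gradZ; exact: edge_bubble_is_grad. Qed.

Lemma bubble_comb_edge a b c k1 k2 k3 d1 d2 d3 x n : bc c a b x = 0 ->
  bubble_comb a b c k1 k2 k3 d1 d2 d3 x = 0 /\
  dot (bubble_comb_grad a b c k1 k2 k3 d1 d2 d3 x) n =
    k1 * (30 * (bc a b c x ^+ 2 * bc b c a x ^+ 2)) * (bcl c a b n * d1).
Proof.
move=> xc; rewrite /bubble_comb /bubble_comb_grad.
have [-> _ _] := edge_bubble_edge d1 xc; have [_ -> _] := edge_bubble_edge d2 xc; have [_ _ ->] := edge_bubble_edge d3 xc.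
have [-> _] := edge_bubble_grad_edge d1 xc; have [_ [-> _]] := edge_bubble_grad_edge d2 xc; have [_ [_ ->]] := edge_bubble_grad_edge d3 xc.
rewrite !scaler0 !mulr0 !addr0; split=> //.
by rewrite -dot_bc_slope /dot /= /GRing.scale /=; ring.
Qed.

Lemma lip_on_rot a b c G (L : R) : lip_on b c a G L -> lip_on a b c G L.
Proof. by move=> h x y; rewrite fset3_rot => hx hy; exact: h. Qed.

Lemma lip_on_add a b c G (G' : plane R -> plane R) (L L' : R) : lip_on a b c G L -> lip_on a b c G' L' ->
  lip_on a b c (fun x => G x + G' x) (L + L').
Proof.
move=> h h' x y hx hy; have [h1 h2] := h x y hx hy; have [h3 h4] := h' x y hx hy.
by split; rewrite /= mulrDl opprD addrACA; apply: le_trans (ler_normD _ _) _; exact: lerD.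
Qed.

Lemma lip_on_scale a b c G (L k g : R) : 0 <= L -> `|k| <= g -> lip_on a b c G L ->
  lip_on a b c (fun x => k *: G x) (g * L).
Proof.
move=> L0 hk h x y hx hy; have [h1 h2] := h x y hx hy.
by split; rewrite /= /GRing.scale /= -mulrBr normrM -mulrA; apply: ler_pM.
Qed.

Lemma bubble_comb_grad_lip a b c (r D k1 k2 k3 d1 d2 d3 g : R) : tri a b c -> fat [fset a; b; c] r D ->
  `|d1| <= D * r -> `|d2| <= D * r -> `|d3| <= D * r -> `|k1| <= g -> `|k2| <= g -> `|k3| <= g ->
  lip_on a b c (bubble_comb_grad a b c k1 k2 k3 d1 d2 d3) (450 * D * g / r).
Proof.
move=> h hfat hd1 hd2 hd3 hk1 hk2 hk3; have [r0 _ _] := hfat.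
have D0 : 0 <= D by rewrite -(pmulr_lge0 _ r0); apply: le_trans hd1.
have L0 : 0 <= 150 * D / r by rewrite divr_ge0 ?mulr_ge0 // ltW.
have l1 := lip_on_scale L0 hk1 (edge_bubble_grad_lip h hfat hd1).
have l2 := lip_on_scale L0 hk2 (edge_bubble_grad_lip (tri_rot h) (fat_rot hfat) hd2).
have l3 := lip_on_scale L0 hk3 (edge_bubble_grad_lip (tri_rot (tri_rot h)) (fat_rot (fat_rot hfat)) hd3).
have := lip_on_add (lip_on_add l1 (lip_on_rot l2)) (lip_on_rot (lip_on_rot l3)).
rewrite (_ : g * (150 * D / r) + _ + _ = 450 * D * g / r) //; ring.
Qed.

End Bubble.

(** * The companion on one triangle *)

Section Companion.
Variable R : realType.
Implicit Types (a b c m p q x y z v : plane R) (f w : plane R -> R) (G : plane R -> plane R)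
  (nu : simplex R -> plane R) (n : plane R) (T E K S : simplex R).

Lemma locateP (TT : mesh R) x : (exists2 S, S \in TT & hull S x) ->
  locate TT x \in TT /\ hull (locate TT x) x.
Proof.
move=> [S hS hx]; rewrite /locate.
have : S \in [seq T : simplex R <- TT | `[< hull T x >]].
  by rewrite mem_filter hS andbT; apply/asboolP.
case e : [seq T : simplex R <- TT | `[< hull T x >]] => [//|U l] _ /=.
have : U \in [seq T : simplex R <- TT | `[< hull T x >]] by rewrite e mem_head.
by rewrite mem_filter => /andP[/asboolP ? ?].
Qed.

Lemma mid3 a b c : tri a b c -> mid [fset a; b; c] = centroid a b c.
Proof. by move=> h; rewrite /mid (triangle_card (triangle3 h)) sum3. Qed.

Lemma edge_in a b c : tri a b c -> [fset a; b] \in edges [fset a; b; c].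
Proof.
move=> h; apply/edgesP; split; last by rewrite cardfs2 (tri_neq h).
by apply/fsubsetP => z; rewrite !inE => /orP[] ->; rewrite ?orbT.
Qed.

Definition part K E : simplex R := (mid K |` E)%fset.

Lemma part_in K E : E \in edges K -> part K E \in hct_split K.
Proof. by move=> h; rewrite /part /hct_split; apply/imfsetP; exists E. Qed.

Lemma hull_part a b c x : tri a b c -> hull [fset a; b; c] x -> near_side c a b x ->
  hull (part [fset a; b; c] [fset a; b]) x.
Proof.
move=> h hx [r1 r2]; rewrite /part mid3 //; set m := centroid a b c.
have hm : tri m a b.
  have k := tri_cross h; rewrite /tri.
  rewrite (_ : cross (a - m) (b - m) = - cross (a - b) (c - b) / 3).
    by rewrite mulf_neq0 ?invr_eq0 ?oppr_eq0 // pnatr_eq0.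
  by rewrite /m /centroid /cross /= /GRing.scale /=; field.
have -> : (m |` [fset a; b])%fset = [fset m; a; b] by apply/fsetP => z; rewrite !inE orbA.
move: hx; rewrite hull3c // => -[h1 h2 h3]; have hs := bc_sumc x h.
rewrite (bc_repr x h) (bc_swap b).
set la := bc a b c x in r1 r2 h1 h2 h3 hs *; set lb := bc b c a x in r1 r2 h1 h2 h3 hs *.
set lc := bc c a b x in r1 r2 h1 h2 h3 hs *.
have -> : la *: a + lb *: b + lc *: c = (3 * lc) *: m + (la - lc) *: a + (lb - lc) *: b.
  by rewrite /m /centroid; plane_field.
have s1 : 3 * lc + (la - lc) + (lb - lc) = 1 by lra.
rewrite hull3 // bc_comb //; split; first by lra.
  rewrite [(3 * lc) *: m + _]addrC bc_comb //; [lra|exact: tri_swap|lra].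
rewrite addrC addrA bc_comb //; [lra|by apply/tri_rot/tri_rot|lra].
Qed.

Lemma near_side_total a b c x : [\/ near_side a b c x, near_side b c a x | near_side c a b x].
Proof.
rewrite /near_side; move: (bc a b c x) (bc b c a x) (bc c a b x) => u v w.
have [h12|h12] := leP u v; have [h13|h13] := leP u w; have [h23|h23] := leP v w;
  first [by constructor 1|by constructor 2; split=> //; lra|by constructor 3; split; lra|exfalso; lra].
Qed.

(** On the boundary between two parts the choice made by locate is
    immaterial, because both pieces have the same value and gradient there. *)
Lemma HCT_split_C1 a b c (c0 : broken R) : tri a b c -> let K := [fset a; b; c] in HCT K c0 ->
  let F e := c0 (part K e) in
  [/\ is_cubic (F [fset a; b]), is_cubic (F [fset b; c]), is_cubic (F [fset c; a])
    & split_C1 a b c (F [fset b; c]) (F [fset c; a]) (F [fset a; b])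
       (fun x => piece_at K c0 x x) (fun x => grad (piece_at K c0 x) x)].
Proof.
move=> h K [hp _ hc] F.
have hb := tri_rot h; have hca := tri_rot hb.
have eK1 : K = [fset b; c; a] by rewrite -fset3_rot.
have eK2 : K = [fset c; a; b] by rewrite fset3_rot.
have i1 : part K [fset a; b] \in hct_split K by apply: part_in; exact: edge_in.
have i2 : part K [fset b; c] \in hct_split K by apply: part_in; rewrite eK1; exact: edge_in.
have i3 : part K [fset c; a] \in hct_split K by apply: part_in; rewrite eK2; exact: edge_in.
have c1 := poly3_cubic (hp _ i1); have c2 := poly3_cubic (hp _ i2); have c3 := poly3_cubic (hp _ i3).
split=> // x hx.
have g1 : near_side c a b x -> hull (part K [fset a; b]) x by exact: hull_part.
have g2 : near_side a b c x -> hull (part K [fset b; c]) x.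
  by move=> r; have := @hull_part b c a x hb; rewrite -eK1; apply.
have g3 : near_side b c a x -> hull (part K [fset c; a]) x.
  by move=> r; have := @hull_part c a b x hca; rewrite -eK2; apply.
have [l1 l2] : locate (hct_split K) x \in hct_split K /\ hull (locate (hct_split K) x) x.
  apply: locateP; have [r|r|r] := near_side_total a b c x.
  - by exists (part K [fset b; c]) => //; exact: g2.
  - by exists (part K [fset c; a]) => //; exact: g3.
  - by exists (part K [fset a; b]) => //; exact: g1.
have U e : part K e \in hct_split K -> is_cubic (F e) -> hull (part K e) x ->
    piece_at K c0 x x = F e x /\ is_grad (F e) x (grad (piece_at K c0 x) x).
  move=> ie ce he; have [v1 v2] := hc _ _ x l1 ie l2 he.
  by rewrite /piece_at v1 v2; split=> //; exact: is_cubic_grad.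
by split=> r; apply: U => //; [exact: g2|exact: g3|exact: g1].
Qed.

Lemma piece_smooth a b c (c0 : broken R) x : tri a b c -> HCT [fset a; b; c] c0 -> hull [fset a; b; c] x ->
  is_cubic (piece_at [fset a; b; c] c0 x).
Proof.
move=> h hH hx; have [_ _ _ hp] := HCT_split_C1 h hH.
have [hp0 _ _] := hH; apply: poly3_cubic; apply: hp0.
apply: (proj1 (locateP _)).
have eK1 := fset3_rot a b c; have eK2 := esym (fset3_rot c a b).
have hb := tri_rot h; have hca := tri_rot hb.
have [r|r|r] := near_side_total a b c x.
- exists (part [fset b; c; a] [fset b; c]); first by rewrite eK1; apply: part_in; exact: (edge_in hb).
  by apply: hull_part => //; rewrite -eK1.
- exists (part [fset c; a; b] [fset c; a]); first by rewrite eK2; apply: part_in; exact: (edge_in hca).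
  by apply: hull_part => //; rewrite -eK2.
- exists (part [fset a; b; c] [fset a; b]); first by apply: part_in; exact: edge_in.
  exact: hull_part.
Qed.

Lemma split_C1_add a b c fa fb fc w G (B : plane R -> R) GB : split_C1 a b c fa fb fc w G ->
  (forall x, is_grad B x (GB x)) ->
  split_C1 a b c (fun x => fa x + B x) (fun x => fb x + B x) (fun x => fc x + B x)
    (fun x => w x + B x) (fun x => G x + GB x).
Proof.
move=> h hB x hx; have [h1 h2 h3] := h x hx.
split; [move/h1|move/h2|move/h3] => -[-> g]; split=> //; exact: is_gradD.
Qed.

Lemma split_C1_ext a b c fa fb fc w G fa' fb' fc' w' G' : split_C1 a b c fa fb fc w G ->
  fa =1 fa' -> fb =1 fb' -> fc =1 fc' -> (forall x, hull [fset a; b; c] x -> w x = w' x) ->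
  (forall x, hull [fset a; b; c] x -> G x = G' x) -> split_C1 a b c fa' fb' fc' w' G'.
Proof.
move=> h /funext <- /funext <- /funext <- hw hG x hx.
by have := h x hx; rewrite hw // hG.
Qed.

(** Simpson's rule is exact for the quadratic part, and the bubble part
    30 ((1 - t) t)^2 has integral 1. *)
Lemma edge_mean_simpson a b f n (k : R) (g : plane R -> R) : a != b -> is_cubic f ->
  (forall t, 0 <= t <= 1 -> g (a + t *: (b - a)) = dot (grad f (a + t *: (b - a))) n
      + k * (30 * ((1 - t) ^+ 2 * t ^+ 2))) ->
  edge_mean [fset a; b] g = (dot (grad f a) n + 4 * dot (grad f (2^-1 *: (a + b))) n
      + dot (grad f b) n) / 6 + k.
Proof.
move=> ab hf hg; rewrite /edge_mean /edge_end.
have gen u v : u != v ->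
  (forall t, 0 <= t <= 1 -> g (u + t *: (v - u)) = dot (grad f (u + t *: (v - u))) n
      + k * (30 * ((1 - t) ^+ 2 * t ^+ 2))) ->
  \int[lebesgue_measure]_(t in `[0%R, 1%R]) g (u + t *: (v - u)) =
    (dot (grad f u) n + 4 * dot (grad f (2^-1 *: (u + v))) n + dot (grad f v) n) / 6 + k.
  move=> uv huv; have [K hK] := cubic_frame hf u (v - u) n.
  have [_ _ h0] := hK 0 0; have [_ _ h1] := hK 1 0; have [_ _ h2] := hK 2^-1 0.
  have e0 : u + 0 *: (v - u) + 0 *: n = u by rewrite !scale0r !addr0.
  have e1 : u + 1 *: (v - u) + 0 *: n = v by rewrite scale0r scale1r addr0 addrC subrK.
  have e2 : u + 2^-1 *: (v - u) + 0 *: n = 2^-1 *: (u + v).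
    by plane_field.
  rewrite (@int01_poly R (K 0%N 1%N) (K 1%N 1%N) (K 2%N 1%N + 30 * k) (- (60 * k)) (30 * k)).
    rewrite e0 in h0; rewrite e1 in h1; rewrite e2 in h2.
    by rewrite h0 h1 h2 /cubt; field.
  move=> t ht; rewrite huv //.
  have [_ _] := hK t 0; rewrite scale0r addr0 => ->.
  by rewrite /cubt; ring.
have [->|->] /= := enum2_cases ab; first exact: gen.
have ba : b != a by rewrite eq_sym.
rewrite gen // ?[b + a]addrC.
  by congr (_ / _ + _); ring.
move=> t /andP[t0 t1]; have -> : b + t *: (a - b) = a + (1 - t) *: (b - a).
  by plane_ring.
rewrite hg; last by apply/andP; split; lra.
by congr (_ + k * (30 * _)); ring.
Qed.

End Companion.

Section CompanionTriangle.
Variable R : realType.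
Implicit Types (a b c m p q x y z : plane R) (f w : plane R -> R) (G : plane R -> plane R)
  (T E K S : simplex R).

Lemma edges_sum a b c (F : simplex R -> R) : tri a b c ->
  \sum_(E <- edges [fset a; b; c]) F E
  = F [fset a; b] + F [fset b; c] + F [fset c; a].
Proof. by move=> h; rewrite (perm_big _ (edges3 h)) /= !big_cons big_nil addr0 addrA. Qed.

Section Local.
Variables (nu : simplex R -> plane R) (v : broken R) (J1 : simplex R -> broken R) (K : simplex R).
Hypothesis hnu : unit_normals nu.
Hypothesis hv : is_quad (v K).
Hypothesis hH : HCT K (J1 K).
Hypothesis hmid : forall E, E \in edges K ->
  'D_(nu E) (piece_at K (J1 K) (mid E)) (mid E) = 'D_(nu E) (v K) (mid E).

Lemma normal_edge a b : a != b -> dot (nu [fset a; b]) (nu [fset a; b]) = 1 /\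
  dot (nu [fset a; b]) (b - a) = 0.
Proof.
move=> ab; have [|h1 h2] := hnu (E := [fset a; b]); first by rewrite cardfs2 ab.
split=> //; move: h2; rewrite /edge_end; have [->|->] := enum2_cases ab => //= h2.
by transitivity (- dot (nu [fset a; b]) (a - b)); [rewrite /dot /=; ring|rewrite h2 oppr0].
Qed.

Definition mean_defect E : R :=
  edge_mean E (fun y => 'D_(nu E) (fun t => v K t - piece_at K (J1 K) y t) y).
Definition height a b c : R := dot (c - a) (nu [fset a; b]).

Definition correction a b c := bubble_comb a b c (mean_defect [fset a; b]) (mean_defect [fset b; c]) (mean_defect [fset c; a])
  (height a b c) (height b c a) (height c a b).
Definition correction_grad a b c := bubble_comb_grad a b c (mean_defect [fset a; b]) (mean_defect [fset b; c]) (mean_defect [fset c; a])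
  (height a b c) (height b c a) (height c a b).

Lemma correction_is_grad a b c x : is_grad (correction a b c) x (correction_grad a b c x).
Proof. exact: bubble_comb_is_grad. Qed.

Let G1 x := grad (piece_at K (J1 K) x) x.
Let W2 := companion2 nu v J1 K.
Let G2 x := grad (piece_at K W2 x) x.

Section Frame.
Variables a b c : plane R.
Hypotheses (h : tri a b c) (eK : K = [fset a; b; c]).

Lemma companion2E S x : companion2 nu v J1 K S x = J1 K S x + correction a b c x.
Proof.
have -> : companion2 nu v J1 K S x = J1 K S x + \sum_(E <- edges K) mean_defect E * bubble nu E K x by [].
congr (_ + _).
have hb := tri_rot h; have hc := tri_rot hb.
have [n1 n2] := normal_edge (tri_neq h); have [n3 n4] := normal_edge (tri_neq hb).
have [n5 n6] := normal_edge (tri_neq hc).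
have b1 : bubble nu [fset a; b] K = edge_bubble a b c (height a b c) by rewrite eK; exact: bubbleE.
have b2 : bubble nu [fset b; c] K = edge_bubble b c a (height b c a).
  by rewrite eK (fset3_rot a); exact: bubbleE.
have b3 : bubble nu [fset c; a] K = edge_bubble c a b (height c a b).
  by rewrite eK -(fset3_rot c); exact: bubbleE.
have := edges_sum (fun E => mean_defect E * bubble nu E K x) h; rewrite -eK => ->.
by rewrite /correction /bubble_comb -b1 -b2 -b3.
Qed.

Lemma companion2_pieceE x : piece_at K W2 x = fun t => piece_at K (J1 K) x t + correction a b c t.
Proof. by apply: funext => t; rewrite /piece_at /W2 companion2E. Qed.

Let F e := J1 K (part K e).

Lemma companion1_cubics : [/\ is_cubic (F [fset a; b]), is_cubic (F [fset b; c]) & is_cubic (F [fset c; a])].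
Proof. by move: hH; rewrite /F eK => hH'; have [] := HCT_split_C1 h hH'. Qed.

Lemma companion1_split : split_C1 a b c (F [fset b; c]) (F [fset c; a]) (F [fset a; b])
  (fun x => piece_at K (J1 K) x x) G1.
Proof. by move: hH; rewrite /F /G1 eK => hH'; have [] := HCT_split_C1 h hH'. Qed.

Lemma companion1_cubic x : hull K x -> is_cubic (piece_at K (J1 K) x).
Proof. by move: hH; rewrite eK => hH' hx; exact: piece_smooth. Qed.

Lemma companion2_is_grad x : hull K x -> is_grad (piece_at K W2 x) x (G1 x + correction_grad a b c x).
Proof.
move=> hx; rewrite companion2_pieceE; apply: is_gradD; last exact: correction_is_grad.
exact: is_cubic_grad (companion1_cubic hx).
Qed.

Lemma companion2_gradE x : hull K x -> G2 x = G1 x + correction_grad a b c x.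
Proof. by move=> hx; rewrite /G2 (is_grad_grad (companion2_is_grad hx)). Qed.

Lemma companion2_derive x n : hull K x -> 'D_n (piece_at K W2 x) x = dot (G2 x) n.
Proof. by move=> hx; rewrite (is_grad_D _ (companion2_is_grad hx)) companion2_gradE. Qed.

Lemma companion2_split : split_C1 a b c (fun x => F [fset b; c] x + correction a b c x)
  (fun x => F [fset c; a] x + correction a b c x) (fun x => F [fset a; b] x + correction a b c x)
  (fun x => piece_at K W2 x x) G2.
Proof.
apply: (split_C1_ext (split_C1_add companion1_split (correction_is_grad a b c))) => // x hx.
  by rewrite companion2_pieceE.
by rewrite companion2_gradE // eK.
Qed.

Lemma edge_point (t : R) : 0 <= t <= 1 -> [/\ hull K (a + t *: (b - a)), near_side c a b (a + t *: (b - a)) &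
  [/\ bc a b c (a + t *: (b - a)) = 1 - t, bc b c a (a + t *: (b - a)) = t & bc c a b (a + t *: (b - a)) = 0]].
Proof.
move=> /andP[t0 t1]; have [e1 e2 e3] := bc_edge t h.
rewrite (bc_swap b) in e2; split=> //.
  by rewrite eK hull3c // e1 e2 e3; clear eK; split; lra.
by rewrite /near_side e1 e2 e3; clear eK; split; lra.
Qed.

Lemma companion1_trace (t : R) : 0 <= t <= 1 -> let x := a + t *: (b - a) in
  piece_at K (J1 K) x x = F [fset a; b] x /\ G1 x = grad (F [fset a; b]) x.
Proof.
move=> ht x; have [hx rx _] := edge_point ht.
rewrite eK in hx; have [_ _ /(_ rx)[v1 v2]] := companion1_split hx.
by rewrite v1 (is_grad_grad v2).
Qed.

Lemma mid_point : 2^-1 *: (a + b) = a + 2^-1 *: (b - a).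
Proof. by plane_field. Qed.

Lemma half01 : 0 <= (2^-1 : R) <= 1.
Proof. by apply/andP; clear eK; split; lra. Qed.

Let E := [fset a; b].
Let n := nu E.

Lemma E_edge : E \in edges K. Proof. by rewrite eK; exact: edge_in. Qed.

Lemma companion1_mid_normal : dot (grad (F E) (2^-1 *: (a + b))) n = dot (grad (v K) (2^-1 *: (a + b))) n.
Proof.
have := hmid E_edge; rewrite mid2 ?(tri_neq h) //.
have [hx _ _] := edge_point half01; rewrite -mid_point in hx.
rewrite (is_grad_D _ (is_cubic_grad _ (companion1_cubic hx))).
rewrite (is_grad_D _ (is_cubic_grad _ (is_quad_cubic hv))) => <-.
by have [_] := companion1_trace half01; rewrite -mid_point /G1 => ->.
Qed.

(** In Simpson's rule the midpoint does not contribute, because the normal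
    derivatives of v and J_1 v agree there. *)
Lemma mean_defectE : mean_defect E = (dot (grad (v K) a - grad (F E) a) n + dot (grad (v K) b - grad (F E) b) n) / 6.
Proof.
have [cF _ _] := companion1_cubics; have cv := is_quad_cubic hv.
have gB x : grad (fun x => v K x - F E x) x = grad (v K) x - grad (F E) x.
  by apply: is_grad_grad; apply: is_gradB; exact: is_cubic_grad.
rewrite /mean_defect (@edge_mean_simpson R a b (fun x => v K x - F E x) n 0) ?(tri_neq h) //; last 2 first.
- exact: is_cubicB.
- move=> t ht; rewrite mul0r addr0 gB.
  have [hx _ _] := edge_point ht; have [_ e2] := companion1_trace ht; rewrite -e2.
  by rewrite (is_grad_D _ (is_gradB (is_cubic_grad _ cv) (is_cubic_grad _ (companion1_cubic hx)))).
rewrite !gB addr0.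
have -> : dot (grad (v K) (2^-1 *: (a + b)) - grad (F E) (2^-1 *: (a + b))) n = 0.
  by rewrite dotB companion1_mid_normal subrr.
by rewrite mulr0 addr0.
Qed.

(** On an edge all bubbles vanish, and only the bubble of this edge has a
    normal derivative. *)
Lemma companion2_trace (t : R) : 0 <= t <= 1 -> let x := a + t *: (b - a) in
  piece_at K W2 x x = F E x /\
  dot (G2 x) n = dot (grad (F E) x) n + mean_defect E * (30 * ((1 - t) ^+ 2 * t ^+ 2)).
Proof.
move=> ht x; have [hx rx [xa xb xc]] := edge_point ht; have [e1 e2] := companion1_trace ht.
have [n1 n2] := normal_edge (tri_neq h).
have k := bcl_normal h n1 n2; rewrite -/(height a b c) in k.
have [b1 b2] := bubble_comb_edge (mean_defect E) (mean_defect [fset b; c]) (mean_defect [fset c; a]) (height a b c) (height b c a) (height c a b) n xc.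
split; first by rewrite companion2_pieceE e1 /correction b1 addr0.
rewrite companion2_gradE // e2 [dot (_ + _) _](_ : _ = dot (grad (F E) x) n + dot (correction_grad a b c x) n).
  by rewrite /correction_grad b2 k mulr1 xa xb.
by rewrite /dot /=; ring.
Qed.

(** The bubbles restore the means of the normal derivatives, which J_1 keeps
    at the midpoints only. *)
Lemma companion2_mean : edge_mean E (fun x => 'D_n (piece_at K W2 x) x) = 'D_n (v K) (2^-1 *: (a + b)).
Proof.
have [cF _ _] := companion1_cubics.
rewrite (@edge_mean_simpson R a b (F E) n (mean_defect E)) ?(tri_neq h) //; last first.
  move=> t ht; have [hx _ _] := edge_point ht; have [_ e2] := companion2_trace ht.
  by rewrite companion2_derive.
rewrite mean_defectE companion1_mid_normal (is_grad_D _ (is_cubic_grad _ (is_quad_cubic hv))).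
have q := quad_ends a b n hv.
have e (X Y : plane R) : dot (X - Y) n = dot X n - dot Y n by rewrite /dot /=; ring.
rewrite !e; set u1 := dot (grad (v K) a) n in q *; set u2 := dot (grad (v K) b) n in q *.
have -> : u1 = 2 * dot (grad (v K) (2^-1 *: (a + b))) n - u2 by rewrite -q; ring.
by field.
Qed.

End Frame.
End Local.
End CompanionTriangle.

(** * The distance of the companion from the quadratic *)

Section Estimates.
Variable R : realType.
Implicit Types (a b c m p q s x y z : plane R) (f w : plane R -> R) (G : plane R -> plane R)
  (T E K S : simplex R).

Lemma unit_comp n : dot n n = 1 :> R -> `|n.1| <= 1 /\ `|n.2| <= 1.
Proof. by move=> h; have := enorm_comp n; rewrite /enorm h sqrtr1. Qed.

Lemma unit_n1 n : dot n n = 1 :> R -> n1 n <= 2.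
Proof. by move=> /unit_comp [h1 h2]; rewrite /n1; lra. Qed.

Lemma dotC p q : dot p q = dot q p.
Proof. by rewrite /dot; ring. Qed.

Lemma avg6 (u w g : R) : `|u| <= 2 * g -> `|w| <= 2 * g -> `|(u + w) / 6| <= g.
Proof.
by rewrite !ler_norml => /andP[? ?] /andP[? ?]; apply/andP; split; lra.
Qed.

Lemma twice_diff_le (X Y Z k : R) : `|X - Z| <= 4 * k -> `|Y - Z| <= 4 * k ->
  `|2 * (X - Y)| <= 16 * k.
Proof.
by rewrite !ler_norml => /andP[? ?] /andP[? ?]; apply/andP; split; lra.
Qed.

Lemma lip_on_ext a b c G (G' : plane R -> plane R) (L : R) :
  (forall z, hull [fset a; b; c] z -> G z = G' z) -> lip_on a b c G L -> lip_on a b c G' L.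
Proof. by move=> e h x y hx hy; rewrite -!e //; exact: h. Qed.

Section Local.
Variables (nu : simplex R -> plane R) (v : broken R) (J1 : simplex R -> broken R) (K : simplex R).
Hypothesis hnu : unit_normals nu.
Hypothesis hv : is_quad (v K).
Hypothesis hH : HCT K (J1 K).
Hypothesis hmid : forall E, E \in edges K ->
  'D_(nu E) (piece_at K (J1 K) (mid E)) (mid E) = 'D_(nu E) (v K) (mid E).
Hypothesis hval : forall z, z \in K -> piece_at K (J1 K) z z = v K z.

Let G1 x := grad (piece_at K (J1 K) x) x.
Let W2 := companion2 nu v J1 K.
Let G2 x := grad (piece_at K W2 x) x.

Variables (r D Gam : R).
Hypothesis hG : forall z, z \in K -> `|(G1 z - grad (v K) z).1| <= Gam /\ `|(G1 z - grad (v K) z).2| <= Gam.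

Section Frame.
Variables a b c : plane R.
Hypotheses (h : tri a b c) (eK : K = [fset a; b; c]).
Hypothesis hfat : fat K r D.

Let ia : a \in K. Proof. by rewrite eK !inE eqxx. Qed.
Let ib : b \in K. Proof. by rewrite eK !inE eqxx orbT. Qed.
Let ic : c \in K. Proof. by rewrite eK !inE eqxx orbT. Qed.

Lemma height_le : `|height nu a b c| <= D * r.
Proof.
have [n1' n2'] := normal_edge hnu (tri_neq h); have [u1 u2] := unit_comp n1'.
rewrite /height dotC; apply: le_trans (dot_n1 _ u1 u2) _; rewrite mul1r.
by case: hfat => _ _; apply; apply: hull_vertex; [exact: ic|exact: ia].
Qed.

Lemma mean_defect_le : `|mean_defect nu v J1 K [fset a; b]| <= Gam.
Proof.
have [n1' n2'] := normal_edge hnu (tri_neq h); have un := unit_n1 n1'.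
rewrite (mean_defectE hv hH hmid h eK).
have z01 : 0 <= (0 : R) <= 1 by rewrite lexx ler01.
have o01 : 0 <= (1 : R) <= 1 by rewrite lexx ler01.
have [_] := companion1_trace hH h eK z01; have [_] := companion1_trace hH h eK o01.
rewrite scale0r scale1r addr0 [a + (b - a)]addrC subrK => <- <-.
set n := nu _ in un *.
have k z : z \in K -> `|dot (grad (v K) z - G1 z) n| <= 2 * Gam.
  move=> zK; have [g1 g2] := hG zK.
  have -> : dot (grad (v K) z - G1 z) n = - dot (G1 z - grad (v K) z) n.
    by rewrite !dotB opprB.
  rewrite normrN; apply: le_trans (dot_n1 _ g1 g2) _.
  by rewrite mulrC ler_wpM2r //; apply: le_trans g1.
move: (k a ia) (k b ib).
exact: avg6.
Qed.

Lemma flat_edge : flat_mid (fun x => J1 K (part K [fset a; b]) x - v K x) a b.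
Proof.
have [n1' n2'] := normal_edge hnu (tri_neq h).
have [cF _ _] := companion1_cubics hH h eK.
exists (nu [fset a; b]); split=> //.
rewrite (is_grad_grad (is_gradB (is_cubic_grad _ cF) (is_cubic_grad _ (is_quad_cubic hv)))).
by rewrite dotB (companion1_mid_normal hv hH hmid h eK) subrr.
Qed.

End Frame.

(** J_1 v - v is a Hsieh-Clough-Tocher function with zero vertex values and
    zero normal derivatives at the midpoints, and the coefficients of the
    bubbles are bounded by Gam. *)
Lemma companion2_lip a b c : tri a b c -> K = [fset a; b; c] -> fat K r D ->
  lip_on a b c (fun x => G2 x - grad (v K) x) (1850 * D * Gam / r).
Proof.
move=> h eK hfat.
have hb := tri_rot h; have hc := tri_rot hb.
have eb : K = [fset b; c; a] by rewrite -fset3_rot.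
have ec : K = [fset c; a; b] by rewrite fset3_rot.
have [c1 c2 c3] := companion1_cubics hH h eK; have cv := is_quad_cubic hv.
have [r0 _ _] := hfat.
have hfat' := hfat; rewrite eK in hfat'.
pose F e x := J1 K (part K e) x - v K x.
have pw : split_C1 a b c (F [fset b; c]) (F [fset c; a]) (F [fset a; b])
    (fun x => piece_at K (J1 K) x x - v K x) (fun x => G1 x - grad (v K) x).
  move=> x hx; have [p1 p2 p3] := companion1_split hH h eK hx.
  by split; [move/p1|move/p2|move/p3] => -[-> g]; split=> //; apply: is_gradB => //; exact: is_cubic_grad.
have Z : [/\ piece_at K (J1 K) a a - v K a = 0, piece_at K (J1 K) b b - v K b = 0 & piece_at K (J1 K) c c - v K c = 0].
  by split; rewrite hval ?subrr // eK !inE eqxx ?orbT.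
have L1 := hct_grad_lip h hfat' (is_cubicB c2 cv) (is_cubicB c3 cv) (is_cubicB c1 cv) pw Z.
have {}L1 : lip_on a b c (fun x => G1 x - grad (v K) x) (1400 * (Gam * (D * r)) / r ^+ 2).
  apply: L1; first by rewrite -eK.
  - exact: (flat_edge h eK).
  - exact: (flat_edge hb eb).
  - exact: (flat_edge hc ec).
have L2 := bubble_comb_grad_lip h hfat' (height_le h eK hfat) (height_le hb eb hfat) (height_le hc ec hfat)
  (mean_defect_le h eK) (mean_defect_le hb eb) (mean_defect_le hc ec).
have L := lip_on_add L1 L2.
have e : 1400 * (Gam * (D * r)) / r ^+ 2 + 450 * D * Gam / r = 1850 * D * Gam / r.
  by field; rewrite gt_eqF.
rewrite e in L; apply: lip_on_ext L => z.
have q : hull [fset a; b; c] z -> G2 z - grad (v K) z = G1 z - grad (v K) z + correction_grad nu v J1 K a b c z.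
  by rewrite -{1}eK => hz; rewrite /G2 (companion2_gradE v hnu hH h eK hz) addrAC.
by move=> hz; exact: esym (q hz).
Qed.

Lemma companion2_taylor a b c : tri a b c -> K = [fset a; b; c] -> fat K r D ->
  forall x y, hull K x -> hull K y ->
  `|(piece_at K W2 y y - v K y) - (piece_at K W2 x x - v K x) - dot (G2 x - grad (v K) x) (y - x)|
    <= 1850 * D * Gam / r * n1 (y - x) ^+ 2.
Proof.
move=> h eK hfat x y hx hy; have L := companion2_lip h eK hfat.
have cv := is_quad_cubic hv.
pose F e x := J1 K (part K e) x + correction nu v J1 K a b c x - v K x.
have pw : split_C1 a b c (F [fset b; c]) (F [fset c; a]) (F [fset a; b])
    (fun x => piece_at K W2 x x - v K x) (fun x => G2 x - grad (v K) x).
  move=> z hz; have [p1 p2 p3] := companion2_split v hnu hH h eK hz.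
  by split; [move/p1|move/p2|move/p3] => -[-> g]; split=> //; apply: is_gradB => //; exact: is_cubic_grad.
have [r0 _ hd] := hfat; have [a' aK] : exists z, z \in K by exists a; rewrite eK !inE eqxx.
have [g1 _] := hG aK; have G0 : 0 <= Gam by apply: le_trans g1.
have D0 : 0 <= D.
  by rewrite -(pmulr_lge0 _ r0); apply: le_trans (hd x x hx hx); exact: n1_ge0.
have B0 : 0 <= 1850 * D * Gam / r.
  apply: divr_ge0; last exact: ltW.
  by apply: mulr_ge0; [apply: mulr_ge0; [exact: ler0n|exact: D0]|exact: G0].
have hx' := hx; have hy' := hy; rewrite eK in hx' hy'.
exact: (split_C1_taylor h B0 pw L hx' hy').
Qed.

End Local.

Section Fine.
Variables (T K : simplex R) (nu : simplex R -> plane R) (g d : plane R -> R) (Gd : plane R -> plane R) (r D L : R).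
Hypothesis hnu : unit_normals nu.
Hypothesis hg : is_quad g.
Hypothesis hT : triangle T.
Hypothesis hfat : fat T r D.
Hypothesis L0 : 0 <= L.
Hypothesis hlip : forall x y, hull T x -> hull T y ->
  `|(Gd y).1 - (Gd x).1| <= L * n1 (y - x) /\ `|(Gd y).2 - (Gd x).2| <= L * n1 (y - x).
Hypothesis htay : forall x y, hull T x -> hull T y -> `|d y - d x - dot (Gd x) (y - x)| <= L * n1 (y - x) ^+ 2.
Hypothesis gval : forall z, z \in T -> g z = d z.
Hypothesis gmean : forall E, E \in edges T ->
  'D_(nu E) g (mid E) = edge_mean E (fun x => dot (Gd x) (nu E)).

(** The normal component of the gradient of g at the midpoint is a mean of
    that of Gd, and the tangential component is a difference quotient of d. Both
    are close to Gd p, because Gd oscillates little on T. *)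
Lemma edge_gradient_close p q : p \in T -> q \in T -> p != q ->
  let X := grad g (2^-1 *: (p + q)) - Gd p in
  `|X.1| <= 4 * L * (D * r) /\ `|X.2| <= 4 * L * (D * r).
Proof.
move=> pT qT pq X; set e := [fset p; q].
have [n1' n2'] := normal_edge hnu pq; have un := unit_n1 n1'.
have hp := hull_vertex pT; have hq := hull_vertex qT.
have [r0 _ hd] := hfat; set rho := D * r in hd *.
have rho0 : 0 <= rho by apply: le_trans (hd p p hp hp); exact: n1_ge0.
have eT : e \in edges T.
  apply/edgesP; split; last by rewrite cardfs2 pq.
  by apply/fsubsetP => z; rewrite !inE => /orP[] /eqP ->.
have Gdot x y : hull T x -> hull T y -> `|dot (Gd y - Gd x) (nu e)| <= 2 * L * n1 (y - x).
  move=> hx hy; have [l1 l2] := hlip hx hy.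
  apply: le_trans (@dot_n1 R (nu e) (Gd y - Gd x) _ l1 l2) _.
  by rewrite mulrC mulrA ler_wpM2r ?n1_ge0 // ler_wpM2r.
have N : `|dot X (nu e)| <= 2 * L * rho.
  rewrite /X dotB; have := gmean eT; rewrite mid2 // (is_grad_D _ (is_cubic_grad _ (is_quad_cubic hg))) => ->.
  rewrite /edge_mean.
  have seg : [/\ hull T (edge_end e 0), hull T (edge_end e 1) & True].
    by rewrite /edge_end; have [->|->] := enum2_cases pq.
  have [h0 h1 _] := seg.
  have inT (t : R) : 0 <= t <= 1 -> hull T (edge_end e 0 + t *: (edge_end e 1 - edge_end e 0)).
    by move=> ht; exact: hull_convex.
  apply: (@int01_near R _ (2 * L * n1 (edge_end e 1 - edge_end e 0))).
    move=> u t hu ht; rewrite -dotB; apply: le_trans (Gdot _ _ (inT _ ht) (inT _ hu)) _.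
    by rewrite line_diff n1Z mulrA [2 * L * _ * _]mulrAC.
  move=> t ht; rewrite -dotB; apply: le_trans (Gdot _ _ hp (inT _ ht)) _.
  by apply: ler_wpM2l; [exact: mulr_ge0|apply: hd; [exact: inT|exact: hp]].
have Tg : `|dot X (q - p)| <= 2 * L * rho * enorm (q - p).
  have := htay hp hq; rewrite -!gval // quad_mid // -dotB -/X => h.
  apply: le_trans h _; have k1 := hd q p hq hp; have k2 := n1_le (q - p).
  have : n1 (q - p) ^+ 2 <= rho * (2 * enorm (q - p)) by rewrite expr2 ler_pM // n1_ge0.
  move/(ler_wpM2l L0); rewrite (_ : L * (rho * _) = 2 * L * rho * enorm (q - p)) //; ring.
have [X1 X2] := normal_frame X n1' n2'.
have e0 : 0 < enorm (q - p).
  rewrite sqrtr_gt0; apply: dot_gt0; by rewrite subr_eq0 eq_sym.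
have fin (u : R) : enorm (q - p) * u <= enorm (q - p) * `|dot X (nu e)| + `|dot X (q - p)| -> u <= 4 * L * rho.
  move=> hu; rewrite -(ler_pM2l e0); apply: le_trans hu _.
  have := ler_wpM2l (ltW e0) N; move: Tg; set ee := enorm _.
  rewrite (_ : ee * (4 * L * rho) = ee * (2 * L * rho) + 2 * L * rho * ee); last by ring.
  by move=> t1 t2; exact: lerD.
by split; apply: fin.
Qed.

(** The gradients of g at the midpoints of two edges with a common vertex
    differ by the Hessian applied to half of the third edge, and both are close
    to the value of Gd at the vertex. The size of T cancels. *)
Lemma interpolant_hess_bound (i j : 'I_2) x : `|hess g x i j| <= 16 * L * D.
Proof.
have [p [q [s [eT h]]]] := hT.
have {}h : tri p q s by [].
have hq := tri_rot h; have hs := tri_rot hq.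
have ip : p \in T by rewrite eT !inE eqxx.
have iq : q \in T by rewrite eT !inE eqxx orbT.
have is' : s \in T by rewrite eT !inE eqxx orbT.
have [r0 _ hd] := hfat; have rn : r != 0 by rewrite gt_eqF.
have [H [HE Hd]] := quad_hess hg; rewrite HE.
have pq := tri_neq h; have qs := tri_neq hq; have sp := tri_neq hs.
pose Hv (l : 'I_2) (y : plane R) := H l 0 * y.1 + H l 1 * y.2.
have pair u y z : u \in T -> y \in T -> z \in T -> u != y -> u != z ->
    forall l, `|Hv l (y - z)| <= 16 * L * (D * r).
  move=> uT yT zT uy uz l.
  have [a1 a2] := edge_gradient_close uT yT uy; have [b1 b2] := edge_gradient_close uT zT uz.
  have [d1 d2] := Hd (2^-1 *: (u + y)) (2^-1 *: (u + z)).
  have E1 : Hv 0 (y - z) = 2 * (grad g (2^-1 *: (u + y)) - grad g (2^-1 *: (u + z))).1.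
    by rewrite d1 /Hv /= /GRing.scale /=; field.
  have E2 : Hv 1 (y - z) = 2 * (grad g (2^-1 *: (u + y)) - grad g (2^-1 *: (u + z))).2.
    by rewrite d2 /Hv /= /GRing.scale /=; field.
  have fin (X Y Z : R) : `|X - Z| <= 4 * L * (D * r) -> `|Y - Z| <= 4 * L * (D * r) ->
      `|2 * (X - Y)| <= 16 * L * (D * r).
    by rewrite -!mulrA; exact: twice_diff_le.
  case: (ord2 l) => ->.
    by rewrite E1; exact: fin a1 b1.
  by rewrite E2; exact: fin a2 b2.
have hfat' := hfat; rewrite eT in hfat'.
have key l z : n1 z = 1 -> `|Hv l z| <= 16 * L * D.
  move=> z1.
  have t1 := bcl_small z hq (fat_rot hfat'); have t2 := bcl_small z hs (fat_rot (fat_rot hfat')).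
  rewrite z1 mul1r in t1 t2.
  have k1 := pair s q p is' iq ip (_ : s != q) sp l; have k2 := pair q s p iq is' ip qs (_ : q != p) l.
  rewrite eq_sym qs in k1; rewrite eq_sym pq in k2; have {}k1 := k1 isT; have {}k2 := k2 isT.
  have -> : Hv l z = bcl q s p z * Hv l (q - p) + bcl s p q z * Hv l (s - p).
    have ez : z = bcl q s p z *: (q - p) + bcl s p q z *: (s - p).
      have e1 := bc_repr (p + z) h; have e2 := bc_sumc (p + z) h.
      have e3 := bcB q s p (p + z) p; have e4 := bcB s p q (p + z) p.
      rewrite bc_other2 subr0 in e3; rewrite bc_other subr0 in e4.
      rewrite [p + z]addrC addrK in e1 e2 e3 e4.
      rewrite -e3 -e4; rewrite (bc_swap q) in e1.
      have e5 : bc p q s (z + p) = 1 - bc q s p (z + p) - bc s p q (z + p) by rewrite -e2; ring.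
      rewrite e5 in e1; rewrite -[LHS](addrK p) {1}e1.
      by plane_ring.
    by rewrite {1}ez /Hv /= /GRing.scale /=; ring.
  apply: le_trans (ler_normD _ _) _.
  have e : 16 * L * D = (2 * r)^-1 * (16 * L * (D * r)) + (2 * r)^-1 * (16 * L * (D * r)) by field.
  by rewrite [leRHS]e; apply: lerD; rewrite normrM; apply: ler_pM.
case: (ord2 j) => ->.
  have := key i (1, 0); rewrite /Hv /= mulr1 mulr0 addr0; apply.
  by rewrite /n1 /= normr1 normr0 addr0.
have := key i (0, 1); rewrite /Hv /= mulr1 mulr0 add0r; apply.
by rewrite /n1 /= normr1 normr0 add0r.
Qed.

End Fine.
End Estimates.

(** * Coarse and fine edges *)

Section Pure.
Variable R : realType.
Implicit Types (a b c p q x y z n : plane R) (f : plane R -> R) (T E K S : simplex R).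

(** Hermite interpolation along the edge: the trace is a cubic, given by
    values and slopes at the ends, and the normal derivative is a quadratic,
    given by its values at the ends and at the midpoint. *)
Lemma cubic_edge_eq f g a b n (t : R) : is_cubic f -> is_cubic g ->
  f a = g a -> f b = g b -> grad f a = grad g a -> grad f b = grad g b ->
  dot (grad f (2^-1 *: (a + b))) n = dot (grad g (2^-1 *: (a + b))) n ->
  f (a + t *: (b - a)) = g (a + t *: (b - a)) /\
  dot (grad f (a + t *: (b - a))) n = dot (grad g (a + t *: (b - a))) n.
Proof.
move=> hf hg ea eb ga gb gm.
have [k hk] := cubic_frame hf a (b - a) n; have [k' hk'] := cubic_frame hg a (b - a) n.
have e0 : a + 0 *: (b - a) + 0 *: n = a by rewrite !scale0r !addr0.
have e1 : a + 1 *: (b - a) + 0 *: n = b by rewrite scale0r scale1r addr0 addrC subrK.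
have e2 : a + 2^-1 *: (b - a) + 0 *: n = 2^-1 *: (a + b).
  by plane_field.
have et u : a + u *: (b - a) + 0 *: n = a + u *: (b - a) by rewrite scale0r addr0.
have [z1 z2 z3] := hk 0 0; have [y1 y2 y3] := hk 1 0; have [_ _ m3] := hk 2^-1 0.
have [z1' z2' z3'] := hk' 0 0; have [y1' y2' y3'] := hk' 1 0; have [_ _ m3'] := hk' 2^-1 0.
have [t1 _ t3] := hk t 0; have [t1' _ t3'] := hk' t 0.
rewrite et in t1 t3 t1' t3'; rewrite t1 t3 t1' t3'.
rewrite e0 in z1' z2' z3'; rewrite e1 in y1' y2' y3'; rewrite e2 in m3'.
rewrite e0 ea z1' in z1; rewrite e1 eb y1' in y1; rewrite e0 ga z2' in z2; rewrite e1 gb y2' in y2.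
rewrite e0 ga z3' in z3; rewrite e1 gb y3' in y3; rewrite e2 gm m3' in m3.
move: z1 z2 z3 y1 y2 y3 m3; rewrite /cubf /cubs /cubt.
rewrite !(expr0n, expr1n, mulr0, mul0r, mulr1, mul1r, addr0, add0r) /=.
move: (k 0%N 0%N) (k' 0%N 0%N) (k 1%N 0%N) (k' 1%N 0%N) (k 2%N 0%N) (k' 2%N 0%N) (k 3%N 0%N) (k' 3%N 0%N).
move: (k 0%N 1%N) (k' 0%N 1%N) (k 1%N 1%N) (k' 1%N 1%N) (k 2%N 1%N) (k' 2%N 1%N).
clear => u1 u1' u2 u2' u3 u3' w0 w0' w1 w1' w2 w2' w3 w3' z1 z2 z3 y1 y2 y3 m3.
have -> : w0 = w0' by lra.
have -> : w1 = w1' by lra.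
have -> : w2 = w2' by lra.
have -> : w3 = w3' by lra.
have -> : u1 = u1' by lra.
have -> : u2 = u2' by lra.
have -> : u3 = u3' by lra.
by [].
Qed.

Lemma grad_mid_eq f g a b n : a != b -> is_quad f -> is_quad g -> dot n n = 1 -> dot n (b - a) = 0 ->
  f a = g a -> f b = g b ->
  dot (grad f (2^-1 *: (a + b))) n = dot (grad g (2^-1 *: (a + b))) n ->
  grad f (2^-1 *: (a + b)) = grad g (2^-1 *: (a + b)).
Proof.
move=> ab hf hg n1' n2' ea eb en; set m := 2^-1 *: (a + b) in en *.
have [x1 x2] := normal_frame (grad f m - grad g m) n1' n2'.
have e0 : 0 < enorm (b - a) by rewrite sqrtr_gt0; apply: dot_gt0; rewrite subr_eq0 eq_sym.
have d1 : dot (grad f m - grad g m) n = 0 by rewrite dotB en subrr.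
have d2 : dot (grad f m - grad g m) (b - a) = 0 by rewrite dotB -!quad_mid // ea eb subrr.
rewrite d1 d2 normr0 mulr0 addr0 (pmulr_rle0 _ e0) normr_le0 subr_eq0 in x1.
rewrite d1 d2 normr0 mulr0 addr0 (pmulr_rle0 _ e0) normr_le0 subr_eq0 in x2.
by apply: plane_eq; apply/eqP.
Qed.

Lemma edge_mean_ext E f g : #|` E| = 2%N -> (forall x, hull E x -> f x = g x) ->
  edge_mean E f = edge_mean E g.
Proof.
move=> cE h; rewrite /edge_mean; apply: eq_Rintegral => t; rewrite inE /= in_itv /= => ht.
apply: h; have [a [b [eE ab]]] := edge2 cE; rewrite {1}eE hull2 //.
rewrite /edge_end eE; have [->|->] := enum2_cases ab => /=; first by exists t.
exists (1 - t); split; first by move: ht => /andP[? ?]; clear eE; apply/andP; split; lra.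
by plane_ring.
Qed.

Lemma edge_mean0 E : #|` E| = 2%N -> edge_mean E (fun=> 0) = 0 :> R.
Proof.
by move=> _; rewrite /edge_mean (@int01_poly R 0 0 0 0 0) => [|t _]; rewrite ?mul0r ?addr0.
Qed.

Lemma cubic0 : is_cubic (fun=> 0 : R).
Proof. by exists (fun _ _ => 0) => x; rewrite /cubf !mul0r !addr0. Qed.

Lemma grad0 x : grad (fun=> 0 : R) x = 0.
Proof. by rewrite (is_grad_grad (is_grad_cst 0 x)). Qed.

Lemma dot0l n : dot 0 n = 0 :> R.
Proof. by rewrite /dot /= !mul0r addr0. Qed.

Lemma bary0_line a b c x : tri a b c -> bc c a b x = 0 -> x = a + bc b a c x *: (b - a).
Proof.
move=> h h0; have hs := bc_sum x h; rewrite {1}(bc_repr x h) h0.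
have -> : bc a b c x = 1 - bc b a c x by rewrite -hs h0; ring.
by plane_ring.
Qed.

Lemma hull_sub T E x : triangle T -> (E `<=` T)%fset -> hull E x -> hull T x.
Proof. by move=> hT s; rewrite (tri_face x hT s) tri_hull // => -[]. Qed.

Lemma triangle_third K c : triangle K -> c \in K -> exists a b, K = [fset a; b; c] /\ tri a b c.
Proof.
move=> hK cK; have [a [b [e h]]] := triangle_vertex hK cK; exists a, b.
by rewrite e fset3_rot; split=> //; exact: tri_rot.
Qed.

Lemma parallel_normal n n' (e : plane R) : dot n n = 1 -> dot n e = 0 -> dot n' e = 0 -> e != 0 ->
  n' = dot n' n *: n.
Proof.
move=> h1 h2 h3 e0; have := @proj_normal R n e n' h1 h2; rewrite h3 mul0r scale0r subr0.
by apply; rewrite gt_eqF // dot_gt0.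
Qed.

End Pure.

Section FineCoarse.
Variable R : realType.
Implicit Types (a b c p q x y z n : plane R) (f : plane R -> R) (T E K S : simplex R).
Variables (Om : set (plane R)) (TT That : mesh R).
Hypothesis regT : regular_triangulation Om TT.
Hypothesis regH : regular_triangulation Om That.

Lemma mesh_edgeP (TT' : mesh R) E : E \in mesh_edges TT' <-> exists2 T, T \in TT' & E \in edges T.
Proof.
rewrite /mesh_edges; split.
  by move/bigfcupP => [T /andP[hT _] eT]; exists T.
by move=> [T hT eT]; apply/bigfcupP; exists T => //; rewrite hT.
Qed.

(** A regular triangulation has no hanging vertices. *)
Lemma fine_vertex T z E : T \in That -> z \in T -> E \in mesh_edges That -> hull E z -> z \in E.
Proof.
move=> hT zT /mesh_edgeP [T' hT' eT'] hz.
have [sE _] := edgesP _ _ eT'; have tT := reg_tri regH hT; have tT' := reg_tri regH hT'.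
have z' : hull T' z by exact: hull_sub hz.
have zT' : z \in T'.
  apply: contraT => nz; have := reg_face0 regH hT hT' (hull_vertex zT) z' zT nz.
  by rewrite bary_vertex // eqxx => /eqP; rewrite oner_eq0.
apply: contraT => nz; move: hz; rewrite (tri_face z tT' sE) => -[_ /(_ z zT' nz)].
by rewrite bary_vertex // eqxx => /eqP; rewrite oner_eq0.
Qed.

Lemma fine_edge_eq T E E' : T \in That -> E' \in edges T -> E \in mesh_edges That ->
  (forall z, z \in E' -> hull E z) -> E' = E.
Proof.
move=> hT /edgesP [s c'] hE h.
have cE : #|` E| = 2%N by move/mesh_edgeP: hE => [T' _ /edgesP []].
apply/eqP; rewrite eqEfcard cE c' leqnn andbT; apply/fsubsetP => z zE.
by apply: (fine_vertex hT _ hE (h z zE)); apply: (fsubsetP s).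
Qed.

Lemma not_fine_refined K E : K \in TT -> E \in edges K -> E \notin mesh_edges That ->
  E \in refined_edges TT That.
Proof. by move=> hK eK nE; rewrite /refined_edges inE nE; apply/mesh_edgeP; exists K. Qed.

Lemma face_split K K' : K \in TT -> K' \in TT -> K <> K' ->
  exists c, c \in K /\ c \notin K'.
Proof.
move=> hK hK' ne; apply: contrapT => hn; apply: ne; apply: (card_sub_eq regT hK hK').
by apply/fsubsetP => c cK; apply: contraT => nc; case: hn; exists c.
Qed.

Lemma shared_inter K K' a b c : K \in TT -> K' \in TT -> tri a b c -> K = [fset a; b; c] ->
  c \notin K' -> a \in K' -> b \in K' -> (K `&` K')%fset = [fset a; b] /\ [fset a; b] \in edges K'.
Proof.
move=> hK hK' h eK nc aK' bK'; split.
  apply/fsetP => z; rewrite eK !inE; have [->|] := eqVneq z a; first by rewrite aK'.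
  have [->|] := eqVneq z b; first by rewrite bK'.
  by have [->|] //= := eqVneq z c; rewrite (negbTE nc).
apply/edgesP; split; last by rewrite cardfs2 (tri_neq h).
by apply/fsubsetP => z; rewrite !inE => /orP[] /eqP ->.
Qed.

Lemma side_patch_sub (EE : {fset simplex R}) K K' z : K' \in TT -> z \in K' -> (K' `&` K)%fset \in EE ->
  (side_patch EE TT K z `<=` side_patch EE TT K' z)%fset.
Proof.
move=> hK' zK' hE; apply/fsubsetP => T; rewrite !inE => /andP[hT /asboolP [s [h1 h2 h3]]].
rewrite hT /=; apply/asboolP; exists (K :: s); split=> //=.
  move=> T'; rewrite inE => /predU1P[->//|]; exact: h1.
by rewrite hE.
Qed.

(** Side-connectivity at z is an equivalence relation. *)
Lemma side_patch_eq (EE : {fset simplex R}) K K' z : K \in TT -> z \in K -> K' \in TT -> z \in K' ->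
  (K `&` K')%fset \in EE -> side_patch EE TT K z = side_patch EE TT K' z.
Proof.
move=> hK zK hK' zK' hE; apply/eqP; rewrite eqEfsubset !side_patch_sub //.
by rewrite fsetIC.
Qed.

Lemma side_patch_self (EE : {fset simplex R}) K z : K \in TT -> z \in K -> K \in side_patch EE TT K z.
Proof.
move=> hK zK; rewrite !inE hK /=; apply/asboolP; exists [::]; split=> //= T'.
by rewrite inE => /eqP ->.
Qed.

End FineCoarse.

(** * The interpolant is a Morley function *)

Lemma dotZr (R : realType) (x : plane R) (k : R) (n : plane R) : dot x (k *: n) = k * dot x n.
Proof. by rewrite /dot /= /GRing.scale /=; ring. Qed.

Lemma mid_between (R : realType) (t s : R) : 0 <= t <= 1 -> 0 <= s <= 1 -> t <> s ->
  0 < (t + s) / 2 < 1.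
Proof.
move=> /andP[? ?] /andP[? ?] ne; have [tls|stl|//] := ltgtP t s; apply/andP; split; lra.
Qed.

Section MorleyFine.
Variable R : realType.
Implicit Types (a b c p q x y z n : plane R) (f : plane R -> R) (T E K S : simplex R).
Variables (Om : set (plane R)) (TT That : mesh R) (nu : simplex R -> plane R).
Variables (v : broken R) (J1 : simplex R -> broken R).
Hypothesis regT : regular_triangulation Om TT.
Hypothesis regH : regular_triangulation Om That.
Hypothesis hnu : unit_normals nu.
Hypothesis oO : open Om.
Hypothesis hL : lipschitz_boundary Om.
Hypothesis hmor : morley Om TT v.
Hypothesis hJ : companion1 (zero_patch Om TT That) TT That nu v J1.

Let EE := refined_edges TT That.
Let W2 := companion2 nu v J1.
Let G1 K x := grad (piece_at K (J1 K) x) x.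
Let G2 K x := grad (piece_at K (W2 K) x) x.
Let w K x := piece_at K (W2 K) x x.

Lemma quadK K : K \in TT -> is_quad (v K).
Proof. by move=> hK; case: hmor => h _ _ _ _; exact/poly2_quad/h. Qed.
Lemma hctK K : K \in TT -> HCT K (J1 K).
Proof. by move=> hK; case: (hJ hK). Qed.
Lemma midK K : K \in TT -> forall E, E \in edges K ->
  'D_(nu E) (piece_at K (J1 K) (mid E)) (mid E) = 'D_(nu E) (v K) (mid E).
Proof. by move=> hK; case: (hJ hK). Qed.
Lemma valK K : K \in TT -> forall z, z \in K -> piece_at K (J1 K) z z = v K z.
Proof. by move=> hK; case: (hJ hK). Qed.

Let z01 : 0 <= (0 : R) <= 1. Proof. by rewrite lexx ler01. Qed.
Let o01 : 0 <= (1 : R) <= 1. Proof. by rewrite lexx ler01. Qed.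

Definition edge_trace K E : plane R -> R := J1 K (part K E).

Section OneEdge.
Variables (K : simplex R) (a b c : plane R).
Hypotheses (hK : K \in TT) (h : tri a b c) (eK : K = [fset a; b; c]).
Let E := [fset a; b].
Let n := nu E.

Lemma aK : a \in K. Proof. by rewrite eK !inE eqxx. Qed.
Lemma bK : b \in K. Proof. by rewrite eK !inE eqxx orbT. Qed.
Lemma cK : c \in K. Proof. by rewrite eK !inE eqxx orbT. Qed.

Lemma edge_trace_cubic : is_cubic (edge_trace K E).
Proof. by have [] := companion1_cubics (hctK hK) h eK. Qed.

Lemma edge_trace_a : edge_trace K E a = v K a /\ grad (edge_trace K E) a = G1 K a.
Proof.
have [] := companion1_trace (hctK hK) h eK z01; rewrite scale0r addr0 => e1 e2.
by rewrite /edge_trace /G1 e2 -e1 (valK hK) // aK.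
Qed.

Lemma edge_trace_b : edge_trace K E b = v K b /\ grad (edge_trace K E) b = G1 K b.
Proof.
have [] := companion1_trace (hctK hK) h eK o01; rewrite scale1r [a + (b - a)]addrC subrK => e1 e2.
by rewrite /edge_trace /G1 e2 -e1 (valK hK) // bK.
Qed.

Lemma edge_trace_mid : dot (grad (edge_trace K E) (2^-1 *: (a + b))) n = dot (grad (v K) (2^-1 *: (a + b))) n.
Proof. exact: (companion1_mid_normal (quadK hK) (hctK hK) (midK hK) h eK). Qed.

Lemma mean_defect_trace : mean_defect nu v J1 K E = (2 * dot (grad (v K) (2^-1 *: (a + b))) n
   - dot (grad (edge_trace K E) a) n - dot (grad (edge_trace K E) b) n) / 6.
Proof.
rewrite (mean_defectE (quadK hK) (hctK hK) (midK hK) h eK) -(quad_ends _ _ n (quadK hK)) !dotB.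
by congr (_ / _); rewrite /edge_trace -/E -/n; move: (dot _ _) (dot _ _) (dot _ _) (dot _ _) => *; ring.
Qed.

Lemma J2_edge (t : R) : 0 <= t <= 1 ->
  w K (a + t *: (b - a)) = edge_trace K E (a + t *: (b - a)) /\
  dot (G2 K (a + t *: (b - a))) n = dot (grad (edge_trace K E) (a + t *: (b - a))) n
     + mean_defect nu v J1 K E * (30 * ((1 - t) ^+ 2 * t ^+ 2)).
Proof. exact: (companion2_trace v hnu (hctK hK) h eK). Qed.

Lemma J2_derive x n' : hull K x -> 'D_n' (piece_at K (W2 K) x) x = dot (G2 K x) n'.
Proof. exact: (companion2_derive v hnu (hctK hK) h eK). Qed.

Lemma J2_mean : edge_mean E (fun x => 'D_n (piece_at K (W2 K) x) x) = 'D_n (v K) (mid E).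
Proof.
by rewrite (companion2_mean hnu (quadK hK) (hctK hK) (midK hK) h eK) mid2 // (tri_neq h).
Qed.

(** All data that determine J_2 v on the edge vanish: the values of v and the
    prescribed gradients at the ends, and the gradient of v at the midpoint. *)
Lemma J2_bdry (t : R) : on_boundary Om E -> E \in EE -> 0 <= t <= 1 ->
  w K (a + t *: (b - a)) = 0 /\ dot (G2 K (a + t *: (b - a))) n = 0.
Proof.
move=> hb hE ht; have eE : E \in edges K by rewrite eK; exact: edge_in.
have z0 z : z \in K -> z \in E -> v K z = 0 /\ G1 K z = 0.
  move=> zK zE; split.
    by case: hmor => _ _ _ hz _; apply: (hz K z hK zK); apply: hb; exact: hull_vertex.
  case: (hJ hK) => _ _ _ hz _; apply: (hz z zK).
  exists K; first exact: side_patch_self.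
  by exists E.
have iaE : a \in E by rewrite !inE eqxx.
have ibE : b \in E by rewrite !inE eqxx orbT.
have [va ga] := z0 a aK iaE; have [vb gb] := z0 b bK ibE.
have [fa fga] := edge_trace_a; have [fb fgb] := edge_trace_b.
have gm : dot (grad (v K) (2^-1 *: (a + b))) n = 0.
  by case: hmor => _ _ _ _ hz; have := hz K E hK eE hb; rewrite mid2 ?(tri_neq h) // => ->; exact: dot0l.
have k0 : mean_defect nu v J1 K E = 0 by rewrite mean_defect_trace gm fga fgb ga gb dot0l !subr0 mulr0 mul0r.
have [-> ->] := J2_edge ht.
have [-> ->] : edge_trace K E (a + t *: (b - a)) = 0 /\ dot (grad (edge_trace K E) (a + t *: (b - a))) n = dot (grad (fun=> 0 : R) (a + t *: (b - a))) n.
  apply: (@cubic_edge_eq R (edge_trace K E) (fun=> 0) a b n t edge_trace_cubic (@cubic0 R)).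
  - by rewrite fa va.
  - by rewrite fb vb.
  - by rewrite fga ga grad0.
  - by rewrite fgb gb grad0.
  - by rewrite edge_trace_mid gm grad0 dot0l.
by rewrite grad0 dot0l k0 mul0r addr0.
Qed.

End OneEdge.

Lemma J2_vertex K z : K \in TT -> z \in K -> w K z = v K z.
Proof.
move=> hK zK; have [b [c [eK h]]] := triangle_vertex (reg_tri regT hK) zK.
have [] := J2_edge hK h eK z01; rewrite scale0r addr0 => -> _.
by have [] := edge_trace_a hK h eK.
Qed.

(** The two triangles have the same side patch at z, hence the same average,
    and the gradient is set to zero on both or on none of them. *)
Lemma J1_grad_shared K K' z : K \in TT -> K' \in TT -> z \in K -> z \in K' ->
  (K `&` K')%fset \in EE -> G1 K z = G1 K' z.
Proof.
move=> hK hK' zK zK' hE.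
have eP := side_patch_eq hK zK hK' zK' hE; rewrite -/EE in eP.
case: (hJ hK) => _ _ _ hz hn; case: (hJ hK') => _ _ _ hz' hn'.
have eZ : zero_patch Om TT That K z <-> zero_patch Om TT That K' z.
  by rewrite /zero_patch -/EE eP.
have [y|y] := pselect (zero_patch Om TT That K z).
  by rewrite /G1 hz // hz' //; apply/eZ.
have y' : ~ zero_patch Om TT That K' z by move/eZ.
by rewrite /G1 (hn z zK y) (hn' z zK' y') /= -/EE eP.
Qed.

(** The two pieces share their data on the common edge: the values and
    gradients at the ends, the normal derivative at the midpoint, and with these
    the coefficient of the bubble. *)
Lemma J2_shared K K' a b c c' (t : R) : K \in TT -> K' \in TT -> K <> K' -> tri a b c -> tri a b c' ->
  K = [fset a; b; c] -> K' = [fset a; b; c'] -> (K `&` K')%fset = [fset a; b] ->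
  [fset a; b] \in EE -> 0 <= t <= 1 ->
  w K (a + t *: (b - a)) = w K' (a + t *: (b - a)) /\
  dot (G2 K (a + t *: (b - a))) (nu [fset a; b]) = dot (G2 K' (a + t *: (b - a))) (nu [fset a; b]).
Proof.
move=> hK hK' ne h h' eK eK' eI hE ht; set E := [fset a; b] in hE eI *; set n := nu E.
have ab := tri_neq h.
have eE : E \in edges K by rewrite eK; exact: edge_in.
have eE' : E \in edges K' by rewrite eK'; exact: edge_in.
have hI : (K `&` K')%fset \in EE by rewrite eI.
have [vc gm] : (forall z, z \in K -> z \in K' -> v K z = v K' z) /\ grad (v K) (2^-1 *: (a + b)) = grad (v K') (2^-1 *: (a + b)).
  case: hmor => _ hz hg _ _; split; first by move=> z zK zK'; exact: hz.
  by rewrite -mid2 //; apply: hg => //; apply/eqP.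
have ka := aK eK; have kb := bK eK; have ka' := aK eK'; have kb' := bK eK'.
have ga := J1_grad_shared hK hK' ka ka' hI; have gb := J1_grad_shared hK hK' kb kb' hI.
have [fa fga] := edge_trace_a hK h eK; have [fb fgb] := edge_trace_b hK h eK.
have [fa' fga'] := edge_trace_a hK' h' eK'; have [fb' fgb'] := edge_trace_b hK' h' eK'.
have kk : mean_defect nu v J1 K E = mean_defect nu v J1 K' E.
  by rewrite (mean_defect_trace hK h eK) (mean_defect_trace hK' h' eK') gm fga fga' fgb fgb' ga gb.
have [u1 u2] := J2_edge hK h eK ht; have [u1' u2'] := J2_edge hK' h' eK' ht.
have [q1 q2] := @cubic_edge_eq R (edge_trace K E) (edge_trace K' E) a b n t (edge_trace_cubic hK h eK) (edge_trace_cubic hK' h' eK')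
  (etrans fa (etrans (vc a ka ka') (esym fa'))) (etrans fb (etrans (vc b kb kb') (esym fb')))
  (etrans fga (etrans ga (esym fga'))) (etrans fgb (etrans gb (esym fgb')))
  (etrans (edge_trace_mid hK h eK) (etrans (congr1 (fun X => dot X n) gm) (esym (edge_trace_mid hK' h' eK')))).
split; first exact: (etrans u1 (etrans q1 (esym u1'))).
exact: (etrans u2 (etrans (f_equal2 (fun A B : R => A + B * (30 * ((1 - t) ^+ 2 * t ^+ 2))) q2 kk) (esym u2'))).
Qed.

Lemma on_edge a b c K x : tri a b c -> K = [fset a; b; c] -> hull K x -> bary K c x = 0 ->
  exists t : R, [/\ 0 <= t <= 1, x = a + t *: (b - a), bary K a x = 1 - t & bary K b x = t].
Proof.
move=> h eK; rewrite eK hull3 // bary3 // bary3b // bary3c // => -[h1 h2 h3] h0.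
have e := bary0_line h h0; have hs := bc_sum x h; rewrite h0 addr0 in hs.
exists (bc b a c x); split=> //; last by rewrite -hs addrK.
by rewrite h2 /=; slra.
Qed.

Variable uh : broken R.
Hypothesis hint : morley_interp TT That nu W2 uh.
Hypothesis href : refines TT That.

Lemma uh_val T K z : T \in That -> K \in TT -> hull T `<=` hull K -> z \in T -> uh T z = w K z.
Proof. by move=> hT hK hs zT; have [_ /(_ K hK hs) [h _]] := hint hT; exact: h. Qed.

Lemma uh_quad T : T \in That -> is_quad (uh T).
Proof. by move=> hT; have [/poly2_quad] := hint hT. Qed.

Lemma uh_mean T K E : T \in That -> K \in TT -> hull T `<=` hull K -> E \in edges T ->
  'D_(nu E) (uh T) (mid E) = edge_mean E (fun x => dot (G2 K x) (nu E)).
Proof.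
move=> hT hK hs eE; have [_ /(_ K hK hs) [_ h]] := hint hT; rewrite h //.
have [a [b [c [eK ht]]]] := reg_tri regT hK.
have [sE cE] := edgesP _ _ eE.
apply: edge_mean_ext => // x hx; apply: (J2_derive hK ht eK).
by apply: hs; exact: hull_sub (reg_tri regH hT) sE hx.
Qed.

Lemma uh_mean_coarse T K E : T \in That -> K \in TT -> hull T `<=` hull K -> E \in edges T ->
  E \in edges K -> 'D_(nu E) (uh T) (mid E) = 'D_(nu E) (v K) (mid E).
Proof.
move=> hT hK hs eT eK; have [_ /(_ K hK hs) [_ m1]] := hint hT.
have [a [b [c [eK' eE h]]]] := triangle_edge (reg_tri regT hK) eK; subst E.
exact: (etrans (m1 _ eT) (J2_mean hK h eK')).
Qed.

(** The common face of the two triangles contains two points, so it is an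
    edge. *)
Lemma coarse_edge K K' p q : K \in TT -> K' \in TT -> K <> K' -> p != q ->
  hull K p -> hull K' p -> hull K q -> hull K' q ->
  exists a b c c' (t s : R), [/\ tri a b c, tri a b c', K = [fset a; b; c], K' = [fset a; b; c'] &
   [/\ (K `&` K')%fset = [fset a; b], 0 <= t <= 1, p = a + t *: (b - a), 0 <= s <= 1 & q = a + s *: (b - a)]].
Proof.
move=> hK hK' ne pq p1 p2 q1 q2.
have [c [ck nc]] := face_split regT hK hK' ne.
have [a [b [eK h]]] := triangle_third (reg_tri regT hK) ck.
have bp := reg_face0 regT hK hK' p1 p2 ck nc; have bq := reg_face0 regT hK hK' q1 q2 ck nc.
have [t [ht ep pa pb]] := on_edge h eK p1 bp; have [s [hs eq qa qb]] := on_edge h eK q1 bq.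
have aK' : a \in K'.
  apply: contraT => na; have za := aK eK; case/negP: pq; apply/eqP; rewrite ep eq.
  have t1 := reg_face0 regT hK hK' p1 p2 za na; have s1 := reg_face0 regT hK hK' q1 q2 za na.
  by rewrite pa in t1; rewrite qa in s1; congr (_ + _ *: _); slra.
have bK' : b \in K'.
  apply: contraT => nb; have zb := bK eK; case/negP: pq; apply/eqP; rewrite ep eq.
  have t1 := reg_face0 regT hK hK' p1 p2 zb nb; have s1 := reg_face0 regT hK hK' q1 q2 zb nb.
  by rewrite pb in t1; rewrite qb in s1; rewrite t1 s1.
have [eI eE'] := shared_inter hK hK' h eK nc aK' bK'.
have [a1 [b1 [c1 [e1 e2 h1]]]] := triangle_edge (reg_tri regT hK') eE'.
exists a, b, c, c1, t, s; split=> //.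
  have [[? ?]|[? ?]] := fset2_cases (tri_neq h) e2; subst a1 b1; first exact: h1.
  exact: tri_swap.
have [[? ?]|[? ?]] := fset2_cases (tri_neq h) e2; subst a1 b1; first exact: e1.
by rewrite e1 fset3_swap.
Qed.

Lemma coarse_vertex_edge K K' x : K \in TT -> K' \in TT -> K <> K' -> hull K x -> hull K' x -> x \notin K ->
  exists a b c c' (t : R), [/\ tri a b c, tri a b c', K = [fset a; b; c], K' = [fset a; b; c'] &
   [/\ (K `&` K')%fset = [fset a; b], 0 < t < 1 & x = a + t *: (b - a)]].
Proof.
move=> hK hK' ne x1 x2 nx.
have [c [ck nc]] := face_split regT hK hK' ne.
have [a [b [eK h]]] := triangle_third (reg_tri regT hK) ck.
have bx := reg_face0 regT hK hK' x1 x2 ck nc.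
have [t [/andP[t0 t1] ex xa xb]] := on_edge h eK x1 bx.
have tn0 : t != 0.
  by apply: contraNneq nx => e; rewrite ex e scale0r addr0 (aK eK).
have tn1 : t != 1.
  by apply: contraNneq nx => e; rewrite ex e scale1r addrC subrK (bK eK).
have t0' : 0 < t by rewrite lt_neqAle eq_sym tn0.
have t1' : t < 1 by rewrite lt_neqAle tn1.
have aK' : a \in K'.
  apply: contraT => na; have := reg_face0 regT hK hK' x1 x2 (aK eK) na.
  by rewrite xa => e; slra.
have bK' : b \in K'.
  apply: contraT => nb; have := reg_face0 regT hK hK' x1 x2 (bK eK) nb.
  by rewrite xb => e; slra.
have [eI eE'] := shared_inter hK hK' h eK nc aK' bK'.
have [a1 [b1 [c1 [e1 e2 h1]]]] := triangle_edge (reg_tri regT hK') eE'.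
exists a, b, c, c1, t; split=> //; last by rewrite t0' t1'.
  have [[? ?]|[? ?]] := fset2_cases (tri_neq h) e2; subst a1 b1; first exact: h1.
  exact: tri_swap.
have [[? ?]|[? ?]] := fset2_cases (tri_neq h) e2; subst a1 b1; first exact: e1.
by rewrite e1 fset3_swap.
Qed.

Lemma inner_notin a b c (t : R) : tri a b c -> 0 < t < 1 -> a + t *: (b - a) \notin [fset a; b].
Proof.
move=> h /andP[t0 t1]; have [e1 e2 e3] := bc_edge t h.
rewrite !inE negb_or; apply/andP; split; apply/eqP => e.
  by rewrite e bc_self // in e1; lra.
by rewrite e bc_other in e1; lra.
Qed.

(** A new vertex in two coarse triangles lies inside their common edge, which
    therefore is refined, so that J_2 v is continuous there. *)
Lemma uh_continuous T T' z : T \in That -> T' \in That -> z \in T -> z \in T' -> uh T z = uh T' z.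
Proof.
move=> hT hT' zT zT'.
have [K hK sK] := href hT; have [K' hK' sK'] := href hT'.
rewrite (uh_val hT hK sK zT) (uh_val hT' hK' sK' zT').
have [->//|ne] := pselect (K = K').
have z1 := sK _ (hull_vertex zT); have z2 := sK' _ (hull_vertex zT').
have [zK|zK] := boolP (z \in K).
  have zK' : z \in K'.
    apply: contraT => nz; have := reg_face0 regT hK hK' z1 z2 zK nz.
    by rewrite (bary_vertex (reg_tri regT hK) zK zK) eqxx => /eqP; rewrite oner_eq0.
  by rewrite !J2_vertex //; case: hmor => _ hz _ _ _; exact: hz.
have [a [b [c [c' [t [h h' eK eK' [eI ht ez]]]]]]] := coarse_vertex_edge hK hK' ne z1 z2 zK.
have eE : [fset a; b] \in edges K by rewrite eK; exact: edge_in.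
have /andP[t0 t1] := ht; have ht' : 0 <= t <= 1 by rewrite !ltW.
have hE : [fset a; b] \in EE.
  apply: (not_fine_refined hK eE); apply/negP => hf.
  have /negP := inner_notin h ht; apply; rewrite -ez; apply: (fine_vertex regH hT zT hf).
  by rewrite hull2 ?(tri_neq h) //; exists t.
by rewrite ez; have [] := J2_shared hK hK' ne h h' eK eK' eI hE ht'.
Qed.

Lemma edge_ends T E : triangle T -> E \in edges T -> exists p q, [/\ E = [fset p; q], p != q, p \in T & q \in T].
Proof.
move=> hT eE; have [p [q [s [eT eE' h]]]] := triangle_edge hT eE.
by exists p, q; split=> //; [exact: tri_neq h|rewrite eT !inE eqxx|rewrite eT !inE eqxx orbT].
Qed.

Lemma sub_edge a b p q x (t s : R) : a != b -> p != q -> p = a + t *: (b - a) -> q = a + s *: (b - a) ->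
  0 <= t <= 1 -> 0 <= s <= 1 -> hull [fset p; q] x ->
  (exists r : R, 0 <= r <= 1 /\ x = a + r *: (b - a)) /\
  nu [fset p; q] = dot (nu [fset p; q]) (nu [fset a; b]) *: nu [fset a; b].
Proof.
move=> ab pq ep eq /andP[t0 t1] /andP[s0 s1]; rewrite hull2 // => -[r [/andP[r0 r1] ex]]; split.
  exists (t + r * (s - t)); split; first by apply/andP; split; nra.
  by rewrite ex ep eq; plane_ring.
have [n1' n2'] := normal_edge hnu ab; have [n3 n4] := normal_edge hnu pq.
apply: (parallel_normal n1' n2'); last by rewrite subr_eq0 eq_sym.
have st : s - t != 0 by apply: contraNneq pq => e; rewrite ep eq -[s](subrK t) e add0r.
have e : q - p = (s - t) *: (b - a) by rewrite ep eq; exact: line_diff.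
apply: (mulfI st); rewrite mulr0 -[RHS]n4 e.
by rewrite /dot /= /GRing.scale /=; ring.
Qed.

(** Both sides take the mean of the same function if the fine edge lies
    inside one coarse triangle, or inside a refined edge, where J_2 v is C^1. The
    remaining coarse edges are fine edges, and there the means are the midpoint
    values of the normal derivatives of v. *)
Lemma uh_grad_continuous T T' E : T \in That -> T' \in That -> T != T' -> E \in edges T -> E \in edges T' ->
  grad (uh T) (mid E) = grad (uh T') (mid E).
Proof.
move=> hT hT' neT eT eT'.
have [K hK sK] := href hT; have [K' hK' sK'] := href hT'.
have [p [q [eE pq pT qT]]] := edge_ends (reg_tri regH hT) eT.
have [sE' _] := edgesP _ _ eT'.
have pT' : p \in T' by apply: (fsubsetP sE'); rewrite eE !inE eqxx.
have qT' : q \in T' by apply: (fsubsetP sE'); rewrite eE !inE eqxx orbT.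
have [n1' n2'] := normal_edge hnu pq; rewrite -eE in n1' n2'.
have em : mid E = 2^-1 *: (p + q) by rewrite eE mid2.
suff H : 'D_(nu E) (uh T) (mid E) = 'D_(nu E) (uh T') (mid E).
  rewrite em; apply: (grad_mid_eq pq (uh_quad hT) (uh_quad hT') n1' n2'); [exact: uh_continuous|exact: uh_continuous|].
  by move: H; rewrite em !(is_grad_D _ (is_cubic_grad _ (is_quad_cubic (uh_quad _)))).
have [eKK|ne] := pselect (K = K').
  by rewrite (uh_mean hT hK sK eT) (uh_mean hT' hK' sK' eT') eKK.
have p1 := sK _ (hull_vertex pT); have p2 := sK' _ (hull_vertex pT').
have q1 := sK _ (hull_vertex qT); have q2 := sK' _ (hull_vertex qT').
have [a [b [c [c' [t [s [h h' eK eK' [eI ht ep hs eq]]]]]]]] := coarse_edge hK hK' ne pq p1 p2 q1 q2.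
have ab := tri_neq h.
have eEK : [fset a; b] \in edges K by rewrite eK; exact: edge_in.
have eEK' : [fset a; b] \in edges K' by rewrite eK'; exact: edge_in.
have [hf|hf] := boolP ([fset a; b] \in mesh_edges That).
  have eEE : E = [fset a; b].
    apply: (fine_edge_eq regH hT eT hf) => z; rewrite eE !inE => /orP[] /eqP ->; rewrite hull2 //.
      by exists t.
    by exists s.
  have eEK2 : E \in edges K by rewrite eEE.
  have eEK2' : E \in edges K' by rewrite eEE.
  apply: (etrans (uh_mean_coarse hT hK sK eT eEK2) (etrans _ (esym (uh_mean_coarse hT' hK' sK' eT' eEK2')))).
  have g : grad (v K) (mid E) = grad (v K') (mid E).
    by case: hmor => _ _ hz _ _; apply: (hz K K' _ hK hK' _ eEK2 eEK2'); apply/eqP.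
  have d1 := is_grad_D (nu E) (is_cubic_grad (mid E) (is_quad_cubic (quadK hK))).
  have d2 := is_grad_D (nu E) (is_cubic_grad (mid E) (is_quad_cubic (quadK hK'))).
  exact: (etrans d1 (etrans (congr1 (fun X => dot X (nu E)) g) (esym d2))).
rewrite (uh_mean hT hK sK eT) (uh_mean hT' hK' sK' eT').
have [_ cE] := edgesP _ _ eT; apply: (edge_mean_ext cE) => x hx.
have hx' : hull [fset p; q] x by rewrite -eE.
have [[r [hr ex]] en] := sub_edge ab pq ep eq ht hs hx'.
have [_ g] := J2_shared hK hK' ne h h' eK eK' eI (not_fine_refined hK eEK hf) hr.
rewrite -ex in g; rewrite -eE in en.
exact: (etrans (congr1 (dot _) en) (etrans (dotZr _ _ _) (etrans (congr1 ( *%R _) g)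
  (etrans (esym (dotZr _ _ _)) (esym (congr1 (dot _) en)))))).
Qed.

Lemma bdry_not_interior K x : K \in TT -> hull K x -> bdry Om x -> exists2 c, c \in K & bary K c x = 0.
Proof.
move=> hK hx hb; apply: contrapT => hn.
have tK := reg_tri regT hK.
have pos z : z \in K -> 0 < bary K z x.
  move=> zK; rewrite lt_neqAle; move: hx; rewrite tri_hull // => -> //; rewrite andbT.
  by apply/eqP => e; apply: hn; exists z.
apply: (bdry_not_inner oO hL hb); apply: filterS (tri_interior tK pos) => y hy.
by apply/(reg_cover regT); exists K => //; rewrite tri_hull // => z /hy/ltW.
Qed.

Lemma uh_bdry T z : T \in That -> z \in T -> bdry Om z -> uh T z = 0.
Proof.
move=> hT zT hb; have [K hK sK] := href hT; rewrite (uh_val hT hK sK zT).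
have z1 := sK _ (hull_vertex zT).
have [zK|zK] := boolP (z \in K).
  by rewrite J2_vertex //; case: hmor => _ _ _ hz _; exact: hz hb.
have [c ck h0] := bdry_not_interior hK z1 hb.
have [a [b [eK h]]] := triangle_third (reg_tri regT hK) ck.
have [t [/andP[t0 t1] ez za zb]] := on_edge h eK z1 h0.
have tn0 : t != 0 by apply: contraNneq zK => e; rewrite ez e scale0r addr0 (aK eK).
have tn1 : t != 1 by apply: contraNneq zK => e; rewrite ez e scale1r addrC subrK (bK eK).
have ht : 0 < t < 1 by rewrite !lt_neqAle tn1 eq_sym tn0 t0 t1.
have eE : [fset a; b] \in edges K by rewrite eK; exact: edge_in.
have ab := tri_neq h; rewrite ez in hb.
have oB := bdry_edge regT oO hL hK ab eE ht hb.
have hE : [fset a; b] \in EE.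
  apply: (not_fine_refined hK eE); apply/negP => hf.
  have /negP := inner_notin h ht; apply; rewrite -ez; apply: (fine_vertex regH hT zT hf).
  by rewrite hull2 //; exists t; rewrite t0 t1.
have ht' : 0 <= t <= 1 by rewrite t0 t1.
by rewrite ez; have [] := J2_bdry hK h eK oB hE ht'.
Qed.

Lemma uh_grad_bdry T E : T \in That -> E \in edges T -> on_boundary Om E -> grad (uh T) (mid E) = 0.
Proof.
move=> hT eT hb; have [K hK sK] := href hT.
have [p [q [eE pq pT qT]]] := edge_ends (reg_tri regH hT) eT.
have [n1' n2'] := normal_edge hnu pq; rewrite -eE in n1' n2'.
have em : mid E = 2^-1 *: (p + q) by rewrite eE mid2.
have pE : p \in E by rewrite eE !inE eqxx.
have qE : q \in E by rewrite eE !inE eqxx orbT.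
have up : uh T p = 0 by apply: uh_bdry => //; apply: hb; exact: hull_vertex.
have uq : uh T q = 0 by apply: uh_bdry => //; apply: hb; exact: hull_vertex.
have q0 : is_quad (fun=> 0 : R) by exists (fun _ _ => 0); split=> // x; rewrite /cubf !mul0r !addr0.
suff H : 'D_(nu E) (uh T) (mid E) = 0.
  rewrite em -[RHS](grad0 (2^-1 *: (p + q))).
  apply: (grad_mid_eq pq (uh_quad hT) q0 n1' n2') => //.
  by move: H; rewrite em (is_grad_D _ (is_cubic_grad _ (is_quad_cubic (uh_quad hT)))) => ->; rewrite grad0 dot0l.
have p1 := sK _ (hull_vertex pT); have q1 := sK _ (hull_vertex qT).
have mh : hull E (mid E).
  rewrite em eE hull2 //; exists 2^-1; split; first by apply/andP; split; slra.
  by plane_field.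
have tK := reg_tri regT hK.
have emid : mid E = p + 2^-1 *: (q - p).
  by rewrite em; plane_field.
have m1 : hull K (mid E).
  by rewrite emid; apply: hull_convex => //; apply/andP; split; slra.
have [c ck h0] := bdry_not_interior hK m1 (hb _ mh).
have [a [b [eK h]]] := triangle_third tK ck.
have bp0 : 0 <= bary K c p by move: p1; rewrite tri_hull //; apply.
have bq0 : 0 <= bary K c q by move: q1; rewrite tri_hull //; apply.
have bpq : bary K c p = 0 /\ bary K c q = 0.
  by move: h0; rewrite emid bary_line // => h0; split; slra.
have [bp bq] := bpq.
have [t [ht ep pa pb]] := on_edge h eK p1 bp; have [s [hs eq qa qb]] := on_edge h eK q1 bq.
have ab := tri_neq h.
have ts : t <> s by move=> e; move: pq; rewrite ep eq e eqxx.
have eEK : [fset a; b] \in edges K by rewrite eK; exact: edge_in.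
have oB : on_boundary Om [fset a; b].
  have := hb _ mh; have -> : mid E = a + ((t + s) / 2) *: (b - a).
    by rewrite em ep eq; plane_field.
  apply: (bdry_edge regT oO hL hK ab eEK).
  exact: mid_between.
have [hf|hf] := boolP ([fset a; b] \in mesh_edges That).
  have eEE : E = [fset a; b].
    apply: (fine_edge_eq regH hT eT hf) => z; rewrite eE !inE => /orP[] /eqP ->; rewrite hull2 //.
      by exists t.
    by exists s.
  have eEK2 : E \in edges K by rewrite eEE.
  rewrite (uh_mean_coarse hT hK sK eT eEK2) (is_grad_D _ (is_cubic_grad _ (is_quad_cubic (quadK hK)))).
  by case: hmor => _ _ _ _ hz; rewrite (hz K _ hK eEK2 hb) dot0l.
rewrite (uh_mean hT hK sK eT).
have [_ cE] := edgesP _ _ eT; rewrite -(edge_mean0 cE); apply: (edge_mean_ext cE) => x hx.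
have hx' : hull [fset p; q] x by rewrite -eE.
have [[r [hr ex]] en] := sub_edge ab pq ep eq ht hs hx'.
have [_ g] := J2_bdry hK h eK oB (not_fine_refined hK eEK hf) hr.
rewrite -ex in g; rewrite -eE in en.
exact: (etrans (congr1 (dot _) en) (etrans (dotZr _ _ _) (etrans (congr1 ( *%R _) g) (mulr0 _)))).
Qed.

Theorem morley_fine : morley Om That uh.
Proof.
split.
- by move=> T hT; have [] := hint hT.
- exact: uh_continuous.
- exact: uh_grad_continuous.
- exact: uh_bdry.
- exact: uh_grad_bdry.
Qed.

End MorleyFine.

(** * Integration over a triangle *)

Section Measure.
Local Open Scope ereal_scope.

(** The integral of a nonnegative function is a supremum over simple
    functions below it, so that monotonicity needs no measurability. The
    integrands below are put together from the pieces selected by locate. *)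
Lemma integral_mono d (T : measurableType d) (R : realType) (mu : {measure set T -> \bar R})
    (f g : T -> \bar R) :
  (forall x, 0 <= f x) -> (forall x, f x <= g x) -> \int[mu]_x f x <= \int[mu]_x g x.
Proof.
move=> f0 fg; rewrite !ge0_integralTE // => [|x]; last exact: le_trans (f0 x) (fg x).
apply: ub_ereal_sup => _ [h /= hf <-]; apply: ereal_sup_ubound; exists h => //= x.
exact: le_trans (hf x) (fg x).
Qed.

Variable R : realType.
Local Notation mu2 := (@lebesgue_measure R \x @lebesgue_measure R).

Definition line (p q s : R) : set (plane R) := [set x | (p * x.1 + q * x.2 = s)%R].

Lemma line_measurable (p q s : R) : measurable (line p q s : set (measurableTypeR R * measurableTypeR R)).
Proof.
have -> : line p q s = (fun x : measurableTypeR R * measurableTypeR R => p * x.1 + q * x.2)%R @^-1` [set s] by [].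
rewrite -[X in measurable X]setTI.
suff h : measurable_fun setT (fun x : measurableTypeR R * measurableTypeR R => p * x.1 + q * x.2)%R by apply: h.
apply: measurable_funD; apply: measurable_funM => //.
Qed.

Lemma line_null (p q s : R) : (p != 0)%R || (q != 0)%R -> mu2 (line p q s) = 0.
Proof.
move=> pq; have [q0|q0] := eqVneq q 0%R.
  rewrite q0 eqxx orbF in pq.
  have -> : line p q s = [set s / p]%R `*` setT.
    apply/seteqP; split=> x /=; rewrite /line /= q0 mul0r addr0.
      by move=> <-; split=> //; field.
    by move=> [-> _]; field.
  rewrite product_measure1E; [|exact: measurable_set1|by []].
  by rewrite [X in (X * _)%E]lebesgue_measure_set1 mul0e.
(* every vertical section of the line is a point *)
rewrite /product_measure1 (eq_integral (cst 0)) ?integral0 // => x _ /=.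
have -> : xsection (line p q s) x = [set (s - p * x) / q]%R.
  apply/seteqP; split=> y /=; rewrite /xsection /= inE /line /=.
    by move=> <-; field.
  by move=> ->; field.
exact: lebesgue_measure_set1.
Qed.

Lemma box_measure (c : plane R) (r : R) : (0 <= r)%R ->
  let B := `[(c.1 - r)%R, (c.1 + r)%R]%classic `*` `[(c.2 - r)%R, (c.2 + r)%R]%classic in
  mu2 B = ((2 * r) ^+ 2)%:E.
Proof.
move=> r0 B; rewrite /B product_measure1E //.
have h (u : R) : lebesgue_measure (`[u - r, u + r]%classic%R : set R) = (2 * r)%:E.
  rewrite lebesgue_measure_itv /= lte_fin; case: ltP => hu; first by rewrite -EFinB; congr EFin; ring.
  by congr EFin; apply/eqP; rewrite eq_le; apply/andP; split; lra.
have e : (2 * r)%:E * (2 * r)%:E = ((2 * r) ^+ 2)%:E by rewrite -EFinM expr2.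
exact: etrans (f_equal2 (fun a b : \bar R => a * b) (h c.1) (h c.2)) e.
Qed.

(** Nothing is known about f on the null set N, so it is compared with a
    function that is infinite there. *)
Lemma integral_box_lines (D N : set (plane R)) (c : plane R) (r B : R) (f : plane R -> \bar R) :
  (0 <= r)%R -> (0 <= B)%R ->
  measurable (N : set (measurableTypeR R * measurableTypeR R)) -> mu2 N = 0 ->
  (forall x, D x -> `|x.1 - c.1| <= r /\ `|x.2 - c.2| <= r)%R ->
  (forall x, D x -> 0 <= f x) -> (forall x, D x -> ~ N x -> f x <= B%:E) ->
  \int[mu2]_(x in D) f x <= (B * (2 * r) ^+ 2)%:E.
Proof.
move=> r0 B0 mN N0 hD f0 fB.
pose X : set (measurableTypeR R * measurableTypeR R) := `[(c.1 - r)%R, (c.1 + r)%R]%classic `*` `[(c.2 - r)%R, (c.2 + r)%R]%classic.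
have mX : measurable X by exact: measurableX.
rewrite integral_mkcond.
apply: (@le_trans _ _ (\int[mu2]_x (((cst B%:E) \_ X) x + ((cst (+oo : \bar R)) \_ N) x))).
  apply: integral_mono => x; first exact: erestrict_ge0.
  have p1 : 0 <= ((cst B%:E) \_ X) x by apply: erestrict_ge0 => y _; rewrite lee_fin.
  have p2 : 0 <= ((cst (+oo : \bar R)) \_ N) x by apply: erestrict_ge0 => y _; exact: leey.
  rewrite [leLHS]patchE; case: ifPn => [/set_mem hx|_]; last exact: adde_ge0.
  have [hN|hN] := pselect (N x).
    rewrite [(cst +oo \_ N) x]patchE mem_set // [_ + _]addey ?leey //.
    by rewrite gt_eqF // (lt_le_trans _ p1) // ltNyr.
  apply: (@le_trans _ _ (((cst B%:E) \_ X) x)); last by rewrite leeDl.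
  rewrite patchE mem_set ?fB //.
  have [] := hD x hx; rewrite !ler_norml /X /= !in_itv /= => /andP[? ?] /andP[? ?].
  by split; apply/andP; split; lra.
have B0' : forall y, X y -> 0 <= B%:E by move=> _ _; rewrite lee_fin.
rewrite ge0_integralD //.
- have i1 : \int[mu2]_(x in X) (cst B%:E) x = B%:E * mu2 X by exact: integral_cst.
  have i2 : \int[mu2]_(x in N) (cst (+oo : \bar R)) x = +oo * mu2 N by exact: integral_cst.
  rewrite -!integral_mkcond i1 i2 N0 mule0 adde0.
  by rewrite (box_measure c r0) EFinM.
- by move=> x _; apply: erestrict_ge0.
- by apply/(measurable_restrictT _ mX); exact: measurable_cst.
- by move=> x _; apply: erestrict_ge0 => y _; exact: leey.
- by apply/(measurable_restrictT _ mN); exact: measurable_cst.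
Qed.

(** The boundary of T lies on three lines and T in a square of side 2 r. *)
Lemma integral_triangle (T : simplex R) (c : plane R) (r B : R) (f : plane R -> \bar R) :
  triangle T -> (0 <= r)%R -> (0 <= B)%R -> hull T `<=` cball c r ->
  (forall x, 0 <= f x) ->
  (forall x, hull T x -> (forall z, z \in T -> 0 < bary T z x)%R -> f x <= B%:E) ->
  \int[mu2]_(x in hull T) f x <= (B * (2 * r) ^+ 2)%:E.
Proof.
move=> [p [q [s [eT h]]]] r0 B0 hb f0 fB; have {}h : tri p q s by [].
have hq := tri_rot h; have hs := tri_rot hq.
have zero_line (a b d : plane R) : tri a b d -> exists2 N : set (plane R),
    measurable (N : set (measurableTypeR R * measurableTypeR R)) /\ mu2 N = 0 &
    forall x, bc a b d x = 0%R -> N x.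
  move=> hab; pose u := (d - b)%R.
  exists (line u.2 (- u.1)%R (b.1 * u.2 - b.2 * u.1)%R).
    split; first exact: line_measurable.
    apply: line_null; rewrite oppr_eq0 -negb_and; apply/negP => /andP[/eqP e1 /eqP e2].
    by move: (tri_cross hab); rewrite /cross -/u e1 e2 !mulr0 subrr eqxx.
  move=> x /eqP; rewrite /bc mulf_eq0 invr_eq0 (negbTE (tri_cross hab)) orbF => /eqP.
  rewrite /cross -/u /= => e; rewrite /line /= -[RHS]addr0 -e /=; ring.
have [N1 [m1 z1] h1] := zero_line _ _ _ h; have [N2 [m2 z2] h2] := zero_line _ _ _ hq.
have [N3 [m3 z3] h3] := zero_line _ _ _ hs.
apply: (@integral_box_lines _ ((N1 `|` N2) `|` N3) c) => //.
- by apply: measurableU => //; exact: measurableU.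
- by apply: null_set_setU => //; [exact: measurableU|exact: null_set_setU].
- move=> x /hb; rewrite /cball /= => hx.
  by have [e1 e2] := enorm_comp (x - c)%R; split; [exact: le_trans e1 hx|exact: le_trans e2 hx].
move=> x hx nN; apply: fB => // z zT; rewrite lt_neqAle; apply/andP; split; last first.
  by move: hx z zT; rewrite tri_hull //; exists p, q, s.
apply: contra_notN nN => /eqP e.
move: zT; rewrite eT !inE => /orP[/orP[]|] /eqP ez; move: e; rewrite ez eT.
- by rewrite bary3 // => e; left; left; exact: h1.
- by rewrite fset3_rot bary3 // => e; left; right; exact: h2.
- by rewrite -fset3_rot bary3 // => e; right; exact: h3.
Qed.
End Measure.

(** * Jumps of the Hessian and of the gradient *)

Section JumpSize.
Variable R : realType.
Implicit Types (a b c p q x y z n : plane R) (f : plane R -> R) (T E K S F : simplex R).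

Definition mxv (A : 'M[R]_2) (e : plane R) : plane R :=
  (A 0 0 * e.1 + A 0 1 * e.2, A 1 0 * e.1 + A 1 1 * e.2).

Lemma frobenius_col (A : 'cV[R]_2) : frobenius2 A = A 0 0 ^+ 2 + A 1 0 ^+ 2.
Proof. by rewrite /frobenius2 !big_ord_recl !big_ord0 /= !addr0; congr (A _ _ ^+ 2 + A _ _ ^+ 2); apply: val_inj. Qed.

(** The tangent is the normal turned by a right angle, so A x n is A e up
    to sign and the length of e. *)
Lemma tangential_size (A : 'M[R]_2) n e : dot n n = 1 -> dot n e = 0 ->
  dot e e * frobenius2 (tangential A n) = dot (mxv A e) (mxv A e).
Proof.
move=> h1 h2; rewrite frobenius_col !mxE; have [e1 e2] := normal_coord h1 h2.
set k := e.2 * n.1 - e.1 * n.2 in e1 e2.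
have -> : dot e e = k ^+ 2 by rewrite -[RHS]mulr1 -h1 /dot [in LHS]e1 [in LHS]e2; ring.
by rewrite /dot /mxv /= e1 e2; ring.
Qed.

Lemma edge_mean_cst E (k : R) : edge_mean E (fun=> k) = k.
Proof.
by rewrite /edge_mean (@int01_poly R k 0 0 0 0) => [|t _]; rewrite !mul0r !addr0.
Qed.

Lemma len_sqr a b : a != b -> len [fset a; b] ^+ 2 = dot (b - a) (b - a).
Proof.
move=> ab; rewrite /len enorm_sqr /edge_end; have [->|->] := enum2_cases ab => //=.
by rewrite /dot /=; ring.
Qed.

Definition jump_size Om (TT : mesh R) nu (v : broken R) E : R :=
  len E * edge_int E (fun x =>
    frobenius2 (tangential (jump Om TT nu E (fun T => hess (v T) x)) (nu E))).

(** The jump of the Hessian of a piecewise quadratic is constant on the edge,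
    so the mean is trivial; one factor |E| is the weight and one comes from the
    integral. *)
Lemma jump_sizeE Om (TT : mesh R) nu (v : broken R) a b (A : 'M[R]_2) : unit_normals nu -> a != b ->
  (forall x, jump Om TT nu [fset a; b] (fun T => hess (v T) x) = A \/
     jump Om TT nu [fset a; b] (fun T => hess (v T) x) = - A) ->
  jump_size Om TT nu v [fset a; b] = dot (mxv A (b - a)) (mxv A (b - a)).
Proof.
move=> hnu ab hA; have [n1' n2'] := normal_edge hnu ab.
rewrite /jump_size /edge_int.
have -> : edge_mean [fset a; b] (fun x => frobenius2 (tangential
    (jump Om TT nu [fset a; b] (fun T => hess (v T) x)) (nu [fset a; b]))) =
    frobenius2 (tangential A (nu [fset a; b])).
  rewrite -[RHS](edge_mean_cst [fset a; b]).
  congr edge_mean; apply: funext => x; case: (hA x) => -> //.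
  by rewrite !frobenius_col !mxE; ring.
by rewrite mulrA -expr2 len_sqr // (tangential_size A n1' n2').
Qed.

Lemma jump_size_ge0 Om (TT : mesh R) nu (v : broken R) E : 0 <= jump_size Om TT nu v E.
Proof.
have l0 : 0 <= len E by exact: sqrtr_ge0.
apply: mulr_ge0 => //; apply: mulr_ge0 => //; apply: Rintegral_ge0 => t _.
by apply: sumr_ge0 => i _; apply: sumr_ge0 => j _; exact: sqr_ge0.
Qed.

Lemma grad_end f a b z (H : 'M[R]_2) :
  (forall x y, (grad f x - grad f y).1 = H 0 0 * (x - y).1 + H 0 1 * (x - y).2 /\
   (grad f x - grad f y).2 = H 1 0 * (x - y).1 + H 1 1 * (x - y).2) ->
  z \in [fset a; b] -> exists2 k : R, k ^+ 2 = 4^-1 &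
  grad f z = grad f (2^-1 *: (a + b)) + k *: mxv H (b - a).
Proof.
move=> hH; have [h1 h2] := hH z (2^-1 *: (a + b)).
rewrite !inE => /orP[] /eqP ez; [exists (- 2^-1)|exists 2^-1]; try (by field).
  rewrite -[LHS](subrK (grad f (2^-1 *: (a + b)))) addrC; congr (_ + _); apply: plane_eq.
    by rewrite h1 ez /= /GRing.scale /=; field.
  by rewrite h2 ez /= /GRing.scale /=; field.
rewrite -[LHS](subrK (grad f (2^-1 *: (a + b)))) addrC; congr (_ + _); apply: plane_eq.
  by rewrite h1 ez /= /GRing.scale /=; field.
by rewrite h2 ez /= /GRing.scale /=; field.
Qed.

Definition comp_le x (s : R) := `|x.1| <= s /\ `|x.2| <= s.

Lemma half_jump_le x (k s : R) : k ^+ 2 = 4^-1 -> dot x x = s -> comp_le (k *: x) (Num.sqrt s).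
Proof.
move=> hk hs; rewrite /comp_le /= /GRing.scale /=; have k4 : k ^+ 2 <= 1 by rewrite hk; lra.
have h (u w : R) : u ^+ 2 + w ^+ 2 = s -> `|k * u| <= Num.sqrt s.
  move=> e; rewrite -sqrtr_sqr ler_sqrt; last by rewrite -e addr_ge0 ?sqr_ge0.
  rewrite exprMn -e; have := sqr_ge0 w; have := sqr_ge0 u; nra.
by move: hs; rewrite /dot -!expr2 => hs; split; [exact: h hs|apply: (h x.2 x.1); rewrite addrC].
Qed.

Lemma comp_leD x y (s t : R) : comp_le x s -> comp_le y t -> comp_le (x + y) (s + t).
Proof. by move=> [x1 x2] [y1 y2]; split; rewrite /= (le_trans (ler_normD _ _)) // lerD. Qed.

Lemma comp_leN x (s : R) : comp_le (- x) s <-> comp_le x s.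
Proof. by rewrite /comp_le /= !normrN. Qed.

Lemma comp_le_trans x (s t : R) : s <= t -> comp_le x s -> comp_le x t.
Proof. by move=> st [h1 h2]; split; exact: le_trans st. Qed.

Section Mismatch.
Variables (Om : set (plane R)) (TT : mesh R) (nu : simplex R -> plane R) (v : broken R).
Hypothesis regT : regular_triangulation Om TT.
Hypothesis hnu : unit_normals nu.
Hypothesis oO : open Om.
Hypothesis hL : lipschitz_boundary Om.
Hypothesis hmor : morley Om TT v.
Local Notation eta := (jump_size Om TT nu v).

Let quad T : T \in TT -> is_quad (v T).
Proof. by move=> hT; case: hmor => h _ _ _ _; exact/poly2_quad/h. Qed.

(** The gradients of the two quadratics agree at the midpoint and drift apart
    linearly towards z, by the jump of the Hessian applied to half of the
    edge. *)
Lemma mismatch_inner T T' E z : T \in TT -> T' \in TT -> T <> T' -> E \in edges T -> E \in edges T' ->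
  z \in E -> comp_le (grad (v T) z - grad (v T') z) (Num.sqrt (eta E)).
Proof.
move=> hT hT' ne eT eT'; have [a [b [c [_ eE h]]]] := triangle_edge (reg_tri regT hT) eT.
have ab := tri_neq h; rewrite eE => zE.
have gm : grad (v T) (2^-1 *: (a + b)) = grad (v T') (2^-1 *: (a + b)).
  by rewrite -mid2 // -eE; case: hmor => _ _ hg _ _; apply: hg => //; apply/eqP.
have [H [HE Hd]] := quad_hess (quad hT); have [H' [HE' Hd']] := quad_hess (quad hT').
have hb : is_quad (fun x => v T x - v T' x) by exact: is_quadB (quad hT) (quad hT').
have [D [DE Dd]] := quad_hess hb.
have Dx x : hess (v T) x - hess (v T') x = D by rewrite (hessB x (quad hT) (quad hT')).
have gB x : grad (fun x => v T x - v T' x) x = grad (v T) x - grad (v T') x.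
  by apply: is_grad_grad; apply: is_gradB; apply: is_cubic_grad; apply: is_quad_cubic; exact: quad.
have [k k2] := grad_end Dd zE; rewrite !gB gm subrr add0r => ->; apply: half_jump_le => //.
rewrite (@jump_sizeE _ _ _ _ a b D) // -eE => x.
rewrite -(Dx x) opprB; exact: (jump_inner regT oO hL (fun T => hess (v T) x) hnu hT hT' eT eT' ne).
Qed.

(** The boundary condition puts zero in the place of the second quadratic. *)
Lemma mismatch_bdry T E z : T \in TT -> E \in edges T -> on_boundary Om E ->
  z \in E -> comp_le (grad (v T) z) (Num.sqrt (eta E)).
Proof.
move=> hT eT hb; have [a [b [c [_ eE h]]]] := triangle_edge (reg_tri regT hT) eT.
have ab := tri_neq h; rewrite eE => zE.
have gm : grad (v T) (2^-1 *: (a + b)) = 0.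
  by rewrite -mid2 // -eE; case: hmor => _ _ _ _ hg; apply: hg.
have [D [DE Dd]] := quad_hess (quad hT).
have [k k2] := grad_end Dd zE; rewrite gm add0r => ->; apply: half_jump_le => //.
rewrite (@jump_sizeE _ _ _ _ a b D) // -eE => x; left.
by rewrite -(DE x); exact: (jump_bdry regT oO hL nu (fun T => hess (v T) x) hT eT hb).
Qed.

End Mismatch.
End JumpSize.

(** * The reliability estimate *)

Section Reliability.
Variable R : realType.
Implicit Types (a b c p q x y z n : plane R) (f : plane R -> R) (T E K S F : simplex R).

Lemma quad_mean f a b n : a != b -> is_quad f ->
  edge_mean [fset a; b] (fun x => dot (grad f x) n) = dot (grad f (2^-1 *: (a + b))) n.
Proof.
move=> ab hf; rewrite (@edge_mean_simpson _ a b f n 0) //; [|exact: is_quad_cubic|by move=> t _; rewrite mul0r addr0].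
have m1 := quad_ends a b n hf.
by move: m1; clear; move: (dot _ _) (dot _ _) (dot _ _) => r1 r2 r3 d; lra.
Qed.

Lemma edge_mean_add E (f g : plane R -> R) (L L' : R) :
  let pt (t : R) := edge_end E 0 + t *: (edge_end E 1 - edge_end E 0) in
  (forall s t, 0 <= s <= 1 -> 0 <= t <= 1 -> `|f (pt s) - f (pt t)| <= L * `|s - t|) ->
  (forall s t, 0 <= s <= 1 -> 0 <= t <= 1 -> `|g (pt s) - g (pt t)| <= L' * `|s - t|) ->
  edge_mean E (fun x => f x + g x) = edge_mean E f + edge_mean E g.
Proof.
move=> pt hf hg; rewrite /edge_mean; apply: RintegralD => //.
  exact: (int01_lip_integrable hf).
exact: (int01_lip_integrable hg).
Qed.

Lemma frobenius2_le (A : 'M[R]_2) (y : R) : (forall i j, `|A i j| <= y) -> frobenius2 A <= (2 * y) ^+ 2.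
Proof.
move=> h; have y0 : 0 <= y by apply: le_trans (h 0 0).
have k i j : A i j ^+ 2 <= y ^+ 2 by rewrite -real_normK ?num_real // lerXn2r ?nnegrE.
rewrite /frobenius2 !big_ord_recl !big_ord0 !addr0.
have := lerD (lerD (k ord0 ord0) (k ord0 (lift ord0 ord0)))
  (lerD (k (lift ord0 ord0) ord0) (k (lift ord0 ord0) (lift ord0 ord0))).
by move/le_trans; apply; rewrite le_eqVlt; apply/orP; left; apply/eqP; ring.
Qed.

Lemma frobenius2_ge0 (A : 'M[R]_2) : 0 <= frobenius2 A.
Proof. by apply: sumr_ge0 => i _; apply: sumr_ge0 => j _; exact: sqr_ge0. Qed.

(** The bound for the Hessian carries a factor 1 / r, and the side of the
    square a factor r. *)
Lemma scaling_bound (M r r' n s : R) : 0 < r -> 0 <= r' -> r' <= M * r -> 0 <= n -> 0 <= s ->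
  (2 * (16 * (1850 * (4 * M) * (n * s) / r) * (4 * M))) ^+ 2 * (2 * r') ^+ 2 <=
  (4 * (16 * (1850 * 4) * 4) * M ^+ 3 * n) ^+ 2 * s ^+ 2.
Proof.
move=> r0 r'0 hr n0 s0; have rn : r != 0 by rewrite gt_eqF.
have M0 : 0 <= M by rewrite -(pmulr_lge0 _ r0); exact: le_trans hr.
pose Z := 4 * (16 * (1850 * 4) * 4) * M ^+ 2 * (n * s).
have Z0 : 0 <= Z / r.
  apply: divr_ge0; last exact: ltW.
  by apply: mulr_ge0; [apply: mulr_ge0; [rewrite -!natrM; exact: ler0n|exact: sqr_ge0]|exact: mulr_ge0].
rewrite -!exprMn.
have -> : 2 * (16 * (1850 * (4 * M) * (n * s) / r) * (4 * M)) * (2 * r') = Z / r * r' by rewrite /Z; field.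
have -> : 4 * (16 * (1850 * 4) * 4) * M ^+ 3 * n * s = Z / r * (M * r) by rewrite /Z; field.
have h := ler_wpM2l Z0 hr; move: (Z / r) Z0 h => {Z} w w0 h.
have p0 : 0 <= w * r' by exact: mulr_ge0.
by rewrite lerXn2r ?nnegrE // (le_trans p0).
Qed.

Lemma avg_close (P : mesh R) (G : simplex R -> plane R) g (s : R) : 0 <= s -> P != fset0 ->
  (forall T, T \in P -> comp_le (G T - g) s) ->
  comp_le ((#|` P|%:R)^-1 *: (\sum_(T <- P) G T) - g) s.
Proof.
move=> s0 P0 h; have c0 : (0 : R) < #|` P|%:R by rewrite ltr0n cardfs_gt0.
have -> : (#|` P|%:R)^-1 *: (\sum_(T <- P) G T) - g = (#|` P|%:R)^-1 *: (\sum_(T <- P) (G T - g)).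
  rewrite sumrB scalerBr; congr (_ - _).
  rewrite big_const_seq count_predT iter_addr_0 -(scaler_nat _ (g : (R^o * R^o)%type)).
  by rewrite [RHS]scalerA mulVf ?scale1r // gt_eqF.
have k : forall (pr : plane R -> R), (forall x y, pr (x + y) = pr x + pr y) -> pr 0 = 0 ->
    (forall T, T \in P -> `|pr (G T - g)| <= s) -> `|(#|` P|%:R)^-1 * pr (\sum_(T <- P) (G T - g))| <= s.
  move=> pr prD pr0 hp; rewrite (big_morph pr prD pr0) normrM gtr0_norm ?invr_gt0 // ler_pdivrMl //.
  apply: le_trans (ler_norm_sum _ _ _) _; rewrite big_seq.
  apply: le_trans (ler_sum _ (fun T hT => hp T hT)) _.
  by rewrite -big_seq big_const_seq count_predT iter_addr_0 mulr_natl.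
by split; [apply: (k fst)|apply: (k snd)] => // T hT; case: (h T hT).
Qed.

Variables (Om : set (plane R)) (TT That : mesh R) (nu : simplex R -> plane R) (v : broken R) (N : nat).
Hypothesis regT : regular_triangulation Om TT.
Hypothesis hnu : unit_normals nu.
Hypothesis oO : open Om.
Hypothesis hL : lipschitz_boundary Om.
Hypothesis hmor : morley Om TT v.
Hypothesis hN : forall z, (size [seq T : simplex R <- enum_fset TT | z \in T] <= N)%N.
Local Notation eta := (jump_size Om TT nu v).
Let EE := refined_edges TT That.

Definition star_size z : R := \sum_(F <- EE | z \in F) eta F.

Lemma star_size_ge F z : F \in EE -> z \in F -> eta F <= star_size z.
Proof.
move=> hF zF; rewrite /star_size big_mkcond (big_fsetD1 F hF) /= zF lerDl.
by apply: sumr_ge0 => G _; case: ifP => // _; exact: jump_size_ge0.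
Qed.

Lemma sqrt_star F z : F \in EE -> z \in F -> Num.sqrt (eta F) <= Num.sqrt (star_size z).
Proof. by move=> hF zF; apply: ler_wsqrtr; exact: star_size_ge. Qed.

Lemma star_path K z (s : seq (simplex R)) : {in K :: s, forall T, T \in TT /\ z \in T} ->
  path (fun T1 T2 => (T1 `&` T2)%fset \in EE) K s ->
  comp_le (grad (v (last K s)) z - grad (v K) z) ((size s)%:R * Num.sqrt (star_size z)).
Proof.
elim: s K => [|K' s IH] K hs; first by rewrite subrr mul0r /comp_le /= normr0 lexx.
move=> /= /andP[hF hp].
have [hK zK] := hs K (mem_head _ _).
have [hK' zK'] : K' \in TT /\ z \in K' by apply: hs; rewrite !inE eqxx orbT.
have zF : z \in (K `&` K')%fset by rewrite inE zK zK'.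
have cF : #|` (K `&` K')%fset| = 2%N.
  by move: hF; rewrite /EE /refined_edges inE => /andP[_ /mesh_edgeP [T _ /edgesP []]].
have eK : (K `&` K')%fset \in edges K by apply/edgesP; rewrite fsubsetIl.
have eK' : (K `&` K')%fset \in edges K' by apply/edgesP; rewrite fsubsetIr.
have ne : K' <> K.
  by move=> e; move: cF; rewrite e fsetIid (triangle_card (reg_tri regT hK)).
have h1 := mismatch_inner regT hnu oO hL hmor hK' hK ne eK' eK zF.
have h2 : comp_le (grad (v (last K' s)) z - grad (v K') z) ((size s)%:R * Num.sqrt (star_size z)).
  by apply: IH => // T hT; apply: hs; rewrite inE hT orbT.
have := comp_leD h2 (comp_le_trans (sqrt_star hF zF) h1).
by rewrite subrKA -natr1 mulrDl mul1r.
Qed.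

(** A side path without repetition is no longer than the number of triangles
    at z. *)
Lemma patch_close K T z : K \in TT -> T \in side_patch EE TT K z ->
  comp_le (grad (v T) z - grad (v K) z) (N%:R * Num.sqrt (star_size z)).
Proof.
move=> hK; rewrite !inE => /andP[hT /asboolP [s [h1 h2 <-]]].
case: (shortenP h2) => s' p' u' sub'.
have h1' : {in K :: s', forall T', T' \in TT /\ z \in T'}.
  move=> T'; rewrite inE => /predU1P[->|/sub' h]; first by apply: h1; exact: mem_head.
  by apply: h1; rewrite inE h orbT.
have := star_path h1' p'; apply: comp_le_trans.
apply: ler_wpM2r; first exact: sqrtr_ge0.
rewrite ler_nat; apply: leq_trans (hN z); apply: (@leq_trans (size (K :: s'))) => //.
apply: uniq_leq_size => // T' /h1' [a1 a2].
by rewrite mem_filter a2.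
Qed.

(** A side path leads to a triangle with a refined boundary edge at z, where
    the gradient of v is controlled by the jump on that edge. *)
Lemma zero_close K z : K \in TT -> z \in K -> zero_patch Om TT That K z ->
  comp_le (grad (v K) z) (N.+1%:R * Num.sqrt (star_size z)).
Proof.
move=> hK zK [T hT [E [eT hE hb zE]]]; have hT' := hT; rewrite !inE in hT'; have /andP[hTT _] := hT'.
have h1 := mismatch_bdry regT hnu oO hL hmor hTT eT hb zE.
have h2 := patch_close hK hT.
have := comp_leD (comp_le_trans (sqrt_star hE zE) h1) ((comp_leN _ _).2 h2).
by rewrite opprB addrC subrK -natr1 mulrDl mul1r addrC.
Qed.

Definition vertex_jumps K : R := \sum_(z <- K) star_size z.

Lemma star_ge0 z : 0 <= star_size z.
Proof. by apply: sumr_ge0 => F _; exact: jump_size_ge0. Qed.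

Lemma vertex_jumps_ge0 K : 0 <= vertex_jumps K.
Proof. by apply: sumr_ge0 => z _; exact: star_ge0. Qed.

Lemma star_le K z : z \in K -> star_size z <= vertex_jumps K.
Proof.
move=> zK; rewrite /vertex_jumps (big_fsetD1 z zK) /= lerDl.
by apply: sumr_ge0 => y _; exact: star_ge0.
Qed.

(** An edge is counted for each of its two ends and each triangle there. *)
Lemma vertex_jumps_sum : \sum_(K <- TT) vertex_jumps K <= (2 * N)%:R * \sum_(F <- EE) eta F.
Proof.
rewrite /vertex_jumps /star_size.
under eq_bigr => K _ do under eq_bigr => z _ do rewrite big_mkcond.
under eq_bigr => K _ do rewrite exchange_big.
rewrite exchange_big mulr_sumr; rewrite big_seq [leRHS]big_seq; apply: ler_sum => F hF.
have cF : #|` F| = 2%N.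
  by move: hF; rewrite /EE /refined_edges inE => /andP[_ /mesh_edgeP [T _ /edgesP []]].
have e (K : simplex R) : \sum_(z <- K) (if z \in F then eta F else 0) = \sum_(z <- F) (if z \in K then eta F else 0).
  transitivity (\sum_(z <- K | z \in F) eta F); first by rewrite [RHS]big_mkcond.
  transitivity (\sum_(z <- F | z \in K) eta F); last by rewrite big_mkcond.
  rewrite -big_filter -[RHS]big_filter; apply: perm_big; apply: uniq_perm.
  - by rewrite filter_uniq.
  - by rewrite filter_uniq.
  by move=> z; rewrite !mem_filter andbC.
under eq_bigr => K _ do rewrite e.
rewrite exchange_big /=.
have h z : \sum_(K <- TT) (if z \in K then eta F else 0) <= N%:R * eta F.
  have -> : \sum_(K <- TT) (if z \in K then eta F else 0) = \sum_(K <- TT | z \in K) eta F.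
    by rewrite [RHS]big_mkcond.
  rewrite -big_filter big_const_seq count_predT iter_addr_0 -[leLHS]mulr_natl.
  by apply: ler_wpM2r; [exact: jump_size_ge0|rewrite ler_nat; exact: hN].
apply: le_trans (ler_sum _ (fun z _ => h z)) _.
by rewrite big_const_seq count_predT iter_addr_0 -[leLHS]mulr_natl cF mulrA -natrM.
Qed.

Variables (zero : simplex R -> plane R -> Prop) (J1 : simplex R -> broken R).
Hypothesis hz : forall K z, K \in TT -> z \in K -> zero K z -> zero_patch Om TT That K z.
Hypothesis hJ : companion1 zero TT That nu v J1.

Lemma companion_close K z : K \in TT -> z \in K ->
  comp_le (grad (piece_at K (J1 K) z) z - grad (v K) z) (N.+1%:R * Num.sqrt (star_size z)).
Proof.
move=> hK zK; case: (hJ hK) => _ _ _ h0 hn; have [y|y] := pselect (zero K z).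
  by rewrite h0 // sub0r; apply/comp_leN; apply: zero_close => //; exact: hz.
have s0 := sqrtr_ge0 (star_size z).
rewrite hn //=; apply: avg_close; first exact: mulr_ge0.
  by apply/fset0Pn; exists K; exact: side_patch_self.
move=> T hT; have := patch_close hK hT; apply: comp_le_trans.
by apply: ler_wpM2r => //; rewrite ler_nat.
Qed.

Variables (uh : broken R) (M : R).
Hypothesis regH : regular_triangulation Om That.
Hypothesis hint : morley_interp TT That nu (companion2 nu v J1) uh.
Hypothesis href : refines TT That.
Hypothesis hB : forall T, T \in TT -> exists c c' r r', balls M T c c' r r'.
Hypothesis hB' : forall T, T \in That -> exists c c' r r', balls M T c c' r r'.

Let W2 := companion2 nu v J1.
Let G2 K x := grad (piece_at K (W2 K) x) x.

(** The quadratic v on K is reproduced by the interpolation, so the bound for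
    interpolants applies to the difference. *)
Lemma fine_difference K T c c' (r r' : R) (i j : 'I_2) x : K \in TT -> T \in That -> hull T `<=` hull K ->
  balls M K c c' r r' ->
  `|(hess (uh T) x - hess (v K) x) i j| <=
     16 * (1850 * (4 * M) * (N.+1%:R * Num.sqrt (vertex_jumps K)) / r) * (4 * M).
Proof.
move=> hK hT hs hb; have tK := reg_tri regT hK; have tT := reg_tri regH hT.
have [a [b [d [eK h]]]] := tK; have {}h : tri a b d by [].
have hv : is_quad (v K) by case: hmor => q _ _ _ _; exact/poly2_quad/q.
have hu : is_quad (uh T) by have [/poly2_quad] := hint hT.
have fK := balls_fat tK hb; have [r0 hr hb1 hb2] := hb.
have [e [e' [s [s' hbT]]]] := hB' hT; have fT := balls_fat tT hbT.
have [hH hmid hval _ _] := hJ hK.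
set Gam := N.+1%:R * _; set L := 1850 * _ * _ / r.
have hG z : z \in K -> `|(grad (piece_at K (J1 K) z) z - grad (v K) z).1| <= Gam /\
    `|(grad (piece_at K (J1 K) z) z - grad (v K) z).2| <= Gam.
  move=> zK; have := companion_close hK zK; apply: comp_le_trans.
  by apply: ler_wpM2l => //; apply: ler_wsqrtr; exact: star_le.
have M0 : 0 <= 4 * M.
  have ha : hull K a by apply: hull_vertex; rewrite eK !inE eqxx.
  have [_ _ hd] := fK; rewrite -(pmulr_lge0 _ r0); apply: le_trans (hd a a ha ha); exact: n1_ge0.
have G0 : 0 <= Gam by apply: mulr_ge0 => //; exact: sqrtr_ge0.
have L0 : 0 <= L.
  apply: divr_ge0; last exact: ltW.
  by apply: mulr_ge0; [apply: mulr_ge0; [exact: ler0n|exact: M0]|exact: G0].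
have lip := companion2_lip hnu hv hH hmid hval hG h eK fK.
have tay := companion2_taylor hnu hv hH hmid hval hG h eK fK.
rewrite (hessB x hu hv).
apply: (@interpolant_hess_bound R T nu _ (fun x => piece_at K (W2 K) x x - v K x) (fun x => G2 K x - grad (v K) x) s (4 * M) L hnu _ tT fT L0).
- exact: is_quadB.
- move=> p q hp hq; apply: lip; rewrite -eK; exact: hs.
- by move=> p q hp hq; apply: tay; exact: hs.
- by move=> z zT; have [_ /(_ K hK hs) [hv' _]] := hint hT; rewrite hv'.
move=> E eE; have [p [q [eE' pq pT qT]]] := edge_ends tT eE.
have [sE cE] := edgesP _ _ eE.
have [H [_ Hd]] := quad_hess hv.
set n := nu E; pose e0 := edge_end E 0; pose e1 := edge_end E 1.
pose pt (t : R) := e0 + t *: (e1 - e0).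
have hpt (t : R) : 0 <= t <= 1 -> hull T (pt t).
  have seg : hull T e0 /\ hull T e1.
    by rewrite /e0 /e1 /edge_end eE'; have [->|->] := enum2_cases pq => /=; split; exact: hull_vertex.
  by case: seg => s0 s1 ht; apply: hull_convex.
have dpt (t u : R) : pt u - pt t = (u - t) *: (e1 - e0) by exact: line_diff.
pose Gd y := G2 K y - grad (v K) y.
have [u1 u2] := unit_comp (normal_edge hnu pq).1.
have lip1 (u t : R) : 0 <= u <= 1 -> 0 <= t <= 1 ->
    `|dot (Gd (pt u)) n - dot (Gd (pt t)) n| <= 2 * L * n1 (e1 - e0) * `|u - t|.
  move=> hu' ht'.
  have tu := hs _ (hpt u hu'); have tt := hs _ (hpt t ht'); rewrite eK in tu tt.
  have [l1 l2] := lip _ _ tt tu; rewrite dpt n1Z in l1 l2.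
  rewrite -dotB; apply: le_trans (@dot_n1 R n (Gd (pt u) - Gd (pt t)) _ l1 l2) _.
  have : n1 n <= 2 by apply: unit_n1; rewrite /n eE'; exact: (normal_edge hnu pq).1.
  move/(ler_wpM2l (mulr_ge0 L0 (mulr_ge0 (normr_ge0 (u - t)) (n1_ge0 (e1 - e0))))).
  by move/le_trans; apply; rewrite le_eqVlt; apply/orP; left; apply/eqP; ring.
have lip2 (u t : R) : 0 <= u <= 1 -> 0 <= t <= 1 ->
    `|dot (grad (v K) (pt u)) n - dot (grad (v K) (pt t)) n| <= `|dot (mxv H (e1 - e0)) n| * `|u - t|.
  move=> _ _; have [d1 d2] := Hd (pt u) (pt t); rewrite dpt in d1 d2.
  rewrite -dotB -normrM le_eqVlt; apply/orP; left; apply/eqP; congr (`|_|).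
  by rewrite {1}/dot d1 d2 /mxv /dot /= /GRing.scale /=; ring.
have um : 'D_n (uh T) (mid E) = edge_mean E (fun x => dot (G2 K x) n).
  have [_ /(_ K hK hs) [_ ->]] := hint hT => //; apply: (edge_mean_ext cE) => y hy.
  by apply: (companion2_derive v hnu hH h eK); apply: hs; exact: hull_sub tT sE hy.
have cs := is_cubic_grad (mid E) (is_quad_cubic hu).
have cv := is_cubic_grad (mid E) (is_quad_cubic hv).
rewrite (is_grad_D _ (is_gradB cs cv)) dotB.
rewrite (is_grad_D _ cs) in um; rewrite um.
have -> : edge_mean E (fun x => dot (G2 K x) n) = edge_mean E (fun x => dot (Gd x) n + dot (grad (v K) x) n).
  by apply: (edge_mean_ext cE) => y _; rewrite /Gd dotB subrK.
(* the means add up, because both summands are Lipschitz and hence integrable along the edge *)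
rewrite (edge_mean_add lip1 lip2).
have -> : edge_mean E (fun x => dot (grad (v K) x) n) = dot (grad (v K) (mid E)) n.
  by rewrite eE' (quad_mean n pq hv) mid2.
by rewrite addrK.
Qed.

(** One power of M comes from the diameter of the coarse triangle, one from
    that of the fine triangle, and one from the square that contains the coarse
    triangle. *)
Definition reliability_const : R := (4 * (16 * (1850 * 4) * 4) * M ^+ 3 * N.+1%:R) ^+ 2.

(** An interior point of K lies in no other coarse triangle, so the fine
    triangle selected by locate is contained in K. *)
Lemma hess_difference K c c' (r r' : R) x : K \in TT -> balls M K c c' r r' -> hull K x ->
  (forall z, z \in K -> 0 < bary K z x) ->
  frobenius2 (hess_nc That uh x - hess_nc TT v x) <=
    (2 * (16 * (1850 * (4 * M) * (N.+1%:R * Num.sqrt (vertex_jumps K)) / r) * (4 * M))) ^+ 2.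
Proof.
move=> hK hb hx pos; apply: frobenius2_le => i j; rewrite /hess_nc.
have ex : exists2 S, S \in TT & hull S x by exists K.
have [l1 l2] := locateP ex; rewrite -(reg_interior regT hK l1 pos l2).
have /(reg_cover regH) ex' : closure Om x by apply/(reg_cover regT); exists K.
have [l3 l4] := locateP ex'; have [K' hK' hs] := href l3.
have eK := reg_interior regT hK hK' pos (hs _ l4); rewrite -eK in hs.
exact: (fine_difference i j x hK l3 hs hb).
Qed.

Lemma triangle_reliability K : K \in TT ->
  (\int[(@lebesgue_measure R \x @lebesgue_measure R)%E]_(x in hull K)
      (frobenius2 (hess_nc That uh x - hess_nc TT v x))%:E <= (reliability_const * vertex_jumps K)%:E)%E.
Proof.
move=> hK; have [c [c' [r [r' hb]]]] := hB hK; have [r0 hr hb1 hb2] := hb.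
have tK := reg_tri regT hK; have V0 := vertex_jumps_ge0 K.
have r'0 : 0 <= r'.
  have : cball c' r' c by apply/hb2/hb1; rewrite /cball /= subrr /enorm /dot !mulr0 addr0 sqrtr0 ltW.
  by rewrite /cball /=; apply: le_trans; exact: sqrtr_ge0.
apply: (le_trans (integral_triangle tK r'0 (sqr_ge0 _) hb2 _ _)).
- by move=> x; rewrite lee_fin; exact: frobenius2_ge0.
- by move=> x hx pos; rewrite lee_fin; exact: (hess_difference hK hb hx pos).
rewrite lee_fin /reliability_const -[X in _ <= _ * X](sqr_sqrtr V0).
by apply: scaling_bound => //; exact: sqrtr_ge0.
Qed.

Theorem local_reliability : reliability Om TT That nu (reliability_const * (2 * N)%:R) v uh.
Proof.
rewrite /reliability; apply: (@le_trans _ _ (\sum_(K <- TT) (reliability_const * vertex_jumps K)%:E)%E).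
  by rewrite big_seq [leRHS]big_seq; apply: lee_sum => K hK; exact: triangle_reliability.
rewrite sumEFin lee_fin -mulr_sumr -mulrA; apply: ler_wpM2l; first exact: sqr_ge0.
exact: vertex_jumps_sum.
Qed.

End Reliability.

(** * Generated triangulations and the theorem *)

Section Generated.
Variable R : realType.
Variables (Om : set (plane R)) (T0 : mesh R) (adm : mesh R -> mesh R -> Prop).
Hypothesis hadm : triangulations Om T0 adm.

Lemma generated_trans TT That : generated T0 adm TT -> Relation_Operators.clos_refl_trans _ adm TT That ->
  generated T0 adm That.
Proof. exact: Relation_Operators.rt_trans. Qed.

Lemma generated_regular TT : generated T0 adm TT -> regular_triangulation Om TT.
Proof.
move=> g; have [reg0 step] := hadm; have := Operators_Properties.clos_rt_rtn1 _ _ _ _ g.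
elim=> [//|T1 T2 h12 h01 _].
by have [] := step T1 T2 (Operators_Properties.clos_rtn1_rt _ _ _ _ h01) h12.
Qed.

Lemma generated_refines TT That : generated T0 adm TT -> Relation_Operators.clos_refl_trans _ adm TT That ->
  refines TT That.
Proof.
move=> g h; have := Operators_Properties.clos_rt_rtn1 _ _ _ _ h; elim=> [T hT|T1 T2 h12 h01 IH T hT]; first by exists T.
have g1 := generated_trans g (Operators_Properties.clos_rtn1_rt _ _ _ _ h01).
case: hadm => _ step; have [_ /(_ T hT) [T' hT' s]] := step T1 T2 g1 h12.
have [T'' hT'' s'] := IH _ hT'; exists T'' => //; exact: subset_trans s s'.
Qed.

End Generated.

Theorem theorem6p19 (R : realType) (M1 : R) :
  exists C : R,
    forall (Om : set (plane R)) (T0 : mesh R) (adm : mesh R -> mesh R -> Prop)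
      (nu : simplex R -> plane R),
      polygonal_lipschitz_domain Om ->
      triangulations Om T0 adm ->
      shape_regular M1 (generated T0 adm) ->
      unit_normals nu ->
    forall TT That : mesh R,
      generated T0 adm TT ->
      Relation_Operators.clos_refl_trans _ adm TT That ->
    forall uM : broken R, morley Om TT uM ->
      (forall (J1 : simplex R -> broken R) (uhat : broken R),
         companion1 (zero_own Om TT That) TT That nu uM J1 ->
         morley_interp TT That nu (companion2 nu uM J1) uhat ->
         reliability Om TT That nu C uM uhat) /\
      (forall (J1 : simplex R -> broken R) (uhat : broken R),
         companion1 (zero_patch Om TT That) TT That nu uM J1 ->
         morley_interp TT That nu (companion2 nu uM J1) uhat ->
         morley Om That uhat /\ reliability Om TT That nu C uM uhat).
Proof.
have [N hN] := valence M1; exists (reliability_const N M1 * (2 * N)%:R).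
move=> Om T0 adm nu [[_ oO _ _] [_ hL]] hadm hsh hnu TT That g hTT v hmor.
have g' := generated_trans g hTT.
have regT := generated_regular hadm g; have regH := generated_regular hadm g'.
have href := generated_refines hadm g hTT.
have hB T : T \in TT -> exists c c' r r', balls M1 T c c' r r' by exact: hsh.
have hB' T : T \in That -> exists c c' r r', balls M1 T c c' r r' by exact: hsh.
have {}hN := hN Om TT regT hB.
have rel zero J1 uh (hz : forall K z, K \in TT -> z \in K -> zero K z -> zero_patch Om TT That K z)
    (hJ : companion1 zero TT That nu v J1) (hi : morley_interp TT That nu (companion2 nu v J1) uh) :
    reliability Om TT That nu (reliability_const N M1 * (2 * N)%:R) v uh.
  exact: (local_reliability regT hnu oO hL hmor hN hz hJ regH hi href hB hB').
split=> J1 uh hJ hi.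
  by apply: rel hJ hi => K z hK zK h; exists K => //; exact: side_patch_self.
split; last by apply: rel hJ hi.
exact: (morley_fine regT regH hnu oO hL hmor hJ hi href).
Qed.
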